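(* Consider the system $x(t+1)=Ax(t)+Bu(t)+w(t)$, $x(0)=0$, with $$A=\begin{bmatrix} A_{11} & 0 & 0 \\ A_{21} & A_{22} & 0 \\ 0 & A_{32} & A_{33} \end{bmatrix},\quad B=\begin{bmatrix} B_1 & 0 & 0 \\ 0 & B_2 & 0 \\ 0 & 0 & B_3 \end{bmatrix},\quad x=\begin{bmatrix} x_1 \\ x_2 \\ x_3 \end{bmatrix},\quad u=\begin{bmatrix} u_1 \\ u_2 \\ u_3 \end{bmatrix},\quad w=\begin{bmatrix} w_1 \\ w_2 \\ w_3 \end{bmatrix},$$ where $\{w(t)\}$ is a sequence of mutually independent zero-mean Gaussian vectors with $\mathbf{E}\{w(k)w^T(l)\}=\begin{bmatrix} W_1 & 0 & 0 \\ 0 & W_2 & 0 \\ 0 & 0 & W_3 \end{bmatrix}\delta(k-l)$. Consider the problem of minimizing the cost $$\lim_{N\to\infty}\frac1N\,\mathbf{E}\sum_{t=0}^{N-1}\left(x^T(t)Qx(t)+u^T(t)Ru(t)\right),$$ with $Q$ positive semidefinite and $R$ positive definite, over all controllers for which, at each time $t$, $u_1(t)$ is a function of $x_1(0:t)$, $u_2(t)$ is a function of $x_1(0:t),x_2(0:t)$, and $u_3(t)$ is a function of $x_1(0:t),x_2(0:t),x_3(0:t)$. Let $\tilde A=A[2:3,2:3]$, $\tilde B=B[2:3,2:3]$, $\tilde Q=Q[2:3,2:3]$, $\tilde R=R[2:3,2:3]$. Assume that (i) $(A,B)$, $(\tilde A,\tilde B)$ and $(A_{33},B_3)$ are stabilizable,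 (ii) $(Q,A)$, $(\tilde Q,\tilde A)$ and $(Q_{33},A_{33})$ are detectable. Let $X^1,X^2,X^3$ be the positive semidefinite stabilizing solutions to the Riccati equations $$X^1=A^TX^1A+Q-A^TX^1B(B^TX^1B+R)^{-1}B^TX^1A,$$ $$X^2=\tilde A^TX^2\tilde A+\tilde Q-\tilde A^TX^2\tilde B(\tilde B^TX^2\tilde B+\tilde R)^{-1}\tilde B^TX^2\tilde A,$$ $$X^3=A_{33}^TX^3A_{33}+Q_{33}-A_{33}^TX^3B_3(B_3^TX^3B_3+R_{33})^{-1}B_3^TX^3A_{33},$$ where $X^1=[X^1_{ij}]$, $i,j=1,2,3$, is partitioned according to $x=(x_1,x_2,x_3)$ and $X^2=[X^2_{ij}]$, $i,j=1,2$, according to the dimensions of $x_2$ and $x_3$. Let $$L^1=(R+B^TX^1B)^{-1}B^TX^1A,\quad L^2=(\tilde R+\tilde B^TX^2\tilde B)^{-1}\tilde B^TX^2\tilde A,\quad L^3=(R_{33}+B_3^TX^3B_3)^{-1}B_3^TX^3A_{33}.$$ Then the optimal controller is given by $$\begin{bmatrix} \eta_1(t+1) \\ \eta_2(t+1) \end{bmatrix}=(A-BL^1)[2:3,1:3]\begin{bmatrix} x_1(t) \\ \eta_1(t) \\ \eta_2(t) \end{bmatrix},$$ $$\eta_3(t+1)=(\tilde A-\tilde BL^2)[2,1:2]\begin{bmatrix} x_2(t)-\eta_1(t) \\ \eta_3(t) \end{bmatrix},$$ $$\begin{bmatrix} u_1(t) \\ u_2(t) \\ u_3(t) \end{bmatrix}=-L^1\begin{bmatrix}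 x_1(t) \\ \eta_1(t) \\ \eta_2(t) \end{bmatrix}-\begin{bmatrix} 0 \\ L^2\begin{bmatrix} x_2(t)-\eta_1(t) \\ \eta_3(t) \end{bmatrix} \end{bmatrix}-\begin{bmatrix} 0 \\ 0 \\ L^3\left(x_3(t)-\eta_2(t)-\eta_3(t)\right) \end{bmatrix},$$ with $\eta_1(0)=0$, $\eta_2(0)=0$, $\eta_3(0)=0$, and the optimal cost is $$\mathbf{Tr}(X^1_{11}W_1)+\mathbf{Tr}(X^2_{11}W_2)+\mathbf{Tr}(X^3W_3).$$
   Context: Superscripts on $X^i$ and $L^i$ are labels, not powers. For a matrix $M=[M_{ij}]$ partitioned into blocks, $M[i:j,k:l]$ denotes the submatrix formed by block rows $i$ through $j$ and block columns $k$ through $l$; $M[i,k:l]$ means $M[i:i,k:l]$. $Q=[Q_{ij}]$ and $R=[R_{ij}]$, $i,j=1,2,3$, are symmetric and partitioned compatibly with $x=(x_1,x_2,x_3)$ and $u=(u_1,u_2,u_3)$ respectively. The matrix $A-BL^1$ is partitioned like $A$; the matrix $\tilde A-\tilde BL^2$ is partitioned into $2\times2$ blocks according to the dimensions of $x_2,x_3$. So $\eta_1$ has the dimension of $x_2$, while $\eta_2$ and $\eta_3$ have the dimension of $x_3$. $x_i(0:t)$ denotes the sequence $x_i(0),x_i(1),\dots,x_i(t)$. $\mathbf{E}$ is expectation, $\mathbf{Tr}$ is trace, and $\delta(k-l)$ equals $1$ if $k=l$ and $0$ otherwise. Detectability of $(Q,A)$ means detectability of the pair with output matrix $Q$ and state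 matrix $A$. A solution of a Riccati equation is stabilizing if the corresponding closed-loop matrix ($A-BL^1$, $\tilde A-\tilde BL^2$, $A_{33}-B_3L^3$ respectively) has all its eigenvalues in the open unit disc. *)

(* Defs.v *)
From HB Require Import structures.
From mathcomp Require Import all_boot all_order all_algebra.
From mathcomp Require Import all_classical all_reals all_analysis.
From mathcomp Require Import complex.

Set Implicit Arguments.
Unset Strict Implicit.
Unset Printing Implicit Defensive.

Import Order.TTheory GRing.Theory Num.Theory.
Import numFieldNormedType.Exports.

Local Open Scope classical_set_scope.
Local Open Scope ring_scope.

(* Matrices over the reals carry the product sigma-algebra, i.e. the one
   generated by the entries. *)
Definition mx_display : measure_display.
Proof. exact. Qed.

Section measurable_matrix.
Context {K : realType} {m n : nat}.

Definition mx_generators : set (set 'M[K]_(m, n)) :=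
  [set E | exists i j (B : set K),
             measurable B /\ E = [set M : 'M[K]_(m, n) | B (M i j)]].

Let mx_set0 : <<s mx_generators >> set0.
Proof. exact: sigma_algebra0. Qed.

Let mx_setC A : <<s mx_generators >> A -> <<s mx_generators >> (~` A).
Proof. exact: sigma_algebraC. Qed.

Let mx_bigcup (F : (set 'M[K]_(m, n))^nat) :
  (forall i, <<s mx_generators >> (F i)) ->
  <<s mx_generators >> (\bigcup_i F i).
Proof. exact: sigma_algebra_bigcup. Qed.

HB.instance Definition _ := @isMeasurable.Build mx_display 'M[K]_(m, n)
  <<s mx_generators >> mx_set0 mx_setC mx_bigcup.

End measurable_matrix.

Definition qform (K : realType) (n : nat) (M : 'M[K]_n) (v : 'cV[K]_n) : K :=
  (v^T *m M *m v) 0 0.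

Definition pos_semidef (K : realType) (n : nat) (M : 'M[K]_n) : Prop :=
  M^T = M /\ forall v, 0 <= qform M v.

Definition pos_def (K : realType) (n : nat) (M : 'M[K]_n) : Prop :=
  M^T = M /\ forall v, v != 0 -> 0 < qform M v.

(* The complex eigenvalues of a real matrix are in the open unit disc. *)
Definition schur_stable (K : realType) (n : nat) (M : 'M[K]_n) : Prop :=
  forall z : K[i], eigenvalue (map_mx (real_complex K) M) z -> `|z| < 1.

Definition stabilizable (K : realType) (n m : nat)
    (A : 'M[K]_n) (B : 'M[K]_(n, m)) : Prop :=
  exists F : 'M[K]_(m, n), schur_stable (A - B *m F).

(* [C] is the output matrix, [A] the state matrix. *)
Definition detectable (K : realType) (n p : nat)
    (C : 'M[K]_(p, n)) (A : 'M[K]_n) : Prop :=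
  exists H : 'M[K]_(n, p), schur_stable (A - H *m C).

Definition riccati_gain (K : realType) (n m : nat) (A : 'M[K]_n)
    (B : 'M[K]_(n, m)) (R : 'M[K]_m) (X : 'M[K]_n) : 'M[K]_(m, n) :=
  invmx (R + B^T *m X *m B) *m B^T *m X *m A.

Definition psd_stabilizing_riccati (K : realType) (n m : nat) (A : 'M[K]_n)
    (B : 'M[K]_(n, m)) (Q : 'M[K]_n) (R : 'M[K]_m) (X : 'M[K]_n) : Prop :=
  [/\ pos_semidef X,
      X = A^T *m X *m A + Q
          - A^T *m X *m B *m invmx (B^T *m X *m B + R) *m B^T *m X *m A
    & schur_stable (A - B *m riccati_gain A B R X)].

(* A Gaussian law on the line may be degenerate. The case distinction is needed
   because [normal_prob m 0] is not the Dirac mass at [m]. *)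
Definition gaussian_law (K : realType) (m s : K) (E : set K) : \bar K :=
  if s == 0 then \d_m E else normal_prob m s E.

Definition gaussian_vector (K : realType) (d : measure_display)
    (Omega : measurableType d) (P : probability Omega K) (n : nat)
    (X : Omega -> 'cV[K]_n) : Prop :=
  measurable_fun setT X /\
  forall a : 'rV[K]_n, exists m s : K, forall E : set K, measurable E ->
    P [set o | E ((a *m X o) 0 0)] = gaussian_law m s E.

Definition mutually_independent (K : realType) (d d' : measure_display)
    (Omega : measurableType d) (P : probability Omega K)
    (T : measurableType d') (X : nat -> Omega -> T) : Prop :=
  forall (s : seq nat) (E : nat -> set T), uniq s ->
    (forall k, measurable (E k)) ->
    P (\bigcap_(k in [set` s]) (X k @^-1` E k)) =
    (\prod_(k <- s) P (X k @^-1` E k))%E.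

Definition gaussian_white_noise (K : realType) (d : measure_display)
    (Omega : measurableType d) (P : probability Omega K) (n : nat)
    (W : 'M[K]_n) (w : nat -> Omega -> 'cV[K]_n) : Prop :=
  [/\ mutually_independent P w,
      forall k, gaussian_vector P (w k),
      forall k i, ('E_P[(fun o => w k o i 0)%R])%E = 0%E
    & forall k l i j,
        ('E_P[(fun o => w k o i 0 * w l o j 0)%R])%E = (W i j *+ (k == l))%:E].

(* A controller maps the state history x(0), ..., x(t) to the input u(t). *)
Definition controller (K : realType) (n m : nat) : Type :=
  forall t : nat, t.+1.-tuple 'cV[K]_n -> 'cV[K]_m.

(* Measurability of the three control laws is part of the class, so that the
   inputs are random vectors and the cost is an expectation. *)
Definition admissible (K : realType) (n1 n2 n3 m1 m2 m3 : nat)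
    (kappa : controller K (n1 + (n2 + n3)) (m1 + (m2 + m3))) : Prop :=
  exists (g1 : forall t, t.+1.-tuple 'cV[K]_n1 -> 'cV[K]_m1)
         (g2 : forall t, t.+1.-tuple 'cV[K]_n1 * t.+1.-tuple 'cV[K]_n2 ->
                         'cV[K]_m2)
         (g3 : forall t, t.+1.-tuple 'cV[K]_n1 * t.+1.-tuple 'cV[K]_n2
                         * t.+1.-tuple 'cV[K]_n3 -> 'cV[K]_m3),
    [/\ forall t, measurable_fun setT (g1 t),
        forall t, measurable_fun setT (g2 t),
        forall t, measurable_fun setT (g3 t)
      & forall t (h : t.+1.-tuple 'cV[K]_(n1 + (n2 + n3))),
          let h1 := map_tuple (fun x => usubmx x) h in
          let h2 := map_tuple (fun x => usubmx (dsubmx x)) h in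
          let h3 := map_tuple (fun x => dsubmx (dsubmx x)) h in
          kappa t h =
            col_mx (g1 t h1) (col_mx (g2 t (h1, h2)) (g3 t (h1, h2, h3)))].

(* The states x(0), ..., x(t) of x(t+1) = A x(t) + B u(t) + v(t), x(0) = 0, in
   closed loop with [kappa], for a given disturbance sequence [v]. *)
Fixpoint history (K : realType) (n m : nat) (A : 'M[K]_n) (B : 'M[K]_(n, m))
    (kappa : controller K n m) (v : nat -> 'cV[K]_n) (t : nat) :
    t.+1.-tuple 'cV[K]_n :=
  if t is s.+1 then
    let h := history A B kappa v s in
    rcons_tuple h (A *m tnth h ord_max + B *m kappa s h + v s)
  else [tuple 0].

Definition state (K : realType) (n m : nat) (A : 'M[K]_n) (B : 'M[K]_(n, m))
    (kappa : controller K n m) (v : nat -> 'cV[K]_n) (t : nat) : 'cV[K]_n :=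
  tnth (history A B kappa v t) ord_max.

Definition input (K : realType) (n m : nat) (A : 'M[K]_n) (B : 'M[K]_(n, m))
    (kappa : controller K n m) (v : nat -> 'cV[K]_n) (t : nat) : 'cV[K]_m :=
  kappa t (history A B kappa v t).

Lemma state0 (K : realType) (n m : nat) (A : 'M[K]_n) (B : 'M[K]_(n, m))
    (kappa : controller K n m) (v : nat -> 'cV[K]_n) :
  state A B kappa v 0 = 0.
Proof. by rewrite /state (tnth_nth 0). Qed.

Lemma stateS (K : realType) (n m : nat) (A : 'M[K]_n) (B : 'M[K]_(n, m))
    (kappa : controller K n m) (v : nat -> 'cV[K]_n) (t : nat) :
  state A B kappa v t.+1 =
  A *m state A B kappa v t + B *m input A B kappa v t + v t.
Proof.
by rewrite {1}/state (tnth_nth 0) /= nth_rcons size_tuple ltnn eqxx.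
Qed.

Lemma history_state (K : realType) (n m : nat) (A : 'M[K]_n)
    (B : 'M[K]_(n, m)) (kappa : controller K n m) (v : nat -> 'cV[K]_n)
    (t : nat) :
  history A B kappa v t = [tuple state A B kappa v s | s < t.+1].
Proof.
apply: eq_from_tnth => i; rewrite tnth_mktuple (tnth_nth 0).
elim: t i => [|t IH] i; first by rewrite (ord1 i) state0.
rewrite /= nth_rcons size_tuple; case: ltngtP => [lt_it|gt_it|eq_it].
- exact: (IH (Ordinal lt_it)).
- by have := ltn_ord i; rewrite ltnS leqNgt gt_it.
- by rewrite eq_it stateS.
Qed.

(* The cost up to time N, normalized by N (and 0 for N = 0). The expectation of
   this nonnegative variable may be +oo. *)
Definition average_cost (K : realType) (d : measure_display)
    (Omega : measurableType d) (P : probability Omega K) (n m : nat)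
    (A : 'M[K]_n) (B : 'M[K]_(n, m)) (Q : 'M[K]_n) (R : 'M[K]_m)
    (w : nat -> Omega -> 'cV[K]_n) (kappa : controller K n m) (N : nat) :
    \bar K :=
  ((N%:R^-1)%:E *
   'E_P[fun o => (\sum_(t < N)
      (qform Q (state A B kappa (w ^~ o) t)
       + qform R (input A B kappa (w ^~ o) t)))%R])%E.

(* The controller states are functions of the observed state sequence [x].
   [F1] is the closed-loop matrix A - B L^1, and [eta12] stacks eta_1 (of the
   dimension of x_2) above eta_2 (of the dimension of x_3). *)
Fixpoint eta12 (K : realType) (n1 n2 n3 : nat) (F1 : 'M[K]_(n1 + (n2 + n3)))
    (x : nat -> 'cV[K]_(n1 + (n2 + n3))) (t : nat) : 'cV[K]_(n2 + n3) :=
  if t is s.+1 then dsubmx F1 *m col_mx (usubmx (x s)) (eta12 F1 x s) else 0.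

Definition eta1 (K : realType) (n1 n2 n3 : nat) (F1 : 'M[K]_(n1 + (n2 + n3)))
    (x : nat -> 'cV[K]_(n1 + (n2 + n3))) (t : nat) : 'cV[K]_n2 :=
  usubmx (eta12 F1 x t).

Definition eta2 (K : realType) (n1 n2 n3 : nat) (F1 : 'M[K]_(n1 + (n2 + n3)))
    (x : nat -> 'cV[K]_(n1 + (n2 + n3))) (t : nat) : 'cV[K]_n3 :=
  dsubmx (eta12 F1 x t).

(* [F2] is the closed-loop matrix of the subsystem of x_2 and x_3. *)
Fixpoint eta3 (K : realType) (n1 n2 n3 : nat) (F1 : 'M[K]_(n1 + (n2 + n3)))
    (F2 : 'M[K]_(n2 + n3)) (x : nat -> 'cV[K]_(n1 + (n2 + n3))) (t : nat) :
    'cV[K]_n3 :=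
  if t is s.+1 then
    dsubmx F2 *m col_mx (usubmx (dsubmx (x s)) - eta1 F1 x s)
                        (eta3 F1 F2 x s)
  else 0.

Definition chain_controller (K : realType) (n1 n2 n3 m1 m2 m3 : nat)
    (F1 : 'M[K]_(n1 + (n2 + n3))) (F2 : 'M[K]_(n2 + n3))
    (L1 : 'M[K]_(m1 + (m2 + m3), n1 + (n2 + n3)))
    (L2 : 'M[K]_(m2 + m3, n2 + n3)) (L3 : 'M[K]_(m3, n3)) :
    controller K (n1 + (n2 + n3)) (m1 + (m2 + m3)) :=
  fun t h =>
    let x := nth 0 h in
    let x1 := usubmx (x t) in
    let x2 := usubmx (dsubmx (x t)) in
    let x3 := dsubmx (dsubmx (x t)) in
    let e1 := eta1 F1 x t in
    let e2 := eta2 F1 x t in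
    let e3 := eta3 F1 F2 x t in
    - (L1 *m col_mx x1 (col_mx e1 e2))
    - col_mx 0 (L2 *m col_mx (x2 - e1) e3)
    - col_mx 0 (col_mx 0 (L3 *m (x3 - e2 - e3))).

(* Main.v *)
Require Import Defs.
From HB Require Import structures.
From mathcomp Require Import all_boot all_order all_algebra.
From mathcomp Require Import all_classical all_reals all_analysis.
From mathcomp Require Import measurable_realfun complex zify ring lra.

(** The argument compares an arbitrary strategy with the chain controller,
    without conditional expectations or dynamic programming.

    Let F1, F2, F3 be the three closed-loop matrices, and let z1, z2, z3 be the
    responses of F1, F2, F3 to the noises (w1, 0, 0), (w2, 0) and w3. The chain
    controller reconstructs these signals: its trajectory is
    xs = z1 + (0, z2) + (0, 0, z3) with input
    us = - L1 z1 - (0, L2 z2) - (0, 0, L3 z3) ([chain_closed_loop],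
    [chain_closed_loop_input]).

    The heart of the proof is a pairing identity. If X solves a Riccati equation
    with gain L and closed-loop matrix F, if z+ = F z + om, and if
    x+ = A x + B u + e for any input u at all, then z'Qx - (Lz)'Ru equals
    z'Xx - z+'Xx+ + om'Xx+ + (Fz)'Xe ([riccati_pairing]). This is applied to
    X1, z1 and x, to X2, z2 and (x2, x3), and to X3, z3 and x3. After taking
    expectations the unwanted terms vanish. Noise at time t is orthogonal to what
    happened up to time t. Moreover z2 depends only on the second noise block,
    while x1 and u1 are functions of the first; likewise z3 depends only on the
    third block, while x1, x2, u1 and u2 are functions of the first two. What is
    left telescopes: every admissible strategy with square-integrable inputs
    satisfies
      sum over t < N of E(xs'Qx + us'Ru) = N opt - E(lam(N)'x(N)),
    where opt is the sum of the three traces and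
    lam = X1 z1 + (0, X2 z2) + (0, 0, X3 z3) ([pairing_sum]).

    Taking x = xs and u = us gives the cost of the chain controller up to a
    terminal term. For a competitor, the cost J is a quadratic form with polar
    form b, so that J(u) = 2 b(us, u) - J(us) + J(u - us), and b(us, u) is known
    from the pairing. The difference of the two trajectories is driven by no
    noise, hence detectability bounds its terminal value by its own cost
    ([detectable_bound]). Young's inequality then absorbs the terminal pairing
    into J(u - us), at the price of a multiple of E|lam(N)|^2
    ([cost_lower_bound]). All second moments of z1, z2, z3 are bounded because
    F1, F2, F3 are stable ([response_bounded]), so the deviations from N opt are
    bounded and disappear after division by N. A competitor with infinite
    expected cost needs no argument, and finite cost forces square-integrable
    inputs because R is positive definite.

    The strategies are nonlinear, so the orthogonality used above concerns
    arbitrary measurable functions of other noise entries; it is where the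
    Gaussian law enters ([noise_orthogonal]). If U and V are centred, jointly
    Gaussian and uncorrelated, then U + eV and U - eV have the same law, because
    their variances agree; comparing the expectations of their sines and cosines
    and letting e tend to 0 gives E(V cos U) = E(V sin U) = 0. Product-to-sum
    formulas show that the factors by which such relations may be multiplied form
    an algebra closed under bounded limits. Iterating a polynomial on sin(U / n),
    and then letting n grow, brings the sign of U into this algebra, hence the
    indicators of half-spaces, and Dynkin's theorem yields all events. *)

Set Implicit Arguments.
Unset Strict Implicit.
Unset Printing Implicit Defensive.

Import Order.TTheory GRing.Theory Num.Theory.
Import numFieldNormedType.Exports.

Local Open Scope classical_set_scope.
Local Open Scope ring_scope.

(** * Gaussian laws on the line *)
Section gaussian_line.
Context {K : realType}.
Local Notation mu := (@lebesgue_measure K).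

Lemma measurable_affine (a b : K) :
  measurable_fun setT (fun x : K => a + b * x).
Proof. by apply: measurable_funD => //; exact: measurable_funM. Qed.

Definition affine_map (a b : K) : measurableTypeR K -> measurableTypeR K :=
  fun x => a + b * x.

HB.instance Definition _ (a b : K) :=
  @isMeasurableFun.Build _ _ _ _ (affine_map a b) (measurable_affine a b).

(** Scaling the preimage measure by [b] gives a measure with the lengths of
    intervals, hence Lebesgue measure by uniqueness. *)
Lemma lebesgue_measure_affine (a b : K) (E : set K) : 0 < b -> measurable E ->
  (b%:E * mu (affine_map a b @^-1` E) = mu E)%E.
Proof.
move=> b0 mE; apply/esym.
pose bp : {nonneg K} := NngNum (ltW b0).
pose nu0 := mscale bp (pushforward mu (affine_map a b)).
pose nu := nu0 (measurable_affine a b).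
have nuE A : nu A = (b%:E * mu (affine_map a b @^-1` A))%E by [].
rewrite -nuE.
apply: lebesgue_measure_unique => // _ [[u v]] _ <-.
transitivity (nu `]u, v]%classic); last by [].
rewrite nuE.
have -> : affine_map a b @^-1` `]u, v] = `](u - a) / b, (v - a) / b]%classic.
  apply/seteqP; split => x /=; rewrite !in_itv /= /affine_map;
  by rewrite ltr_pdivrMr// ler_pdivlMr// ltrBlDl lerBrDl [x * b]mulrC.
rewrite !lebesgue_measure_itv /= !lte_fin ltr_pM2r ?invr_gt0// ltrD2r.
case: ifPn => uv; last by rewrite mule0.
by rewrite -!EFinD -EFinM; congr EFin; field; rewrite gt_eqF.
Qed.

Lemma ge0_integral_affine (a b : K) (f : K -> \bar K) : 0 < b ->
  measurable_fun setT f -> (forall x, 0 <= f x)%E ->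
  (\int[mu]_x f x = b%:E * \int[mu]_x f (a + b * x)%R)%E.
Proof.
move=> b0 mf f0.
pose bp : {nonneg K} := NngNum (ltW b0).
pose nu0 := mscale bp (pushforward mu (affine_map a b)).
pose nu := nu0 (measurable_affine a b).
rewrite (@eq_measure_integral _ _ _ setT nu); last first.
  by move=> A mA _; exact/esym/(lebesgue_measure_affine a b0 mA).
rewrite ge0_integral_mscale//=; congr (_ * _)%E.
by rewrite ge0_integral_pushforward.
Qed.

Lemma ge0_integral_lebesgueN (f : K -> \bar K) :
  measurable_fun setT f -> (forall x, 0 <= f x)%E ->
  (\int[mu]_x f x = \int[mu]_x f (- x)%R)%E.
Proof.
move=> mf f0.
have mN : measurable_fun setT (-%R : measurableTypeR K -> measurableTypeR K).
  exact: oppr_measurable.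
rewrite -[RHS](ge0_integral_pushforward mN mu measurableT)//.
by apply: eq_measure_integral => A mA _; exact/esym/lebesgue_measureN.
Qed.

Definition std_normal := @normal_prob K 0 1.
HB.instance Definition _ := Probability.on std_normal.

Lemma normal_probE (m s : K) (E : set K) :
  normal_prob m s E = (\int[mu]_(x in E) (normal_pdf m s x)%:E)%E.
Proof. by []. Qed.

Lemma normal_pdf_affine (m s x : K) : s != 0 ->
  `|s| * normal_pdf m s (m + `|s| * x) = normal_pdf 0 1 x.
Proof.
move=> s0; rewrite !normal_pdfE ?oner_eq0// /normal_fun.
rewrite mulrA; congr (_ * expR _).
  rewrite /normal_peak -mulrnAr -[in RHS]mulrnAr (sqrtrM _ (sqr_ge0 s)) (sqrtrM _ (sqr_ge0 1)) !sqrtr_sqr.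
  by rewrite normr1 mul1r invfM mulrA divff ?mul1r ?normr_eq0.
have s20 : s ^+ 2 != 0 by rewrite expf_neq0.
have -> : m + `|s| * x - m = `|s| * x by ring.
rewrite subr0 exprMn real_normK ?num_real//.
by field.
Qed.

Lemma measurable_normal_pdf_restrict (m s : K) (E : set K) : measurable E ->
  measurable_fun setT ((fun x => (normal_pdf m s x)%:E) \_ E).
Proof.
move=> mE; apply/(measurable_restrictT _ mE).
apply: measurable_funS measurableT _ _ => //.
by apply: measurableT_comp => //; exact: measurable_normal_pdf.
Qed.

Lemma normal_pdf_restrict_ge0 (m s : K) (E : set K) x :
  (0 <= ((fun x => (normal_pdf m s x)%:E) \_ E) x)%E.
Proof. by rewrite erestrict_ge0// => y _; rewrite lee_fin normal_pdf_ge0. Qed.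

(** Since [affine_map m `|s|] is constant for [s = 0], this makes the degenerate
    and the nondegenerate case one: every Gaussian law is an affine image of the
    standard one. *)
Lemma gaussian_lawE (m s : K) (E : set K) : measurable E ->
  gaussian_law m s E = std_normal (affine_map m `|s| @^-1` E).
Proof.
move=> mE; rewrite /gaussian_law; have [->|s0] := eqVneq s 0.
  rewrite normr0; have [mE'|mE'] := pselect (E m).
    rewrite (_ : _ @^-1` _ = setT); last first.
      by apply/seteqP; split=> // x _ /=; rewrite /affine_map mul0r addr0.
    by rewrite probability_setT diracE mem_set.
  rewrite (_ : _ @^-1` _ = set0); last first.
    by apply/seteqP; split=> // x /=; rewrite /affine_map mul0r addr0.
  by rewrite measure0 diracE memNset.
have sp : 0 < `|s| by rewrite normr_gt0.
rewrite /std_normal !normal_probE.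
rewrite [LHS]integral_mkcond [RHS]integral_mkcond.
rewrite (@ge0_integral_affine m `|s|)//; last 2 first.
- exact: measurable_normal_pdf_restrict.
- by move=> x; exact: normal_pdf_restrict_ge0.
rewrite -ge0_integralZl//=; last first.
- by move=> x _; exact: normal_pdf_restrict_ge0.
- apply: (measurableT_comp _ (measurable_affine m `|s|)).
  exact: measurable_normal_pdf_restrict.
apply: eq_integral => x _; rewrite /patch.
have -> : (x \in affine_map m `|s| @^-1` E) = (m + `|s| * x \in E).
  by apply/idP/idP => /set_mem ?; apply/mem_set.
by case: ifPn => _; rewrite ?mule0// -EFinM normal_pdf_affine.
Qed.

Lemma std_normalN (E : set K) : measurable E ->
  std_normal (-%R @^-1` E) = std_normal E.
Proof.
move=> mE; rewrite /std_normal !normal_probE.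
rewrite [LHS]integral_mkcond [RHS]integral_mkcond.
rewrite [RHS]ge0_integral_lebesgueN; last 2 first.
- exact: measurable_normal_pdf_restrict.
- by move=> x; exact: normal_pdf_restrict_ge0.
apply: eq_integral => x _; rewrite /patch.
have -> : (x \in -%R @^-1` E) = (- x \in E).
  by apply/idP/idP => /set_mem ?; apply/mem_set.
case: ifPn => // _; rewrite !normal_pdfE ?oner_eq0// /normal_fun.
by rewrite !subr0 sqrrN.
Qed.

End gaussian_line.

(** * Expectations of real random variables *)
Section mean.
Context {K : realType} {d : measure_display} {T : measurableType d}.
Variable P : probability T K.
Implicit Types (f g : T -> K) (c : K).

Definition intg f : Prop := P.-integrable setT (EFin \o f).

Definition sqint f : Prop := measurable_fun setT f /\ intg (fun o => f o ^+ 2).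

Definition mean f : K := \int[P]_o f o.

Lemma intg_measurable f : intg f -> measurable_fun setT f.
Proof. by move=> /integrableP[/measurable_EFinP]. Qed.

Lemma intg_dom g f : measurable_fun setT f -> intg g ->
  (forall o, `|f o| <= g o) -> intg f.
Proof.
move=> mf ig fg; apply: le_integrable ig => //; first exact/measurable_EFinP.
by move=> o _ /=; rewrite lee_fin (le_trans (fg o))// ler_norm.
Qed.

Lemma intgD f g : intg f -> intg g -> intg (fun o => f o + g o).
Proof. exact: integrableD. Qed.

Lemma intgZ c f : intg f -> intg (fun o => c * f o).
Proof. exact: integrableZl. Qed.

Lemma intg_cst c : intg (fun=> c).
Proof. exact: finite_measure_integrable_cst. Qed.

Lemma intgB f g : intg f -> intg g -> intg (fun o => f o - g o).
Proof. exact: integrableB. Qed.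

Lemma intgN f : intg f -> intg (fun o => - f o).
Proof. exact: integrableN. Qed.

Lemma intg_sum (I : Type) (r : seq I) (F : I -> T -> K) :
  (forall i, intg (F i)) -> intg (fun o => \sum_(i <- r) F i o).
Proof.
move=> iF; elim: r => [|i r IH].
  by under eq_fun do rewrite big_nil; exact: intg_cst.
by under eq_fun do rewrite big_cons; exact: intgD.
Qed.

Lemma mean_cst c : mean (fun=> c) = c.
Proof. by rewrite /mean Rintegral_cst//= probability_setT mulr1. Qed.

Lemma meanD f g : intg f -> intg g ->
  mean (fun o => f o + g o) = mean f + mean g.
Proof. exact: RintegralD. Qed.

Lemma meanB f g : intg f -> intg g ->
  mean (fun o => f o - g o) = mean f - mean g.
Proof. exact: RintegralB. Qed.

Lemma meanZ c f : intg f -> mean (fun o => c * f o) = c * mean f.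
Proof. exact: RintegralZl. Qed.

Lemma meanN f : intg f -> mean (fun o => - f o) = - mean f.
Proof.
move=> intf; rewrite -mulN1r -meanZ//; congr mean.
by apply/funext => o; rewrite mulN1r.
Qed.

Lemma mean_sum (I : Type) (r : seq I) (F : I -> T -> K) :
  (forall i, intg (F i)) ->
  mean (fun o => \sum_(i <- r) F i o) = \sum_(i <- r) mean (F i).
Proof.
move=> iF; elim: r => [|i r IH].
  by under eq_fun do rewrite big_nil; rewrite mean_cst big_nil.
under eq_fun do rewrite big_cons.
by rewrite meanD//; [rewrite IH big_cons|exact: intg_sum].
Qed.

Lemma mean_ge0 f : (forall o, 0 <= f o) -> 0 <= mean f.
Proof. by move=> f0; apply: Rintegral_ge0. Qed.

Lemma mean_le f g : intg f -> intg g -> (forall o, f o <= g o) ->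
  mean f <= mean g.
Proof. by move=> intf ig fg; apply: le_Rintegral. Qed.

Lemma EFin_mean f : intg f -> (mean f)%:E = (\int[P]_o (f o)%:E)%E.
Proof.
by move=> intf; rewrite /mean /Rintegral fineK//; exact: integrable_fin_num.
Qed.

Lemma intgM f g : sqint f -> sqint g -> intg (fun o => f o * g o).
Proof.
move=> [mf if2] [mg ig2].
apply: (@intg_dom (fun o => f o ^+ 2 + g o ^+ 2)).
- exact: measurable_funM.
- exact: intgD.
- by move=> o; rewrite ler_norml; apply/andP; split; nra.
Qed.

Lemma sqint_intg f : sqint f -> intg f.
Proof.
move=> [mf if2]; apply: (@intg_dom (fun o => f o ^+ 2 + 1)) => //.
  by apply: intgD => //; exact: intg_cst.
by move=> o; rewrite ler_norml; apply/andP; split; nra.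
Qed.

Lemma sqintD f g : sqint f -> sqint g -> sqint (fun o => f o + g o).
Proof.
move=> [mf if2] [mg ig2]; split; first exact: measurable_funD.
apply: (@intg_dom (fun o => 2 * f o ^+ 2 + 2 * g o ^+ 2)).
- by apply: measurable_funX; exact: measurable_funD.
- by apply: intgD; exact: intgZ.
- move=> o; rewrite ger0_norm ?sqr_ge0//.
  by have := sqr_ge0 (f o - g o); nra.
Qed.

Lemma sqintZ c f : sqint f -> sqint (fun o => c * f o).
Proof.
move=> [mf if2]; split; first exact: measurable_funM.
by under eq_fun do rewrite exprMn; exact: intgZ.
Qed.

Lemma sqint_cst c : sqint (fun=> c).
Proof. by split => //; exact: intg_cst. Qed.

Lemma sqint_sum (I : Type) (r : seq I) (F : I -> T -> K) :
  (forall i, sqint (F i)) -> sqint (fun o => \sum_(i <- r) F i o).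
Proof.
move=> iF; elim: r => [|i r IH].
  by under eq_fun do rewrite big_nil; exact: sqint_cst.
by under eq_fun do rewrite big_cons; exact: sqintD.
Qed.

Lemma ge0_intg f : measurable_fun setT f -> (forall o, 0 <= f o) ->
  (\int[P]_o (f o)%:E < +oo)%E -> intg f.
Proof.
move=> mf f0 foo; apply/integrableP; split; first exact/measurable_EFinP.
by under eq_integral do rewrite /= ger0_norm//.
Qed.

(** The form in which dominated convergence is used: relations [mean f = 0] pass to
    dominated pointwise limits. *)
Lemma mean_lim0 (f_ : nat -> T -> K) f g :
  (forall n, measurable_fun setT (f_ n)) -> intg g ->
  (forall n o, `|f_ n o| <= g o) -> (forall o, f_ ^~ o @ \oo --> f o) ->
  (forall n, mean (f_ n) = 0) -> mean f = 0.
Proof.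
move=> mf_ ig fg cf f0.
have mf : measurable_fun setT f.
  by apply: (measurable_fun_cvg (h := f_)) => // o _; exact: cf.
have [||||| _ _ lim] := @dominated_convergence _ _ _ P _ measurableT
  (fun n => EFin \o f_ n) (EFin \o f) (EFin \o g) => //.
- by move=> n; exact/measurable_EFinP.
- exact/measurable_EFinP.
- by apply: aeW => o _; apply: cvg_EFin; [exact: nearW|exact: cf].
- by apply: aeW => o n _ /=; rewrite lee_fin.
have : (fun=> 0 : \bar K) @ \oo --> (\int[P]_o (f o)%:E)%E.
  rewrite (_ : (fun=> 0) = (fun n => \int[P]_o (f_ n o)%:E)%E)//.
  apply/funext => n; rewrite -EFin_mean ?f0//.
  exact: intg_dom (mf_ n) ig _.
by move=> /cvg_lim H; rewrite /mean /Rintegral -H// lim_cst.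
Qed.

End mean.

(** * Transport of expectations along equal laws *)
Section transport.
Context {K : realType} {d : measure_display} {T : measurableType d}.
Variable P : probability T K.

Lemma ge0_integral_transport (d' : measure_display) (T' : measurableType d')
    (P' : probability T' K) (Y : T -> K) (Y' : T' -> K) :
  measurable_fun setT Y -> measurable_fun setT Y' ->
  (forall E : set K, measurable E -> P (Y @^-1` E) = P' (Y' @^-1` E)) ->
  forall h : K -> \bar K, measurable_fun setT h -> (forall y, 0 <= h y)%E ->
  (\int[P]_o h (Y o) = \int[P']_o h (Y' o))%E.
Proof.
move=> mY mY' YY' h mh h0.
rewrite -[LHS](ge0_integral_pushforward mY P measurableT mh); last by move=> y _.
rewrite -[RHS](ge0_integral_pushforward mY' P' measurableT mh); last by move=> y _.
by apply: eq_measure_integral => A mA _; exact: YY'.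
Qed.

Lemma intg_transport (d' : measure_display) (T' : measurableType d')
    (P' : probability T' K) (Y : T -> K) (Y' : T' -> K) :
  measurable_fun setT Y -> measurable_fun setT Y' ->
  (forall E : set K, measurable E -> P (Y @^-1` E) = P' (Y' @^-1` E)) ->
  forall h : K -> K, measurable_fun setT h -> intg P (h \o Y) ->
  intg P' (h \o Y').
Proof.
move=> mY mY' YY' h mh /integrableP[_ iY]; apply/integrableP; split.
  exact/measurable_EFinP/measurableT_comp.
rewrite -(ge0_integral_transport mY mY' YY' (h := fun y => `|(h y)%:E|%E))//.
by apply: measurableT_comp => //; exact/measurable_EFinP.
Qed.

Lemma mean_transport (d' : measure_display) (T' : measurableType d')
    (P' : probability T' K) (Y : T -> K) (Y' : T' -> K) :
  measurable_fun setT Y -> measurable_fun setT Y' ->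
  (forall E : set K, measurable E -> P (Y @^-1` E) = P' (Y' @^-1` E)) ->
  forall h : K -> K, measurable_fun setT h -> intg P (h \o Y) ->
  mean P (h \o Y) = mean P' (h \o Y').
Proof.
move=> mY mY' YY' h mh iY; rewrite /mean /Rintegral; congr fine.
have mh' : measurable_fun setT (EFin \o h) by exact/measurable_EFinP.
have iY' := intg_transport mY mY' YY' mh iY.
transitivity (\int[pushforward P Y]_y (h y)%:E)%E.
  by rewrite (integral_pushforward mY mh').
transitivity (\int[pushforward P' Y']_y (h y)%:E)%E.
  by apply: eq_measure_integral => A mA _; exact: YY'.
by rewrite (integral_pushforward mY' mh').
Qed.

End transport.

(** * Centred Gaussian laws are determined by their variance *)
Section gaussian_moments.
Context {K : realType}.
Local Notation std := (@std_normal K).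
Local Notation idK := (fun y : K => y).

(** The standard normal law is symmetric. *)
Lemma mean_std_normal : intg std idK -> mean std idK = 0.
Proof.
move=> iid; apply/eqP; rewrite -[_ == _](mulrn_eq0 _ 2) mulr2n.
rewrite addr_eq0 -meanN//; apply/eqP.
apply: (@mean_transport _ _ _ std _ _ std idK -%R _ _ _ idK) => //.
by move=> E mE; exact/esym/std_normalN.
Qed.

(** A vanishing second moment would concentrate the law at 0, but points have
    Lebesgue measure 0. *)
Lemma mean_std_normal_sqr_gt0 : sqint std idK ->
  0 < mean std (fun y => y ^+ 2).
Proof.
move=> [_ i2]; rewrite lt0r mean_ge0 ?andbT; last by move=> y; exact: sqr_ge0.
apply/eqP => m0.
have m2 : measurable_fun setT (fun y : measurableTypeR K => (y ^+ 2)%:E).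
  by apply/measurable_EFinP; exact: measurable_funX.
have /(ae_eq_integral_abs std measurableT m2) : (\int[std]_y `|(y ^+ 2)%:E| = 0)%E.
  under eq_integral do rewrite gee0_abs ?lee_fin ?sqr_ge0//.
  by rewrite -EFin_mean// m0.
case=> N [mN N0 sub].
have : std (N `|` [set 0]) = 1%E.
  rewrite (_ : _ `|` _ = setT) ?probability_setT//.
  apply/seteqP; split => // y _; have [->|y0] := eqVneq y 0; first by right.
  left; apply: sub => /= /(_ I) [] /eqP; rewrite mulf_eq0 orbb.
  by rewrite (negPf y0).
have s00 : std [set 0] = 0%E.
  rewrite /std_normal normal_probE integral_set1//.
rewrite measureU0//= ?N0.
by move=> /eqP; rewrite eq_sym onee_eq0.
Qed.

Context {d : measure_display} {T : measurableType d}.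
Variable P : probability T K.

(** Stated through [gaussian_law], so that the law of [Y] may be degenerate. *)
Definition gaussian_rv (Y : T -> K) : Prop := measurable_fun setT Y /\
  exists m s : K, forall E : set K, measurable E ->
    P [set o | E (Y o)] = gaussian_law m s E.

(** By [gaussian_lawE] the law is the image of the standard one under
    [affine_map m s]. Zero mean forces [m = 0], so [s] is the only parameter left.
    Integrability of the standard normal variable is not computed from its density
    but inherited from [Y] when [s] is nonzero. *)
Lemma centered_gaussian_moment (Y : T -> K) : gaussian_rv Y -> sqint P Y ->
  mean P Y = 0 ->
  exists s : K, [/\ 0 <= s,
    forall E : set K, measurable E -> P (Y @^-1` E) = std (( *%R s) @^-1` E),
    s != 0 -> sqint std idK
    & mean P (fun o => Y o ^+ 2) = s ^+ 2 * mean std (fun y => y ^+ 2)].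
Proof.
move=> [mY [m [s lawY]]] iY EY.
have mA : measurable_fun setT (affine_map m `|s|) := measurable_affine m `|s|.
have tr E : measurable E -> P (Y @^-1` E) = std (affine_map m `|s| @^-1` E).
  by move=> mE; rewrite -gaussian_lawE// -lawY.
have EYm : mean std (affine_map m `|s|) = 0.
  by rewrite -EY; apply/esym; exact: (mean_transport mY mA tr (h := idK) _ (sqint_intg iY)).
have sqid : s != 0 -> sqint std idK.
  move=> s0.
  have sA : sqint std (affine_map m `|s|).
    split=> //; apply: (intg_transport mY mA tr (h := fun y => y ^+ 2)).
      exact: measurable_funX.
    by case: iY.
  rewrite (_ : idK = fun y => `|s|^-1 * (affine_map m `|s| y + - m)).
    by apply: sqintZ; apply: sqintD => //; exact: sqint_cst.
  apply/funext => y; rewrite /affine_map addrC addKr mulrA mulVf ?mul1r//.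
  by rewrite normr_eq0.
have m0 : m = 0.
  move: EYm; have [->|s0] := eqVneq s 0.
    rewrite normr0 (_ : affine_map m 0 = fun=> m) ?mean_cst//.
    by apply/funext => y; rewrite /affine_map mul0r addr0.
  have iid := sqint_intg (sqid s0).
  rewrite meanD; [|exact: intg_cst|exact: intgZ].
  by rewrite mean_cst meanZ// mean_std_normal// mulr0 addr0.
exists `|s|; split => //.
- by move=> E mE; rewrite tr//; congr std; rewrite /affine_map m0; under eq_fun do rewrite add0r.
- by rewrite normr_eq0.
have -> : mean P (fun o => Y o ^+ 2) = mean std (fun y => affine_map m `|s| y ^+ 2).
  apply: (mean_transport mY mA tr (h := fun y => y ^+ 2)); last by case: iY.
  exact: measurable_funX.
rewrite (_ : (fun y => _) = fun y => `|s| ^+ 2 * y ^+ 2); last first.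
  by apply/funext => y; rewrite /affine_map m0 add0r exprMn.
have [->|/sqid[_ i2]] := eqVneq s 0; last exact: meanZ.
by rewrite normr0 expr0n /= mul0r; under eq_fun do rewrite mul0r; rewrite mean_cst.
Qed.

(** The variance fixes the scale [s] of [centered_gaussian_moment], because the
    second moment of the standard normal law is nonzero. *)
Lemma centered_gaussian_eq_law (Y Y' : T -> K) :
  gaussian_rv Y -> gaussian_rv Y' -> sqint P Y -> sqint P Y' ->
  mean P Y = 0 -> mean P Y' = 0 ->
  mean P (fun o => Y o ^+ 2) = mean P (fun o => Y' o ^+ 2) ->
  forall E : set K, measurable E -> P (Y @^-1` E) = P (Y' @^-1` E).
Proof.
move=> gY gY' iY iY' EY EY' v E mE.
have [s [s0 -> // si sv]] := centered_gaussian_moment gY iY EY.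
have [s' [s'0 -> // si' sv']] := centered_gaussian_moment gY' iY' EY'.
suff -> : s = s' by [].
move: v; rewrite sv sv'.
have [ss|ss] := pselect (s != 0 \/ s' != 0); last first.
  by case/not_orP: ss => /negP; rewrite negbK => /eqP -> /negP; rewrite negbK => /eqP ->.
have sq : sqint std idK by case: ss.
have mu2 := mean_std_normal_sqr_gt0 sq.
move/mulIf => /(_ (lt0r_neq0 mu2)) /eqP.
by rewrite eqrXn2// => /eqP.
Qed.

End gaussian_moments.

(** * Approximation of the sign by sines *)
Section trig.
Context {K : realType}.
Implicit Types x y : K.

(** Mean value theorem on the segment from 0 to [`|x|]. *)
Lemma norm_sin_le x : `|sin x| <= `|x|.
Proof.
have [c _] := @MVT_segment K sin cos 0 `|x| (normr_ge0 x)
  (fun y _ => is_derive_sin y) (continuous_subspaceT (@continuous_sin K)).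
rewrite sin0 !subr0 => sx.
have -> : `|sin x| = `|sin `|x| |.
  by have [//|] := lerP 0 x => [x0|x0]; rewrite ?(ger0_norm x0)// (ltr0_norm x0) sinN normrN.
by rewrite sx normrM normr_id ler_piMl// cos_max.
Qed.

(** The derivative of the sine at 0 along the sequence [x / n.+1]. *)
Lemma cvg_sin_div x : n.+1%:R * sin (n.+1%:R^-1 * x) @[n --> \oo] --> x.
Proof.
have [->|x0] := eqVneq x 0.
  by under eq_fun do rewrite mulr0 sin0 mulr0; exact: cvg_cst.
have cd : h^-1 *: ((sin \o shift 0) (h *: (1 : K^o)) - sin 0) @[h --> 0^']
    --> ('D_(1 : K^o) sin 0 : K) by exact: derivable_sin.
move: cd; rewrite (@derive_val _ _ _ _ _ _ _ (is_derive_sin 0)) cos0.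
move=> /cvgr_dnbhsP /(_ (fun n => n.+1%:R^-1 * x)) H.
have {}H : (n.+1%:R^-1 * x)^-1 * sin (n.+1%:R^-1 * x) @[n --> \oo] --> (1 : K).
  rewrite (_ : (fun n => _) = (fun n => (n.+1%:R^-1 * x)^-1 *:
      ((sin \o shift 0) (n.+1%:R^-1 * x *: (1 : K^o)) - sin 0))); last first.
    apply/funext => n /=; rewrite sin0 subr0 addr0 /GRing.scale /=.
    by rewrite mulr1.
  apply: H; split; first by move=> n; rewrite mulf_neq0// invr_neq0.
  rewrite -[X in _ --> X](mul0r x); apply: cvgMl; exact: cvg_harmonic.
rewrite -[X in _ --> X]mul1r.
rewrite (_ : (fun n => _) = (fun n => (n.+1%:R^-1 * x)^-1 *
    sin (n.+1%:R^-1 * x) * x)); first by apply: cvgM => //; exact: cvg_cst.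
by apply/funext => n; rewrite invfM invrK mulrAC divfK.
Qed.

(** A polynomial fixing -1, 0 and 1 for which -1 and 1 attract and 0 repels the
    points of [[-1, 1]]; its iterates tend to the sign while staying polynomial in
    [y]. *)
Definition smoothstep (y : K) : K := (3 * y - y ^+ 3) / 2.

Lemma smoothstep_range y : `|y| <= 1 -> `|smoothstep y| <= 1.
Proof.
rewrite !ler_norml /smoothstep => /andP[yN1 y1].
have := mulr_ge0 (sqr_ge0 (1 - y)) (_ : 0 <= 2 + y).
have := mulr_ge0 (sqr_ge0 (1 + y)) (_ : 0 <= 2 - y).
by move=> /(_ ltac:(lra)) h1 /(_ ltac:(lra)) h2; apply/andP; split; lra.
Qed.

Lemma iter_smoothstep_range n y : `|y| <= 1 -> `|iter n smoothstep y| <= 1.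
Proof. by move=> y1; elim: n => // n IH; exact: smoothstep_range. Qed.

Lemma iter_smoothstepN n y :
  iter n smoothstep (- y) = - iter n smoothstep y.
Proof.
elim: n => //= n ->; rewrite /smoothstep exprNn -signr_odd /=; lra.
Qed.

(** Each step multiplies the distance to 1 by at most [1 - y / 2], since the iterates
    never fall below [y]. *)
Lemma iter_smoothstep_gt0 n y : 0 < y <= 1 ->
  y <= iter n smoothstep y <= 1 /\
  1 - iter n smoothstep y <= (1 - y / 2) ^+ n.
Proof.
move=> /andP[y0 y1]; elim: n => [|n [/andP[IH1 IH2] IH3]].
  by rewrite /= expr0 lexx y1; split => //; lra.
rewrite /= exprS; move: IH1 IH2 IH3; set z := iter _ _ _ => IH1 IH2 IH3.
have z0 : 0 <= z by lra.
have z1 : 0 <= 1 - z by lra.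
have h1 : 0 <= z * (1 - z) * (1 + z) by rewrite !mulr_ge0//; lra.
have h2 : 0 <= (1 - z) ^+ 2 * (2 + z) by rewrite mulr_ge0 ?sqr_ge0//; lra.
have h3 : 0 <= (1 - z) * (z - y + z ^+ 2).
  by rewrite mulr_ge0// addr_ge0 ?sqr_ge0//; lra.
split; first by rewrite /smoothstep; apply/andP; split; lra.
apply: (@le_trans _ _ ((1 - y / 2) * (1 - z))); last first.
  by apply: ler_wpM2l => //; lra.
by rewrite /smoothstep; lra.
Qed.

Lemma cvg_iter_smoothstep y : `|y| <= 1 ->
  iter n smoothstep y @[n --> \oo] --> Num.sg y.
Proof.
have pos (z : K) : 0 < z <= 1 -> iter n smoothstep z @[n --> \oo] --> (1 : K).
  move=> /andP[z0 z1].
  have q1 : `|1 - z / 2| < 1 by rewrite ltr_norml; apply/andP; split; lra.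
  apply: (@squeeze_cvgr _ _ _ _ (fun n => 1 - (1 - z / 2) ^+ n) (fun=> 1)).
  - apply: nearW => n.
    have [/andP[_ ->] H] := @iter_smoothstep_gt0 n z (introT andP (conj z0 z1)).
    by rewrite andbT lerBlDr -lerBlDl.
  - rewrite -[X in _ --> X]subr0; apply: cvgB; first exact: cvg_cst.
    exact: cvg_expr.
  - exact: cvg_cst.
rewrite ler_norml => /andP[yN1 y1].
have [y0|y0|->] := ltrgt0P y.
- by rewrite gtr0_sg//; apply: pos; rewrite y0.
- rewrite ltr0_sg// -[y]opprK; under eq_fun do rewrite iter_smoothstepN.
  by apply: cvgN; apply: pos; rewrite oppr_gt0 y0 lerNl.
- rewrite sgr0; rewrite (_ : (fun n => _) = fun=> 0); first exact: cvg_cst.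
  by apply/funext; elim => //= n ->; rewrite /smoothstep expr0n /= mulr0 subr0 mul0r.
Qed.

(** Dividing by a large number brings [y] into the interval around 0 where the sine
    has the sign of its argument. *)
Lemma cvg_sg_sin (y : K) : Num.sg (sin (n.+1%:R^-1 * y)) @[n --> \oo] --> Num.sg y.
Proof.
have [->|y0] := eqVneq y 0.
  by under eq_fun do rewrite mulr0 sin0; exact: cvg_cst.
have pos (z : K) : 0 < z -> \forall n \near \oo, 0 < sin (n.+1%:R^-1 * z).
  move=> z0; near=> n; apply: sin_gt0_pi; rewrite mulr_gt0 ?invr_gt0//=.
  rewrite mulrC ltr_pdivrMr// (@le_lt_trans _ _ (n%:R * pi))//.
    apply: le_trans (_ : n%:R <= _); first by near: n; exact: nbhs_infty_ger.
    by rewrite ler_peMr//; apply: le_trans (@pi_ge2 K); lra.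
  by rewrite mulrC ltr_pM2l ?pi_gt0// ltr_nat.
apply: cvg_near_cst; have [y0'|y0'] : 0 < y \/ y < 0.
- by case: ltrgt0P y0; [left|right|].
- apply: filterS (pos _ y0') => n sn.
  by rewrite (gtr0_sg y0') (gtr0_sg sn).
- have Ny0 : 0 < - y by rewrite oppr_gt0.
  apply: filterS (pos _ Ny0) => n; rewrite mulrN sinN oppr_gt0 => sn.
  by rewrite (ltr0_sg y0') (ltr0_sg sn).
Unshelve. all: by end_near. Qed.

End trig.

(** * Uncorrelated Gaussian pairs *)
Section uncorrelated.
Context {K : realType} {d : measure_display} {T : measurableType d}.
Variable P : probability T K.
Local Notation mean := (mean P).
Local Notation intg := (intg P).
Local Notation sqint := (sqint P).

Lemma measurable_sin_comp (U : T -> K) :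
  measurable_fun setT U -> measurable_fun setT (fun o => sin (U o)).
Proof.
move=> mU; apply: measurableT_comp => //.
by apply: continuous_measurable_fun; exact: continuous_sin.
Qed.

Lemma measurable_cos_comp (U : T -> K) :
  measurable_fun setT U -> measurable_fun setT (fun o => cos (U o)).
Proof.
move=> mU; apply: measurableT_comp => //.
by apply: continuous_measurable_fun; exact: continuous_cos.
Qed.

Lemma intgM_bounded (f g : T -> K) M : intg f -> measurable_fun setT g ->
  (forall o, `|g o| <= M) -> intg (fun o => f o * g o).
Proof.
move=> fi mg gM; apply: (@intg_dom _ _ _ _ (fun o => M * `|f o|)).
- by apply: measurable_funM => //; exact: intg_measurable fi.
- apply: intgZ; apply: (@intg_dom _ _ _ _ (fun o => `|f o|)).
  + by apply: measurableT_comp => //; exact: intg_measurable fi.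
  + exact: integrable_norm.
  + by move=> o; rewrite normr_id.
- by move=> o; rewrite normrM mulrC ler_wpM2r.
Qed.

(** [U + e * V] and [U - e * V] are centred Gaussian with the same variance, so the
    expectations of their sines and cosines agree. The addition formulas turn this
    into E(sin U sin (eV)) = E(cos U sin (eV)) = 0, and dividing by [e] and letting
    [e] tend to 0 replaces sin (eV) by [V]. *)
Lemma gaussian_uncorrelated_trig (U V : T -> K) :
  (forall e : K, gaussian_rv P (fun o => U o + e * V o)) ->
  sqint U -> sqint V -> mean U = 0 -> mean V = 0 ->
  mean (fun o => U o * V o) = 0 ->
  mean (fun o => V o * cos (U o)) = 0 /\ mean (fun o => V o * sin (U o)) = 0.
Proof.
move=> gUV U2 V2 U0 V0 UV0.
have W2 e : sqint (fun o => U o + e * V o) by apply: sqintD => //; exact: sqintZ.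
have W0 e : mean (fun o => U o + e * V o) = 0.
  rewrite meanD ?meanZ ?U0 ?V0 ?mulr0 ?addr0//; try exact: sqint_intg.
  by apply: intgZ; exact: sqint_intg.
have Wv e : mean (fun o => (U o + e * V o) ^+ 2) =
    mean (fun o => U o ^+ 2) + e ^+ 2 * mean (fun o => V o ^+ 2).
  rewrite (_ : (fun o => _) = (fun o => (U o ^+ 2 + (2 * e) * (U o * V o)) +
     e ^+ 2 * V o ^+ 2)); last by apply/funext => o; ring.
  have iU := U2.2; have iV := V2.2; have iUV := intgM U2 V2.
  rewrite meanD ?meanD ?meanZ ?UV0 ?mulr0 ?addr0//; try exact: intgZ.
  by apply: intgD => //; exact: intgZ.
have law e (h : K -> K) : measurable_fun setT h -> (forall x, `|h x| <= 1) ->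
    mean (fun o => h (U o + e * V o)) = mean (fun o => h (U o + (- e) * V o)).
  move=> mh h1.
  apply: (mean_transport (Y := fun o => U o + e * V o)
           (Y' := fun o => U o + (- e) * V o)) => //.
  - exact: (W2 _).1.
  - exact: (W2 _).1.
  - by apply: centered_gaussian_eq_law => //; rewrite !Wv sqrrN.
  - rewrite (_ : _ \o _ = fun o => 1 * h (U o + e * V o)); last first.
      by apply/funext => o; rewrite mul1r.
    apply: (intgM_bounded (intg_cst P 1) _ (M := 1)) => // .
    by apply: measurableT_comp => //; exact: (W2 _).1.
have mU := U2.1; have mV := V2.1.
have bnd (f g : T -> K) : measurable_fun setT f -> measurable_fun setT g ->
  (forall o, `|f o| <= 1) -> (forall o, `|g o| <= 1) -> intg (fun o => f o * g o).
  move=> mf mg f1 g1; apply: (intgM_bounded _ mg g1).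
  rewrite (_ : f = fun o => 1 * f o); last by apply/funext => o; rewrite mul1r.
  exact: (intgM_bounded (intg_cst P 1) mf f1).
have meV e : measurable_fun setT (fun o => e * V o) by exact: measurable_funM.
have ss e : mean (fun o => sin (U o) * sin (e * V o)) = 0.
  have mc := continuous_measurable_fun (@continuous_cos K).
  have := law e cos mc (@cos_max K).
  rewrite (_ : (fun o => _) = (fun o => cos (U o) * cos (e * V o) -
    sin (U o) * sin (e * V o))); last by apply/funext => o; rewrite cosD.
  rewrite [X in _ = mean X](_ : _ = (fun o => cos (U o) * cos (e * V o) +
    sin (U o) * sin (e * V o))); last first.
    by apply/funext => o; rewrite mulNr cosB.
  rewrite meanB ?meanD; try (apply: bnd => //; do ?[exact: measurable_cos_comp |
    exact: measurable_sin_comp | by move=> o; exact: cos_max | by move=> o; exact: sin_max]).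
  lra.
have cs e : mean (fun o => cos (U o) * sin (e * V o)) = 0.
  have ms := continuous_measurable_fun (@continuous_sin K).
  have := law e sin ms (@sin_max K).
  rewrite (_ : (fun o => _) = (fun o => sin (U o) * cos (e * V o) +
    cos (U o) * sin (e * V o))); last by apply/funext => o; rewrite sinD.
  rewrite [X in _ = mean X](_ : _ = (fun o => sin (U o) * cos (e * V o) -
    cos (U o) * sin (e * V o))); last first.
    by apply/funext => o; rewrite mulNr sinB.
  rewrite meanB ?meanD; try (apply: bnd => //; do ?[exact: measurable_cos_comp |
    exact: measurable_sin_comp | by move=> o; exact: cos_max | by move=> o; exact: sin_max]).
  lra.
have lim (g : T -> K) : measurable_fun setT g -> (forall o, `|g o| <= 1) ->
    (forall e, mean (fun o => g o * sin (e * V o)) = 0) ->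
    mean (fun o => V o * g o) = 0.
  move=> mg g1 H.
  apply: (@mean_lim0 _ _ _ _
    (fun n o => (n.+1%:R * sin (n.+1%:R^-1 * V o)) * g o) _ (fun o => `|V o|)).
  - move=> n; apply: measurable_funM => //; apply: measurable_funM => //.
    exact/measurable_sin_comp.
  - exact/integrable_norm/sqint_intg.
  - move=> n o; rewrite !normrM -[leRHS]mulr1 ler_pM//.
    rewrite normr_nat mulrC -ler_pdivlMr ?ltr0Sn//.
    by rewrite (le_trans (norm_sin_le _))// normrM normfV normr_nat mulrC.
  - by move=> o; apply: cvgM; [exact: cvg_sin_div|exact: cvg_cst].
  - move=> n; rewrite (_ : (fun o => _) = (fun o => n.+1%:R *
      (g o * sin (n.+1%:R^-1 * V o)))); last by apply/funext => o; ring.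
    rewrite meanZ ?H ?mulr0//; apply: bnd => //; last by move=> o; exact: sin_max.
    exact: measurable_sin_comp.
by split; apply: lim => //; do ?[exact: measurable_cos_comp |
    exact: measurable_sin_comp | by move=> o; exact: cos_max | by move=> o; exact: sin_max].
Qed.

End uncorrelated.

(** * The algebra of trigonometric multipliers *)
Section trig_multiplier.
Context {K : realType} {d : measure_display} {T : measurableType d}.
Variable P : probability T K.
Local Notation mean := (mean P).
Local Notation intg := (intg P).
Variables (V : T -> K) (phase : (T -> K) -> Prop).
Hypothesis intgV : intg V.
Hypothesis phase_measurable : forall u, phase u -> measurable_fun setT u.
Hypothesis phaseD : forall u v, phase u -> phase v -> phase (fun o => u o + v o).
Hypothesis phaseZ : forall c u, phase u -> phase (fun o => c * u o).

Definition bounded_mfun (h : T -> K) : Prop :=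
  measurable_fun setT h /\ exists M, forall o, `|h o| <= M.

(** Taken for all phases of a vector space of functions, this says that [V] is
    orthogonal to the products of [h] with all trigonometric polynomials in them. *)
Definition trig_orthogonal (h : T -> K) : Prop := forall u, phase u ->
  mean (fun o => V o * (h o * cos (u o))) = 0 /\
  mean (fun o => V o * (h o * sin (u o))) = 0.

(** The factors that preserve [trig_orthogonal]. Unlike the orthogonal functions
    themselves, they form an algebra, which lets polynomials act on them. *)
Definition trig_multiplier (m : T -> K) : Prop := bounded_mfun m /\
  forall h, bounded_mfun h -> trig_orthogonal h ->
    trig_orthogonal (fun o => h o * m o).

Lemma bounded_mfunD f g : bounded_mfun f -> bounded_mfun g ->
  bounded_mfun (fun o => f o + g o).
Proof.
move=> [mf [M fM]] [mg [N gN]]; split; first exact: measurable_funD.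
by exists (M + N) => o; rewrite (le_trans (ler_normD _ _))// lerD.
Qed.

Lemma bounded_mfunM f g : bounded_mfun f -> bounded_mfun g ->
  bounded_mfun (fun o => f o * g o).
Proof.
move=> [mf [M fM]] [mg [N gN]]; split; first exact: measurable_funM.
by exists (M * N) => o; rewrite normrM ler_pM.
Qed.

Lemma bounded_mfun_cst c : bounded_mfun (fun=> c).
Proof. by split => //; exists `|c|. Qed.

Lemma bounded_mfun_sin u : measurable_fun setT u ->
  bounded_mfun (fun o => sin (u o)).
Proof.
by move=> mu; split; [exact: measurable_sin_comp|exists 1 => o; exact: sin_max].
Qed.

Lemma bounded_mfun_cos u : measurable_fun setT u ->
  bounded_mfun (fun o => cos (u o)).
Proof.
by move=> mu; split; [exact: measurable_cos_comp|exists 1 => o; exact: cos_max].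
Qed.

Lemma intgV_bounded h : bounded_mfun h -> intg (fun o => V o * h o).
Proof. by move=> [mh [M hM]]; exact: intgM_bounded hM. Qed.

Let mcos u := fun pu => bounded_mfun_cos (@phase_measurable u pu).
Let msin u := fun pu => bounded_mfun_sin (@phase_measurable u pu).

Lemma trig_orthogonalD f g : bounded_mfun f -> bounded_mfun g ->
  trig_orthogonal f -> trig_orthogonal g ->
  trig_orthogonal (fun o => f o + g o).
Proof.
move=> bf bg tf tg u pu; have [f1 f2] := tf _ pu; have [g1 g2] := tg _ pu.
have [c s] := (mcos pu, msin pu).
by split; under eq_fun do rewrite mulrDl mulrDr;
  rewrite meanD ?f1 ?f2 ?g1 ?g2 ?addr0//; apply: intgV_bounded;
  exact: bounded_mfunM.
Qed.

Lemma trig_orthogonalZ c f : bounded_mfun f ->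
  trig_orthogonal f -> trig_orthogonal (fun o => c * f o).
Proof.
move=> bf tf u pu; have [f1 f2] := tf _ pu.
have [co s] := (mcos pu, msin pu).
by split; under eq_fun do rewrite -mulrA mulrCA;
  rewrite meanZ ?f1 ?f2 ?mulr0//; apply: intgV_bounded; exact: bounded_mfunM.
Qed.

Lemma trig_multiplierD m n : trig_multiplier m -> trig_multiplier n ->
  trig_multiplier (fun o => m o + n o).
Proof.
move=> [bm tm] [bn tn]; split; first exact: bounded_mfunD.
move=> h bh th; under eq_fun do rewrite mulrDr.
by apply: trig_orthogonalD;
  [exact: bounded_mfunM|exact: bounded_mfunM|exact: tm|exact: tn].
Qed.

Lemma trig_multiplierM m n : trig_multiplier m -> trig_multiplier n ->
  trig_multiplier (fun o => m o * n o).
Proof.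
move=> [bm tm] [bn tn]; split; first exact: bounded_mfunM.
move=> h bh th; under eq_fun do rewrite mulrA.
by apply: tn; [exact: bounded_mfunM|exact: tm].
Qed.

Lemma trig_multiplier_cst c : trig_multiplier (fun=> c).
Proof.
split; first exact: bounded_mfun_cst.
by move=> h bh th; under eq_fun do rewrite mulrC; exact: trig_orthogonalZ.
Qed.

(** Product-to-sum formulas: multiplying by the sine of a phase shifts the other
    phase by it. *)
Lemma trig_multiplier_sin v : phase v -> trig_multiplier (fun o => sin (v o)).
Proof.
move=> pv; split; first exact: msin.
move=> h bh th u pu.
have puv : phase (fun o => u o + v o) by exact: phaseD.
have pvu : phase (fun o => u o + (- 1) * v o).
  by apply: phaseD => //; exact: phaseZ.
have [c1 s1] := th _ puv; have [c2 s2] := th _ pvu.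
have bc w : phase w -> intg (fun o => V o * (h o * cos (w o))).
  by move=> pw; apply: intgV_bounded; apply: bounded_mfunM => //; exact: mcos.
have bs w : phase w -> intg (fun o => V o * (h o * sin (w o))).
  by move=> pw; apply: intgV_bounded; apply: bounded_mfunM => //; exact: msin.
split.
- rewrite (_ : (fun o => _) = (fun o => 2^-1 *
    (V o * (h o * sin (u o + v o)) - V o * (h o * sin (u o + (- 1) * v o))))).
    have [i1 i2] := (bs _ puv, bs _ pvu).
    by rewrite meanZ; [rewrite meanB// s1 s2 subrr mulr0|exact: intgB].
  by apply/funext => o; rewrite mulN1r sinB sinD; field.
- rewrite (_ : (fun o => _) = (fun o => 2^-1 *
    (V o * (h o * cos (u o + (- 1) * v o)) - V o * (h o * cos (u o + v o))))).
    have [i1 i2] := (bc _ puv, bc _ pvu).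
    by rewrite meanZ; [rewrite meanB// c1 c2 subrr mulr0|exact: intgB].
  by apply/funext => o; rewrite mulN1r cosB cosD; field.
Qed.

(** Dominated convergence, with a multiple of [`|V|] as dominating function. *)
Lemma trig_multiplier_lim (m_ : nat -> T -> K) m M :
  (forall n, trig_multiplier (m_ n)) -> (forall n o, `|m_ n o| <= M) ->
  (forall o, m_ ^~ o @ \oo --> m o) -> trig_multiplier m.
Proof.
move=> tm mM cm; have mm n := (tm n).1.1.
have bm : bounded_mfun m.
  split; first by apply: (measurable_fun_cvg (h := m_)) => // o _; exact: cm.
  exists M => o; have : `|m_ n o| @[n --> \oo] --> `|m o|.
    by apply: cvg_norm; exact: cm.
  move/cvg_lim => <-//; apply: limr_le; last exact: nearW.
  by apply: is_cvg_norm; apply/cvg_ex; exists (m o); exact: cm.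
split => // h bh th u pu.
have lim g : bounded_mfun g -> (forall n, mean (fun o => V o * (h o * m_ n o * g o)) = 0) ->
    mean (fun o => V o * (h o * m o * g o)) = 0.
  move=> bg; have [mh [H hH]] := bh; have [mg [G gG]] := bg.
  have mV := intg_measurable intgV.
  apply: (@mean_lim0 _ _ _ _ _ _ (fun o => (H * M * G) * `|V o|)).
  - by move=> n; do 3 ?apply: measurable_funM => //.
  - by apply: intgZ; exact: integrable_norm.
  - move=> n o; rewrite !normrM mulrC ler_wpM2r// ler_pM ?mulr_ge0//.
    by rewrite ler_pM.
  - move=> o; apply: cvgM; first exact: cvg_cst.
    apply: cvgM; last exact: cvg_cst.
    by apply: cvgM; [exact: cvg_cst|exact: cm].
by split; apply: lim; do ?[exact: mcos|exact: msin] => n;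
  have [//] := (tm n).2 _ bh th _ pu.
Qed.

Lemma trig_multiplier_smoothstep m n : trig_multiplier m ->
  trig_multiplier (fun o => iter n smoothstep (m o)).
Proof.
move=> tm; elim: n => //= n IH; rewrite (_ : (fun o => _) = (fun o =>
  iter n smoothstep (m o) * (3 / 2 +
  (- 2^-1) * (iter n smoothstep (m o) * iter n smoothstep (m o))))); last first.
  by apply/funext => o; rewrite /smoothstep; field.
apply: trig_multiplierM => //; apply: trig_multiplierD.
  exact: trig_multiplier_cst.
by apply: trig_multiplierM; [exact: trig_multiplier_cst|exact: trig_multiplierM].
Qed.

(** Two limits: smoothstep iterates of [sin (v / n.+1)] tend to its sign, and this
    sign tends to the sign of [v]. Multipliers are stable under polynomials and
    bounded limits. *)
Lemma trig_multiplier_sg v : phase v -> trig_multiplier (fun o => Num.sg (v o)).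
Proof.
move=> pv; apply: (@trig_multiplier_lim
  (fun n o => Num.sg (sin (n.+1%:R^-1 * v o))) _ 1).
- move=> n; apply: (@trig_multiplier_lim
    (fun k o => iter k smoothstep (sin (n.+1%:R^-1 * v o))) _ 1).
  + by move=> k; apply/trig_multiplier_smoothstep/trig_multiplier_sin/phaseZ.
  + by move=> k o; apply: iter_smoothstep_range; exact: sin_max.
  + by move=> o; apply: cvg_iter_smoothstep; exact: sin_max.
- by move=> n o; rewrite normr_sg; case: (_ != _); rewrite ?normr1 ?normr0.
- by move=> o; exact: cvg_sg_sin.
Qed.

Lemma trig_multiplier_lt0 v : phase v ->
  trig_multiplier (fun o => (v o < 0)%R%:R).
Proof.
move=> pv; rewrite (_ : (fun o => _) = (fun o => 2^-1 *
    (Num.sg (v o) * Num.sg (v o) + (- 1) * Num.sg (v o)))).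
  have ts := trig_multiplier_sg pv.
  apply: trig_multiplierM; first exact: trig_multiplier_cst.
  apply: trig_multiplierD; first exact: trig_multiplierM.
  by apply: trig_multiplierM => //; exact: trig_multiplier_cst.
by apply/funext => o; case: sgrP => _ /=; field.
Qed.

End trig_multiplier.

(** * From orthogonality on events to orthogonality on functions *)
Section orthogonal_sets.
Context {K : realType} {d d0 : measure_display}.
Context {T : measurableType d} {T0 : measurableType d0}.
Variable P : probability T K.
Variables (X : T -> T0) (V : T -> K).
Hypothesis mX : measurable_fun setT X.
Hypothesis iV : intg P V.
Hypothesis orthV : forall E, measurable E ->
  mean P (fun o => V o * \1_E (X o)) = 0.

Import HBNNSimple.

Lemma intg_indic_comp E : measurable E -> intg P (fun o => V o * \1_E (X o)).
Proof.
move=> mE; apply: (@intgM_bounded _ _ _ _ _ _ 1) => //.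
  by apply: (measurableT_comp _ mX); exact: measurable_indic.
by move=> o; rewrite indicE; case: (_ \in _); rewrite ?normr1 ?normr0.
Qed.

Lemma orthogonal_nnsfun (h : {nnsfun T0 >-> K}) :
  mean P (fun o => V o * h (X o)) = 0.
Proof.
rewrite (_ : (fun o => _) = (fun o => \sum_(r <- finmap.enum_fset (fset_set (range h)))
    r * (V o * \1_(h @^-1` [set r]) (X o)))); last first.
  apply/funext => o; rewrite {1}fimfunE fsbig_finite//= mulr_sumr.
  by apply: eq_bigr => r _; rewrite mulrCA.
have mh r : measurable (h @^-1` [set r]) by exact: measurable_funPTI.
rewrite mean_sum => [|r]; last by apply: intgZ; exact: intg_indic_comp.
rewrite big1// => r _; rewrite meanZ; last exact: intg_indic_comp.
by rewrite orthV// mulr0.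
Qed.

Let orthogonal_ge0 (g : T0 -> K) : measurable_fun setT g ->
  (forall x, 0 <= g x) -> intg P (fun o => V o * g (X o)) ->
  mean P (fun o => V o * g (X o)) = 0.
Proof.
move=> mg g0 ig; have mg' : measurable_fun setT (EFin \o g).
  exact/measurable_EFinP.
pose h := nnsfun_approx measurableT mg'.
have ch x : h ^~ x @ \oo --> g x.
  apply: (@fine_cvg _ _ _ _ (fun n => (h n x)%:E) (g x)).
  by apply: (cvg_nnsfun_approx measurableT mg') => // y _; rewrite lee_fin.
apply: (@mean_lim0 _ _ _ _ (fun n o => V o * h n (X o)) _
  (fun o => `|V o * g (X o)|)).
- move=> n; apply: measurable_funM; first exact: intg_measurable iV.
  exact: measurableT_comp.
- exact: integrable_norm.
- move=> n o; rewrite !normrM ler_wpM2l// (ger0_norm (g0 _)) ger0_norm//.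
  have /cvg_lim <- // := ch (X o).
  apply: nondecreasing_cvgn_le; last by apply/cvg_ex; exists (g (X o)); exact: ch.
  move=> p q pq; have /lefP := nd_nnsfun_approx measurableT mg' pq.
  exact.
- by move=> o; apply: cvgM; [exact: cvg_cst|exact: ch].
- by move=> n; exact: orthogonal_nnsfun.
Qed.

(** Approximation of the positive and negative parts of [g] by simple functions. *)
Lemma orthogonal_comp (g : T0 -> K) : measurable_fun setT g ->
  intg P (fun o => V o * g (X o)) -> mean P (fun o => V o * g (X o)) = 0.
Proof.
move=> mg ig.
have mV := intg_measurable iV.
(* Positive and negative part are each dominated by [`|V * g|], so that the
   nonnegative case applies to both. *)
pose gp x := Num.max (g x) 0; pose gn x := Num.max (- g x) 0.
have mgp : measurable_fun setT gp by exact: measurable_maxr.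
have mgn : measurable_fun setT gn by apply: measurable_maxr => //; exact: measurable_funN.
have igp : intg P (fun o => V o * gp (X o)).
  apply: (@intg_dom _ _ _ _ (fun o => `|V o * g (X o)|)); last first.
  - move=> o; rewrite !normrM ler_wpM2l// /gp.
    by case: (leP (g (X o)) 0) => H; rewrite ?normr0.
  - exact: integrable_norm.
  - by apply: measurable_funM => //; exact: measurableT_comp.
have ign : intg P (fun o => V o * gn (X o)).
  apply: (@intg_dom _ _ _ _ (fun o => `|V o * g (X o)|)); last first.
  - move=> o; rewrite !normrM ler_wpM2l// /gn.
    by case: (leP (- g (X o)) 0) => H; rewrite ?normr0// normrN.
  - exact: integrable_norm.
  - by apply: measurable_funM => //; exact: measurableT_comp.
rewrite (_ : (fun o => _) = (fun o => V o * gp (X o) - V o * gn (X o))).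
  rewrite meanB// !orthogonal_ge0 ?subrr// => x; rewrite /gp /gn le_max lexx orbT//.
apply/funext => o; rewrite -mulrBr; congr (_ * _); rewrite /gp /gn.
by case: (leP (g (X o)) 0); case: (leP (- g (X o)) 0); lra.
Qed.

End orthogonal_sets.

(** * Measurability of matrix operations *)
Section measurable_mx.
Context {K : realType} {d : measure_display} {T : measurableType d}.

Lemma measurable_entry m n (i : 'I_m) (j : 'I_n) :
  measurable_fun setT (fun M : 'M[K]_(m, n) => M i j).
Proof.
move=> _ B mB; rewrite setTI; apply: sub_sigma_algebra.
by exists i, j, B.
Qed.

Lemma measurable_mxP m n (f : T -> 'M[K]_(m, n)) :
  measurable_fun setT f <-> forall i j, measurable_fun setT (fun o => f o i j).
Proof.
split=> [mf i j|mf].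
  exact: (measurableT_comp (measurable_entry i j) mf).
apply: (measurability (@mx_generators K m n)) => //.
move=> _ [_ [i [j [B [mB ->]]]] <-].
by have := mf i j measurableT B mB.
Qed.

Lemma measurable_mulmx m n p (M : 'M[K]_(m, n)) (f : T -> 'M[K]_(n, p)) :
  measurable_fun setT f -> measurable_fun setT (fun o => M *m f o).
Proof.
move=> /measurable_mxP mf; apply/measurable_mxP => i j.
under eq_fun do rewrite mxE.
by apply: measurable_sum => k; exact: measurable_funM.
Qed.

Lemma measurable_addmx m n (f g : T -> 'M[K]_(m, n)) :
  measurable_fun setT f -> measurable_fun setT g ->
  measurable_fun setT (fun o => f o + g o).
Proof.
move=> /measurable_mxP mf /measurable_mxP mg; apply/measurable_mxP => i j.
by under eq_fun do rewrite mxE; exact: measurable_funD.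
Qed.

Lemma measurable_oppmx m n (f : T -> 'M[K]_(m, n)) :
  measurable_fun setT f -> measurable_fun setT (fun o => - f o).
Proof.
move=> /measurable_mxP mf; apply/measurable_mxP => i j.
by under eq_fun do rewrite mxE; exact: measurable_funN.
Qed.

Lemma measurable_usubmx m1 m2 n (f : T -> 'M[K]_(m1 + m2, n)) :
  measurable_fun setT f -> measurable_fun setT (fun o => usubmx (f o)).
Proof.
move=> /measurable_mxP mf; apply/measurable_mxP => i j.
by under eq_fun do rewrite mxE; exact: mf.
Qed.

Lemma measurable_dsubmx m1 m2 n (f : T -> 'M[K]_(m1 + m2, n)) :
  measurable_fun setT f -> measurable_fun setT (fun o => dsubmx (f o)).
Proof.
move=> /measurable_mxP mf; apply/measurable_mxP => i j.
by under eq_fun do rewrite mxE; exact: mf.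
Qed.

Lemma measurable_col_mx m1 m2 n (f : T -> 'M[K]_(m1, n))
    (g : T -> 'M[K]_(m2, n)) :
  measurable_fun setT f -> measurable_fun setT g ->
  measurable_fun setT (fun o => col_mx (f o) (g o)).
Proof.
move=> /measurable_mxP mf /measurable_mxP mg; apply/measurable_mxP => i j.
under eq_fun do rewrite mxE.
by case: splitP => k _; [exact: mf|exact: mg].
Qed.

End measurable_mx.

(** * Gaussian white noise *)
Section noise.
Context {K : realType} {d : measure_display} {Omega : measurableType d}.
Variables (P : probability Omega K) (n : nat) (W : 'M[K]_n).
Variable w : nat -> Omega -> 'cV[K]_n.
Hypothesis noise : gaussian_white_noise P W w.
Local Notation mean := (mean P).

Lemma noise_measurable k : measurable_fun setT (w k).
Proof. by case: noise => _ /(_ k)[]. Qed.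

Lemma noise_entry_measurable k i : measurable_fun setT (fun o => w k o i 0).
Proof. exact: (measurable_mxP (w k)).1 (noise_measurable k) i 0. Qed.

Lemma noise_sqint k i : sqint P (fun o => w k o i 0).
Proof.
have mw := noise_entry_measurable k i; split=> //.
apply: ge0_intg; [exact: measurable_funX|by move=> o; exact: sqr_ge0|].
case: noise => _ _ _ /(_ k k i i); rewrite unlock => H.
by under eq_integral do rewrite expr2; rewrite H ltry.
Qed.

Lemma noise_mean k i : mean (fun o => w k o i 0) = 0.
Proof.
case: noise => _ _ /(_ k i) + _; rewrite unlock => H.
by rewrite /mean /Rintegral H.
Qed.

Lemma noise_cov k l i j :
  mean (fun o => w k o i 0 * w l o j 0) = W i j *+ (k == l).
Proof.
case: noise => _ _ _ /(_ k l i j); rewrite unlock => H.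
by rewrite /mean /Rintegral H.
Qed.

Lemma noise_linear_gaussian k (a : 'rV[K]_n) :
  gaussian_rv P (fun o => (a *m w k o) 0 0).
Proof.
split.
  exact: (measurable_mxP _).1 (measurable_mulmx a (noise_measurable k)) 0 0.
by case: noise => _ /(_ k)[_ /(_ a)].
Qed.

(** [gaussian_uncorrelated_trig] with U a linear form in the noise at one time and V
    an entry of it; the hypothesis says that they are uncorrelated. The constant
    phase is removed by the addition formulas. *)
Lemma noise_linear_trig k (a : 'rV[K]_n) (j : 'I_n) (c : K) :
  (a *m W) 0 j = 0 ->
  mean (fun o => w k o j 0 * cos ((a *m w k o) 0 0 + c)) = 0 /\
  mean (fun o => w k o j 0 * sin ((a *m w k o) 0 0 + c)) = 0.
Proof.
move=> aWj; have sV := noise_sqint k j.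
have aE o : (a *m w k o) 0 0 = \sum_i a 0 i * w k o i 0 by rewrite mxE.
have sU : sqint P (fun o => (a *m w k o) 0 0).
  under eq_fun do rewrite aE.
  by apply: sqint_sum => i; apply: sqintZ; exact: noise_sqint.
have [cV0 sV0] : mean (fun o => w k o j 0 * cos ((a *m w k o) 0 0)) = 0 /\
    mean (fun o => w k o j 0 * sin ((a *m w k o) 0 0)) = 0.
  apply: gaussian_uncorrelated_trig => //.
  - move=> e; rewrite (_ : (fun o => _) =
      fun o => ((a + e *: delta_mx 0 j) *m w k o) 0 0).
      exact: noise_linear_gaussian.
    apply/funext => o; rewrite mulmxDl -scalemxAl -rowE !mxE.
    by congr (_ + _); rewrite ?mxE.
  - under eq_fun do rewrite aE.
    rewrite mean_sum => [|i]; last by apply/intgZ/sqint_intg/noise_sqint.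
    rewrite big1// => i _; rewrite meanZ ?noise_mean ?mulr0//.
    exact/sqint_intg/noise_sqint.
  - exact: noise_mean.
  - rewrite (_ : (fun o => _) = fun o =>
      \sum_i a 0 i * (w k o i 0 * w k o j 0)); last first.
      by apply/funext => o; rewrite aE mulr_suml; apply: eq_bigr => i _; ring.
    have iM i : intg P (fun o => w k o i 0 * w k o j 0).
      by apply: intgM; exact: noise_sqint.
    rewrite mean_sum => [|i]; last exact: intgZ.
    rewrite -[RHS]aWj mxE; apply: eq_bigr => i _.
    by rewrite meanZ// noise_cov eqxx.
have ic : intg P (fun o => w k o j 0 * cos ((a *m w k o) 0 0)).
  apply: (@intgM_bounded _ _ _ _ _ _ 1); [exact: sqint_intg| |].
    exact/measurable_cos_comp/sU.1.
  by move=> o; exact: cos_max.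
have is_ : intg P (fun o => w k o j 0 * sin ((a *m w k o) 0 0)).
  apply: (@intgM_bounded _ _ _ _ _ _ 1); [exact: sqint_intg| |].
    exact/measurable_sin_comp/sU.1.
  by move=> o; exact: sin_max.
split.
- rewrite (_ : (fun o => _) = fun o =>
    cos c * (w k o j 0 * cos ((a *m w k o) 0 0)) -
    sin c * (w k o j 0 * sin ((a *m w k o) 0 0))).
    by rewrite meanB ?meanZ ?cV0 ?sV0 ?mulr0 ?subrr//; exact: intgZ.
  by apply/funext => o; rewrite cosD; ring.
- rewrite (_ : (fun o => _) = fun o =>
    cos c * (w k o j 0 * sin ((a *m w k o) 0 0)) +
    sin c * (w k o j 0 * cos ((a *m w k o) 0 0))).
    by rewrite meanD ?meanZ ?cV0 ?sV0 ?mulr0 ?addr0//; exact: intgZ.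
  by apply/funext => o; rewrite sinD; ring.
Qed.

(** Events depending on other times are independent of [w s], so the centred
    indicator of such an event is orthogonal to every function of [w s]. *)
Lemma noise_indep s (ks : seq nat) (E : nat -> set 'cV[K]_n) (g : 'cV[K]_n -> K) :
  uniq ks -> s \notin ks -> (forall k, measurable (E k)) ->
  measurable_fun setT g -> intg P (fun o => g (w s o)) ->
  mean (fun o => g (w s o)) = 0 ->
  mean (fun o => \1_(\bigcap_(k in [set` ks]) (w k @^-1` E k)) o * g (w s o)) = 0.
Proof.
move=> uks sks mE mg ig g0; set A := \bigcap_(k in _) _.
have [ind _ _ _] := noise.
have mwE k F : measurable F -> measurable (w k @^-1` F).
  by move=> mF; have := noise_measurable k measurableT mF; rewrite setTI.
have mA : measurable A.
  apply: fin_bigcap_measurable; first exact: finite_seq.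
  by move=> k _; exact: mwE.
have PA : P A \is a fin_num by exact: fin_num_measure.
(* Centring makes the indicator orthogonal to the indicators of all events
   that depend on [w s]. *)
pose V o : K := \1_A o - fine (P A).
have i1 : intg P (fun o => \1_A o) by apply: integrable_indic.
have iV : intg P V by apply: intgB => //; exact: intg_cst.
have Vle o : `|V o| <= 1 + `|fine (P A)|.
  rewrite (le_trans (ler_normB _ _))// lerD2r.
  by rewrite indicE; case: (_ \in _); rewrite ?normr1 ?normr0.
have iVg : intg P (fun o => V o * g (w s o)).
  under eq_fun do rewrite mulrC.
  by apply: intgM_bounded Vle => //; exact: intg_measurable iV.
have i1g : intg P (fun o => \1_A o * g (w s o)).
  under eq_fun do rewrite mulrC.
  apply: (@intgM_bounded _ _ _ _ _ _ 1) => // o.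
  by rewrite indicE; case: (_ \in _); rewrite ?normr1 ?normr0.
have meanI (F : set Omega) : measurable F -> mean (\1_F) = fine (P F).
  by move=> mF; rewrite /mean /Rintegral integral_indic// setIT.
have V0 : mean (fun o => V o * g (w s o)) = 0.
  apply: (orthogonal_comp (noise_measurable s)) => // F mF.
  have mwF := mwE s F mF.
  rewrite (_ : (fun o => _) = fun o => \1_(A `&` w s @^-1` F) o -
      fine (P A) * \1_(w s @^-1` F) o); last first.
    by apply/funext => o; rewrite indicI mulrBl.
  have mAF : measurable (A `&` w s @^-1` F) by exact: measurableI.
  have iF : intg P \1_(w s @^-1` F) by exact: integrable_indic.
  rewrite meanB; [|exact: integrable_indic|exact: intgZ].
  rewrite meanZ// !meanI//.
  pose E' k := if k == s then F else E k.
  have mE' k : measurable (E' k) by rewrite /E'; case: ifP.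
  have neqs k : k \in ks -> (k == s) = false.
    by apply: contraTF => /eqP ->.
  have -> : A `&` w s @^-1` F = \bigcap_(k in [set` s :: ks]) (w k @^-1` E' k).
    apply/seteqP; split => o /=.
      move=> [Ao Fo] k /=; rewrite inE /E'; case: eqP => [->//|_ /= kks].
      exact: Ao.
    move=> H; split; last first.
      by have := H s; rewrite /= inE eqxx /E' eqxx; exact.
    move=> k /= kks; have := H k; rewrite /= inE kks orbT /E' neqs//.
    exact.
  rewrite ind//=; last by rewrite sks.
  rewrite big_cons {1}/E' eqxx.
  have -> : (\prod_(k <- ks) P (w k @^-1` E' k) = P A)%E.
    rewrite ind//; rewrite big_seq [RHS]big_seq; apply: eq_bigr => k kks.
    by rewrite /E' neqs.
  by rewrite fineM ?fin_num_measure// mulrC subrr.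
rewrite (_ : (fun o => _) = fun o => V o * g (w s o) + fine (P A) * g (w s o)).
  by rewrite meanD ?meanZ ?V0 ?g0 ?mulr0 ?addr0//; exact: intgZ.
by apply/funext => o; rewrite /V; ring.
Qed.

End noise.

(** * Noise is orthogonal to uncorrelated information *)
Section information.
Context {K : realType} {d : measure_display} {Omega : measurableType d}.
Variables (P : probability Omega K) (n : nat) (W : 'M[K]_n).
Variable w : nat -> Omega -> 'cV[K]_n.
Hypothesis noise : gaussian_white_noise P W w.
Local Notation mean := (mean P).

Definition below (l : seq (nat * 'I_n * K)) : set Omega :=
  [set o | forall x, x \in l -> w x.1.1 o x.1.2 0 < x.2].

(** A pi-system generating the information carried by the entries [w k _ i 0] with
    index [(k, i)] in [I]. *)
Definition cylinders (I : set (nat * 'I_n)) : set (set Omega) :=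
  [set A | exists2 l, (forall x, x \in l -> I x.1) & A = below l].

Lemma cylinders_setI (I : set (nat * 'I_n)) : setI_closed (cylinders I).
Proof.
move=> _ _ [l Il ->] [l' Il' ->]; exists (l ++ l').
  by move=> x; rewrite mem_cat => /orP[/Il|/Il'].
apply/seteqP; split=> o /=.
  by move=> [lo l'o] x; rewrite mem_cat => /orP[/lo|/l'o].
by move=> H; split=> x xl; apply: H; rewrite mem_cat xl ?orbT.
Qed.

Lemma measurable_entry_lt (i : 'I_n) (c : K) :
  measurable [set v : 'cV[K]_n | v i 0 < c].
Proof.
rewrite (_ : [set _ | _] = setT `&`
    (fun v : 'cV[K]_n => v i 0) @^-1` `]-oo, c[%classic).
  by apply: measurable_entry => //; exact: measurable_itv.
by apply/seteqP; split => v /=; rewrite in_itv //= => -[].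
Qed.

Lemma measurable_below l : measurable (below l).
Proof.
rewrite (_ : below l = \bigcap_(x in [set` l])
    (w x.1.1 @^-1` [set v : 'cV[K]_n | v x.1.2 0 < x.2])).
  apply: fin_bigcap_measurable => [|x _]; first exact: finite_seq.
  have := noise_measurable noise x.1.1 measurableT (measurable_entry_lt x.1.2 x.2).
  by rewrite setTI.
by apply/seteqP; split.
Qed.

Lemma measurable_info (I : set (nat * 'I_n)) (A : set Omega) :
  <<s cylinders I >> A -> measurable A.
Proof.
move=> H; apply: H; split; first exact: sigma_algebra_measurable.
by move=> _ [l _ ->]; exact: measurable_below.
Qed.

Lemma prod_natr_all (I : Type) (r : seq I) (b : pred I) :
  \prod_(x <- r) (b x)%:R = (all b r)%:R :> K.
Proof.
elim: r => [|x r IH]; first by rewrite big_nil.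
by rewrite big_cons IH /=; case: (b x); rewrite ?mul1r ?mul0r.
Qed.

Section orthogonality.
Variables (I : set (nat * 'I_n)) (s : nat) (j : 'I_n).
Hypothesis uncorrelated : forall k i, I (k, i) -> k <> s \/ W i j = 0.
Local Notation V := (fun o => w s o j 0).

Let phase (u : Omega -> K) : Prop := exists (a : 'rV[K]_n) (c : K),
  (forall i, a 0 i != 0 -> I (s, i)) /\ u = (fun o => (a *m w s o) 0 0 + c).

Let phase_measurable u : phase u -> measurable_fun setT u.
Proof.
move=> [a [c [_ ->]]]; apply: measurable_funD => //.
by have := (measurable_mxP _).1 (measurable_mulmx a (noise_measurable noise s)) 0 0.
Qed.

Let phaseD u v : phase u -> phase v -> phase (fun o => u o + v o).
Proof.
move=> [a [c [aI ->]]] [b [e [bI ->]]]; exists (a + b), (c + e); split.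
  move=> i; rewrite mxE; have [->|/aI//] := eqVneq (a 0 i) 0.
  by rewrite add0r => /bI.
by apply/funext => o; rewrite addrACA mulmxDl [in RHS]mxE.
Qed.

Let phaseZ c u : phase u -> phase (fun o => c * u o).
Proof.
move=> [a [e [aI ->]]]; exists (c *: a), (c * e); split.
  by move=> i; rewrite mxE mulf_eq0 negb_or => /andP[_ /aI].
by apply/funext => o; rewrite mulrDr -scalemxAl [in RHS]mxE.
Qed.

Let phase_lt i c : I (s, i) -> phase (fun o => w s o i 0 - c).
Proof.
move=> Isi; exists (delta_mx 0 i), (- c); split.
  by move=> i'; rewrite !mxE /=; have [->//|] := eqVneq i' i; rewrite eqxx.
by apply/funext => o; rewrite -rowE [in RHS]mxE.
Qed.

Let intgV : intg P V.
Proof. exact/sqint_intg/(noise_sqint noise). Qed.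

Let other_times l : trig_orthogonal P V phase
  (fun o => \1_(below [seq x <- l | x.1.1 != s]) o).
Proof.
move=> u [a [c [aI ->]]].
have aWj : (a *m W) 0 j = 0.
  rewrite mxE big1// => i _; have [->|/aI] := eqVneq (a 0 i) 0; first exact: mul0r.
  by move=> /uncorrelated[//|->]; exact: mulr0.
have [c0 s0] := noise_linear_trig noise s c aWj.
set lA := [seq x <- l | _].
pose ks := undup [seq x.1.1 | x <- lA].
pose E k := [set v : 'cV[K]_n | forall x, x \in [seq y <- lA | y.1.1 == k] ->
  v x.1.2 0 < x.2].
have mE k : measurable (E k).
  rewrite (_ : E k = \bigcap_(x in [set` [seq y <- lA | y.1.1 == k]])
      [set v : 'cV[K]_n | v x.1.2 0 < x.2]); last by apply/seteqP; split.
  apply: fin_bigcap_measurable => [|x _]; first exact: finite_seq.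
  exact: measurable_entry_lt.
have sks : s \notin ks.
  rewrite mem_undup; apply/mapP => -[x]; rewrite mem_filter => /andP[/eqP + _].
  by move=> H /esym.
have -> : below lA = \bigcap_(k in [set` ks]) (w k @^-1` E k).
  apply/seteqP; split => o /= H.
    by move=> k _ x; rewrite mem_filter => /andP[/eqP <-]; exact: H.
  move=> x xl; apply: (H x.1.1); last by rewrite mem_filter eqxx.
  by rewrite /= mem_undup; exact: map_f.
have mj : measurable_fun setT (fun v : 'cV[K]_n => v j 0) by exact: measurable_entry.
have ma : measurable_fun setT (fun v : 'cV[K]_n => (a *m v) 0 0 + c).
  apply: measurable_funD => //.
  exact: (measurable_mxP _).1 (measurable_mulmx a (@measurable_id _ _ setT)) 0 0.
have pu : phase (fun o => (a *m w s o) 0 0 + c) by exists a, c.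
split.
- rewrite (_ : (fun o => _) = fun o => \1_(\bigcap_(k in [set` ks]) (w k @^-1` E k)) o *
      (w s o j 0 * cos ((a *m w s o) 0 0 + c))); last by apply/funext => o; ring.
  apply: (noise_indep noise (g := fun v => v j 0 * cos ((a *m v) 0 0 + c))) => //.
  + exact: undup_uniq.
  + by apply: measurable_funM => //; exact: measurable_cos_comp.
  + apply: (@intgM_bounded _ _ _ _ _ _ 1) => //.
      exact/measurable_cos_comp/phase_measurable.
    by move=> o; exact: cos_max.
- rewrite (_ : (fun o => _) = fun o => \1_(\bigcap_(k in [set` ks]) (w k @^-1` E k)) o *
      (w s o j 0 * sin ((a *m w s o) 0 0 + c))); last by apply/funext => o; ring.
  apply: (noise_indep noise (g := fun v => v j 0 * sin ((a *m v) 0 0 + c))) => //.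
  + exact: undup_uniq.
  + by apply: measurable_funM => //; exact: measurable_sin_comp.
  + apply: (@intgM_bounded _ _ _ _ _ _ 1) => //.
      exact/measurable_sin_comp/phase_measurable.
    by move=> o; exact: sin_max.
Qed.

Let mean_below l : (forall x, x \in l -> I x.1) ->
  mean (fun o => V o * \1_(below l) o) = 0.
Proof.
move=> Il.
pose b (x : nat * 'I_n * K) o := (w s o x.1.2 0 - x.2 < 0)%R.
(* The bounds at time [s] are split off into the product over [r]. *)
pose f r o : K := \1_(below [seq x <- l | x.1.1 != s]) o * \prod_(x <- r) (b x o)%:R.
have fP r : (forall x, x \in r -> I (s, x.1.2)) ->
    bounded_mfun (f r) /\ trig_orthogonal P V phase (f r).
  elim/last_ind: r => [_|r x IH Ir].
    rewrite /f; under eq_fun do rewrite big_nil mulr1; split; last exact: other_times.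
    split; first exact/measurable_indic/measurable_below.
    by exists 1 => o; rewrite indicE; case: (_ \in _); rewrite ?normr1 ?normr0.
  have [y yr|bf tf] := IH; first by apply: Ir; rewrite mem_rcons inE yr orbT.
  have px : phase (fun o => w s o x.1.2 0 - x.2).
    by apply: phase_lt; apply: Ir; rewrite mem_rcons mem_head.
  have [bm tm] := trig_multiplier_lt0 intgV phase_measurable phaseD phaseZ px.
  have fE : f (rcons r x) = fun o => f r o * (b x o)%:R.
    by apply/funext => o; rewrite /f big_rcons /= mulrA.
  rewrite fE; split; first exact: bounded_mfunM.
  exact: tm.
(* The cosine of the zero phase turns trigonometric orthogonality into the
   plain expectation. *)
have [|_ /(_ (fun=> 0))] := fP [seq x <- l | x.1.1 == s].
  move=> x; rewrite mem_filter => /andP[/eqP <- /Il].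
  by case: x => [[]].
case.
  exists 0, 0; split; first by move=> i; rewrite mxE eqxx.
  by apply/funext => o; rewrite mul0mx mxE addr0.
rewrite cos0 => + _; rewrite (_ : (fun o => _) = fun o => V o * \1_(below l) o)//.
apply/funext => o; rewrite mulr1 /f prod_natr_all; congr (_ * _).
rewrite !indicE -natrM mulnb; congr (_%:R); congr nat_of_bool.
apply/idP/idP.
- move=> /andP[/set_mem H /allP H']; apply/mem_set => x xl.
  have [xs|xs] := eqVneq x.1.1 s.
    have := H' x; rewrite mem_filter xs eqxx xl /b subr_lt0; exact.
  by apply: H; rewrite mem_filter xs.
- move=> /set_mem H; apply/andP; split.
    by apply/mem_set => x; rewrite mem_filter => /andP[_ /H].
  apply/allP => x; rewrite mem_filter => /andP[/eqP xs xl].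
  by rewrite /b subr_lt0 -xs; exact: H.
Qed.

Let info := g_sigma_algebraType (cylinders I).

Let mean_info (A : set Omega) : <<s cylinders I >> A ->
  mean (fun o => V o * \1_A o) = 0.
Proof.
have EV0 : mean V = 0 by exact: (noise_mean noise).
have i1 (B : set Omega) : measurable B -> intg P (fun o => V o * \1_B o).
  move=> mB; apply: (@intgM_bounded _ _ _ _ _ _ 1) => // o.
  by rewrite indicE; case: (_ \in _); rewrite ?normr1 ?normr0.
move: A; apply: (@dynkin_induction _ info (cylinders I)) => //.
- exact: cylinders_setI.
- by under eq_fun do rewrite indicT mulr1.
- by move=> _ [l Il ->]; exact: mean_below.
- move=> S /measurable_info mS S0.
  rewrite (_ : (fun o => _) = fun o => V o - V o * \1_S o).
    by rewrite meanB ?S0 ?EV0 ?subrr//; exact: i1.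
  apply/funext => o; rewrite !indicE in_setC.
  by case: (_ \in _); rewrite /=; ring.
- move=> F mF tF F0; have mF' k := measurable_info (mF k).
  rewrite /mean /Rintegral.
  have E (B : set Omega) :
    (\int[P]_o (V o * \1_B o)%:E = \int[P]_(o in B) (V o)%:E)%E.
    rewrite [RHS]integral_mkcond; apply: eq_integral => o _.
    by rewrite /patch indicE; case: ifP => _; rewrite ?mulr1 ?mulr0.
  rewrite E integral_bigcup//; last by apply: integrableS intgV => //; exact: bigcup_measurable.
  rewrite eseries0// => k _ _; rewrite -E -EFin_mean ?F0//; exact: i1.
Qed.

(** By Dynkin's theorem it suffices to treat events given by finitely many strict
    upper bounds on entries. The bounds at times other than [s] enter through
    independence; they leave a trigonometrically orthogonal function. The bounds at
    time [s] are multipliers ([trig_multiplier_lt0]), added one at a time. *)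
Lemma noise_orthogonal (phi : info -> K) :
  measurable_fun setT phi -> sqint P (phi : Omega -> K) ->
  mean (fun o => w s o j 0 * phi o) = 0.
Proof.
move=> mphi sphi.
have mid : measurable_fun setT (idfun : Omega -> info).
  by move=> _ A mA; rewrite setTI; exact: measurable_info mA.
apply: (orthogonal_comp mid intgV _ mphi).
  by move=> A mA; exact: mean_info.
by apply: intgM => //; exact: (noise_sqint noise).
Qed.

End orthogonality.
End information.

(** * Lyapunov functions from eigenvalues *)
Section complex_norm.
Context {R : rcfType}.
Local Notation C := R[i].
Implicit Types (z : C) (e : R).

Definition sqabs z : R := complex.Re z ^+ 2 + complex.Im z ^+ 2.

Lemma sqabs_ge0 z : 0 <= sqabs z.
Proof. by rewrite addr_ge0 ?sqr_ge0. Qed.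

Lemma sqabsM z1 z2 : sqabs (z1 * z2) = sqabs z1 * sqabs z2.
Proof. by case: z1 z2 => [a b] [c e]; rewrite /sqabs /=; ring. Qed.

Lemma sqabs_lt1 z : (`|z| < 1) = (sqabs z < 1).
Proof.
rewrite normc_def -[1]/((1 : R)%:C)%C ltcR -/(sqabs z).
by rewrite -[X in _ < X]sqrtr1 ltr_sqrt.
Qed.

(** Young's inequality; the weight [1 + e] close to 1 on the first term is what the
    Lyapunov estimate needs. *)
Lemma sqrD_young e (a b : R) : 0 < e ->
  (a + b) ^+ 2 <= (1 + e) * a ^+ 2 + (1 + e^-1) * b ^+ 2.
Proof.
move=> e0; rewrite -subr_ge0.
rewrite (_ : _ - _ = (e * a - b) ^+ 2 / e).
  by rewrite divr_ge0 ?sqr_ge0 ?ltW.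
by field; rewrite gt_eqF.
Qed.

Lemma sqabsD_young e z1 z2 : 0 < e ->
  sqabs (z1 + z2) <= (1 + e) * sqabs z1 + (1 + e^-1) * sqabs z2.
Proof.
case: z1 z2 => [a b] [c f] e0; rewrite /sqabs /=.
have := sqrD_young a c e0; have := sqrD_young b f e0; lra.
Qed.

Definition sqnorm n (v : 'cV[C]_n) : R := \sum_i sqabs (v i 0).

Lemma sqnorm_ge0 n (v : 'cV[C]_n) : 0 <= sqnorm v.
Proof. by apply: sumr_ge0 => i _; exact: sqabs_ge0. Qed.

Lemma sqnorm0 n : sqnorm (0 : 'cV[C]_n) = 0.
Proof. by apply: big1 => i _; rewrite mxE /sqabs /= expr0n addr0. Qed.

Lemma sqnormZ n z (v : 'cV[C]_n) : sqnorm (z *: v) = sqabs z * sqnorm v.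
Proof. by rewrite mulr_sumr; apply: eq_bigr => i _; rewrite mxE sqabsM. Qed.

Lemma sqnormD_young n e (u v : 'cV[C]_n) : 0 < e ->
  sqnorm (u + v) <= (1 + e) * sqnorm u + (1 + e^-1) * sqnorm v.
Proof.
move=> e0; rewrite !mulr_sumr -big_split; apply: ler_sum => i _.
by rewrite mxE; exact: sqabsD_young.
Qed.

Lemma sqnormD n (u v : 'cV[C]_n) :
  sqnorm (u + v) <= 2 * sqnorm u + 2 * sqnorm v.
Proof.
by have := sqnormD_young u v ltr01; rewrite invr1.
Qed.

Lemma sqabs_sum (I : Type) (r : seq I) (F : I -> C) :
  sqabs (\sum_(i <- r) F i) <= (size r)%:R * \sum_(i <- r) sqabs (F i).
Proof.
elim: r => [|i r IH]; first by rewrite !big_nil /sqabs /= expr0n /= mulr0 addr0.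
rewrite !big_cons /=.
have [r0|r0] := posnP (size r).
  by rewrite (size0nil r0) !big_nil !addr0 mul1r.
have r0' : 0 < (size r)%:R :> R by rewrite ltr0n.
apply: (le_trans (sqabsD_young _ _ r0')).
have S0 : 0 <= \sum_(j <- r) sqabs (F j).
  by apply: sumr_ge0 => j _; exact: sqabs_ge0.
rewrite -natr1 [leRHS]mulrDr addrC [leRHS]addrC lerD//; last by rewrite addrC.
apply: (@le_trans _ _ ((1 + (size r)%:R^-1) * ((size r)%:R * \sum_(j <- r) sqabs (F j)))).
  by rewrite ler_wpM2l// addr_ge0 ?invr_ge0 ?ltW.
by rewrite mulrA mulrDl mul1r mulVf ?gt_eqF.
Qed.

Lemma sqnorm_mulmx m n (M : 'M[C]_(m, n)) :
  exists2 c : R, 0 <= c & forall v : 'cV_n, sqnorm (M *m v) <= c * sqnorm v.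
Proof.
exists (n%:R * \sum_i \sum_j sqabs (M i j)).
  by rewrite mulr_ge0// sumr_ge0// => i _; rewrite sumr_ge0// => j _; exact: sqabs_ge0.
move=> v; rewrite /sqnorm -mulrA mulr_suml mulr_sumr; apply: ler_sum => i _.
rewrite mxE; apply: (le_trans (sqabs_sum _ _)).
rewrite [size _](_ : _ = n); last by rewrite /index_enum -enumT size_enum_ord.
rewrite ler_wpM2l// mulr_suml; apply: ler_sum => j _.
rewrite sqabsM ler_wpM2l ?sqabs_ge0// (bigD1 j)//= lerDl.
by apply: sumr_ge0 => k _; exact: sqabs_ge0.
Qed.

(** The product of the matrices [M - z] for [z] in [s]; it vanishes when [s] lists the
    roots of the characteristic polynomial. *)
Definition shifts n (M : 'M[C]_n) (s : seq C) : 'M[C]_n :=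
  foldr (fun z N => (M - z%:M) *m N) 1%:M s.

Lemma shifts_comm n (M : 'M[C]_n) s : M *m shifts M s = shifts M s *m M.
Proof.
elim: s => [|z s IH] /=; first by rewrite mulmx1 mul1mx.
rewrite -[RHS]mulmxA -IH !mulmxA; congr (_ *m _).
by rewrite mulmxBr mulmxBl scalar_mxC.
Qed.

(** Induction on [s]. The vector [y = shifts M s *m x] obeys [y+ = z y] up to the next
    shift of [x] and [f], so its squared norm contracts when [z] is in the open unit
    disc. A large multiple of it added to the previous [V] absorbs the error term of
    the previous estimate, and leaves the next shift as the new error. This avoids
    triangular forms and spectral radii. *)
Lemma shifts_lyapunov n (M : 'M[C]_n) s : (forall z, z \in s -> sqabs z < 1) ->
  exists (V : 'cV[C]_n -> R) (rho c : R),
  [/\ 0 <= rho < 1, 0 <= c, V 0 = 0, forall x, sqnorm x <= V x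
    & forall x f : 'cV[C]_n, V (M *m x + f) <=
        rho * V x + c * (sqnorm (shifts M s *m x) + sqnorm f)].
Proof.
elim: s => [_|z s IH zs].
  have [k k0 kM] := sqnorm_mulmx M.
  exists (@sqnorm n), 0, (2 * k + 2); split => //=.
  - by rewrite lexx ltr01.
  - by rewrite addr_ge0// mulr_ge0.
  - exact: sqnorm0.
  move=> x f; rewrite mul0r add0r mul1mx.
  have := sqnormD (M *m x) f; have := kM x.
  have := sqnorm_ge0 x; have := sqnorm_ge0 f.
  have : 0 <= k * sqnorm f by rewrite mulr_ge0 ?sqnorm_ge0.
  by move=> *; lra.
have [V [rho [c [/andP[rho0 rho1] c0 V0 Vge Vle]]]] :
    exists (V : 'cV[C]_n -> R) (rho c : R),
    [/\ 0 <= rho < 1, 0 <= c, V 0 = 0, forall x, sqnorm x <= V x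
      & forall x f : 'cV[C]_n, V (M *m x + f) <=
        rho * V x + c * (sqnorm (shifts M s *m x) + sqnorm f)].
  by apply: IH => y ys; apply: zs; rewrite inE ys orbT.
have {zs} r1 : sqabs z < 1 by apply: zs; exact: mem_head.
set r := sqabs z in r1; have r0 : 0 <= r := sqabs_ge0 z.
set N := shifts M s; have [k k0 kN] := sqnorm_mulmx N.
(* With this [e] the factor [(1 + e) * r] is at most [(1 + r) / 2 < 1]. *)
pose e : R := (1 - r) / 2; have e0 : 0 < e by rewrite /e; lra.
pose y x := sqnorm (N *m x).
have y_step (x f : 'cV[C]_n) : y (M *m x + f) <=
    (1 + r) / 2 * y x +
    (1 + e^-1) * (2 * sqnorm (shifts M (z :: s) *m x) + 2 * k * sqnorm f).
  rewrite /y; have -> : N *m (M *m x + f) =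
      z *: (N *m x) + (shifts M (z :: s) *m x + N *m f).
    rewrite /= -/N mulmxDr addrA; congr (_ + _).
    rewrite mulmxA -shifts_comm -/N mulmxBl mulmxBl mul_scalar_mx.
    by rewrite -scalemxAl addrC subrK.
  apply: (le_trans (sqnormD_young _ _ e0)); rewrite sqnormZ -/r mulrA lerD//.
    by rewrite ler_wpM2r ?sqnorm_ge0// /e; nra.
  have E1 : 0 <= 1 + e^-1 by rewrite addr_ge0 ?invr_ge0 ?ltW.
  rewrite ler_wpM2l//.
  by apply: (le_trans (sqnormD _ _)); rewrite lerD2l -mulrA ler_wpM2l.
pose E : R := 1 + e^-1; have E0 : 0 <= E by rewrite addr_ge0 ?invr_ge0 ?ltW.
(* The gap between [(1 + r) / 2] and [(3 + r) / 4] times [kap] is exactly [c],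
   which pays for the term [c * y x]. *)
have [kap kap0 kapE] : exists2 kap : R, 0 <= kap & kap * (1 - r) = 4 * c.
  exists (4 * c / (1 - r)); last by rewrite divfK//; lra.
  by rewrite divr_ge0 ?mulr_ge0//; lra.
exists (fun x => V x + kap * y x), (Num.max rho ((3 + r) / 4)),
  (c + kap * E * (2 + 2 * k)).
have y0 x : 0 <= y x by exact: sqnorm_ge0.
split => //.
- by rewrite le_max rho0 gt_max rho1 /=; lra.
- have k2 : 0 <= 2 + 2 * k by lra.
  by rewrite addr_ge0// mulr_ge0// mulr_ge0.
- by rewrite /y mulmx0 sqnorm0 V0 mulr0 addr0.
- by move=> x; rewrite (le_trans (Vge x))// lerDl mulr_ge0.
move=> x f; set rho' := Num.max _ _; set s' := sqnorm (shifts _ _ *m x).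
have s0 : 0 <= s' := sqnorm_ge0 _; have f0 := sqnorm_ge0 f.
have Vx0 : 0 <= V x := le_trans (sqnorm_ge0 x) (Vge x).
have h1 := Vle x f; rewrite -/N -/(y x) in h1.
have h2 := ler_wpM2l kap0 (y_step x f); rewrite -/s' -/E in h2.
have h3 : rho * V x <= rho' * V x by rewrite ler_wpM2r// le_max lexx.
have h4 : kap * ((3 + r) / 4 * y x) <= kap * (rho' * y x).
  by rewrite ler_wpM2l// ler_wpM2r// le_max lexx orbT.
have h5 : kap * ((3 + r) / 4 * y x) = c * y x + kap * ((1 + r) / 2 * y x).
  by rewrite -[c]mul1r -(mulVf (_ : 4 != 0 :> R))// -[4^-1 * 4 * c]mulrA -kapE; field.
have h6 : kap * (E * (2 * s' + 2 * k * sqnorm f)) <=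
    kap * E * (2 + 2 * k) * (s' + sqnorm f).
  rewrite mulrA -[leRHS]mulrA; apply: ler_wpM2l; first exact: mulr_ge0.
  rewrite -subr_ge0.
  rewrite (_ : _ - _ = 2 * sqnorm f + 2 * k * s'); last by ring.
  by rewrite addr_ge0// mulr_ge0// mulr_ge0.
have h7 : 0 <= c * s' by rewrite mulr_ge0.
by rewrite mulrDr [(c + _) * _]mulrDl; lra.
Qed.

End complex_norm.

(** * Stable matrices have fading memory *)
Section stability.
Context {K : realType}.
Local Notation C := K[i].

Definition sqn n (v : 'cV[K]_n) : K := \sum_i v i 0 ^+ 2.

Lemma sqn_ge0 n (v : 'cV[K]_n) : 0 <= sqn v.
Proof. by apply: sumr_ge0 => i _; exact: sqr_ge0. Qed.

Lemma sqnorm_complex n (v : 'cV[K]_n) :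
  sqnorm (map_mx (real_complex K) v) = sqn v.
Proof.
by apply: eq_bigr => i _; rewrite mxE /sqabs /= expr0n addr0.
Qed.

(** Cayley-Hamilton, with the characteristic polynomial split over [C]. *)
Lemma stable_shifts n (M : 'M[K]_n) : schur_stable M ->
  exists s : seq C, (forall z, z \in s -> sqabs z < 1) /\
    shifts (map_mx (real_complex K) M) s = 0.
Proof.
case: n M => [|n] M stM; first by exists [::]; split => //; rewrite thinmx0.
pose MC := map_mx (real_complex K) M.
have [s sE] := closed_field_poly_normal (char_poly MC).
exists s; split.
  move=> z zs; rewrite -sqabs_lt1; apply: stM.
  rewrite eigenvalue_root_char sE rootZ; last first.
    by rewrite lead_coef_eq0 monic_neq0// char_poly_monic.
  by rewrite root_prod_XsubC.
have /eqP := Cayley_Hamilton MC.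
rewrite sE (monicP (char_poly_monic MC)) scale1r rmorph_prod /= => /eqP <-.
elim: s {sE} => [|z s IH]; first by rewrite big_nil.
rewrite big_cons -IH /= rmorphB /= horner_mx_X horner_mx_C.
by [].
Qed.

Lemma geometric_sum_le (rho : K) N : 0 <= rho < 1 ->
  \sum_(t < N) rho ^+ (N.-1 - t) <= (1 - rho)^-1.
Proof.
move=> /andP[r0 r1].
rewrite (reindex_inj rev_ord_inj) /=.
rewrite (eq_bigr (fun t : 'I_N => rho ^+ t)); last first.
  by move=> t _; congr (_ ^+ _); have := ltn_ord t; lia.
have r10 : 0 < 1 - rho by lra.
rewrite -[leRHS]mul1r ler_pdivlMr// mulrC.
have := subrX1 rho N; have : 0 <= rho ^+ N by exact: exprn_ge0.
lra.
Qed.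

(** For the list of eigenvalues the error term of [shifts_lyapunov] vanishes, and
    its estimate becomes a geometric recursion. *)
Lemma stable_fading n (M : 'M[K]_n) : schur_stable M ->
  exists (rho c : K), [/\ 0 <= rho < 1, 0 <= c
    & forall x f : nat -> 'cV[K]_n, x 0%N = 0 ->
        (forall t, x t.+1 = M *m x t + f t) ->
        forall N, sqn (x N) <= c * \sum_(t < N) rho ^+ (N.-1 - t) * sqn (f t)].
Proof.
move=> /stable_shifts[s [s1 s0]].
have [V [rho [c [r01 c0 V0 Vge Vle]]]] := 
  shifts_lyapunov (map_mx (real_complex K) M) s1.
exists rho, c; split => // x f x0 xS N.
rewrite -sqnorm_complex; apply: (le_trans (Vge _)).
have /andP[rho0 _] := r01.
elim: N => [|N IH]; first by rewrite x0 map_mx0 V0 big_ord0 mulr0.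
rewrite xS map_mxD map_mxM; apply: (le_trans (Vle _ _)).
rewrite s0 mul0mx sqnorm0 add0r sqnorm_complex big_ord_recr /= subnn expr0 mul1r.
rewrite mulrDr lerD2r; apply: (le_trans (ler_wpM2l rho0 IH)).
rewrite mulrCA ler_wpM2l// mulr_sumr; apply: ler_sum => i _.
rewrite mulrA -exprS (_ : (N.-1 - i).+1 = (N - i)%N)//.
by case: N i {IH} => [[]//|N] i; rewrite /= subSn// -ltnS.
Qed.

End stability.

(** * Bilinear forms and detectability *)
Section quadratic.
Context {K : realType}.

Definition bform n m (M : 'M[K]_(n, m)) (a : 'cV[K]_n) (b : 'cV[K]_m) : K :=
  (a^T *m M *m b) 0 0.

Lemma qformE n (M : 'M[K]_n) v : qform M v = bform M v v.
Proof. by []. Qed.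

Lemma bformDl n m (M : 'M[K]_(n, m)) a a' b :
  bform M (a + a') b = bform M a b + bform M a' b.
Proof. by rewrite /bform raddfD /= !mulmxDl mxE. Qed.

Lemma bformDr n m (M : 'M[K]_(n, m)) a b b' :
  bform M a (b + b') = bform M a b + bform M a b'.
Proof. by rewrite /bform mulmxDr mxE. Qed.

Lemma bformZl n m (M : 'M[K]_(n, m)) c a b :
  bform M (c *: a) b = c * bform M a b.
Proof. by rewrite /bform linearZ /= -!scalemxAl mxE. Qed.

Lemma bformZr n m (M : 'M[K]_(n, m)) c a b :
  bform M a (c *: b) = c * bform M a b.
Proof. by rewrite /bform -scalemxAr mxE. Qed.

Lemma bformNl n m (M : 'M[K]_(n, m)) a b : bform M (- a) b = - bform M a b.
Proof. by rewrite -scaleN1r bformZl mulN1r. Qed.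

Lemma bformNr n m (M : 'M[K]_(n, m)) a b : bform M a (- b) = - bform M a b.
Proof. by rewrite -scaleN1r bformZr mulN1r. Qed.

Lemma bformDm n m (M N : 'M[K]_(n, m)) a b :
  bform (M + N) a b = bform M a b + bform N a b.
Proof. by rewrite /bform mulmxDr mulmxDl mxE. Qed.

Lemma bformNm n m (M : 'M[K]_(n, m)) a b : bform (- M) a b = - bform M a b.
Proof. by rewrite /bform mulmxN mulNmx mxE. Qed.

Lemma bform_mulmxl n m p (M : 'M[K]_(n, m)) (F : 'M[K]_(n, p)) a b :
  bform (F^T *m M) a b = bform M (F *m a) b.
Proof. by rewrite /bform trmx_mul !mulmxA. Qed.

Lemma bform_mulmxr n m p (M : 'M[K]_(n, m)) (G : 'M[K]_(m, p)) a b :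
  bform (M *m G) a b = bform M a (G *m b).
Proof. by rewrite /bform !mulmxA. Qed.

Lemma bform0l n m (M : 'M[K]_(n, m)) b : bform M 0 b = 0.
Proof. by rewrite /bform trmx0 !mul0mx mxE. Qed.

Lemma bformC n (M : 'M[K]_n) a b : M^T = M -> bform M a b = bform M b a.
Proof.
move=> sM; rewrite /bform; have -> : a^T *m M *m b = (b^T *m M *m a)^T.
  by rewrite !trmx_mul trmxK sM mulmxA.
by rewrite mxE.
Qed.

Lemma bform_sum n m (M : 'M[K]_(n, m)) a b :
  bform M a b = \sum_i \sum_j M i j * (a i 0 * b j 0).
Proof.
rewrite /bform -mulmxA mxE; apply: eq_bigr => i _.
rewrite !mxE mulr_sumr; apply: eq_bigr => j _; ring.
Qed.

Lemma bform_col_mx n1 n2 m1 m2 (M : 'M[K]_(n1 + n2, m1 + m2)) a1 a2 b1 b2 :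
  bform M (col_mx a1 a2) (col_mx b1 b2) =
  bform (ulsubmx M) a1 b1 + bform (ursubmx M) a1 b2 +
  (bform (dlsubmx M) a2 b1 + bform (drsubmx M) a2 b2).
Proof.
rewrite /bform -{1}[M]submxK tr_col_mx mul_row_block mul_row_col.
by rewrite !mulmxDl !mxE; ring.
Qed.

Lemma sqn_mulmx n m (M : 'M[K]_(m, n)) :
  exists2 c : K, 0 <= c & forall v, sqn (M *m v) <= c * sqn v.
Proof.
have [c c0 H] := sqnorm_mulmx (map_mx (real_complex K) M).
by exists c => // v; rewrite -!sqnorm_complex map_mxM.
Qed.

Lemma sqnD n (u v : 'cV[K]_n) : sqn (u + v) <= 2 * sqn u + 2 * sqn v.
Proof. by rewrite -!sqnorm_complex map_mxD; exact: sqnormD. Qed.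

Lemma sqn0 n : sqn (0 : 'cV[K]_n) = 0.
Proof. by apply: big1 => i _; rewrite mxE expr0n. Qed.

Lemma sqn_col_mx n m (u : 'cV[K]_n) (v : 'cV[K]_m) :
  sqn (col_mx u v) = sqn u + sqn v.
Proof.
rewrite /sqn big_split_ord /=; congr (_ + _); apply: eq_bigr => i _.
  by rewrite col_mxEu.
by rewrite col_mxEd.
Qed.

Definition dotv n (a b : 'cV[K]_n) : K := bform 1%:M a b.

Lemma bform_dotv n m (M : 'M[K]_(n, m)) a b : bform M a b = dotv a (M *m b).
Proof. by rewrite /dotv /bform mulmx1 mulmxA. Qed.

Lemma dotv_sum n (a b : 'cV[K]_n) : dotv a b = \sum_i a i 0 * b i 0.
Proof. by rewrite /dotv /bform mulmx1 mxE; apply: eq_bigr => i _; rewrite mxE. Qed.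

Lemma dotv_young n (a b : 'cV[K]_n) (c : K) : 0 < c ->
  2 * dotv a b <= c * sqn a + c^-1 * sqn b.
Proof.
move=> c0; rewrite dotv_sum /sqn !mulr_sumr -big_split; apply: ler_sum => i _.
rewrite -subr_ge0 (_ : _ - _ = (c * a i 0 - b i 0) ^+ 2 / c).
  by rewrite divr_ge0 ?sqr_ge0 ?ltW.
by rewrite /=; field; rewrite gt_eqF.
Qed.

Lemma bform_bound n m (M : 'M[K]_(n, m)) :
  exists2 c : K, 0 <= c & forall a b, `|bform M a b| <= c * (sqn a + sqn b).
Proof.
have [c c0 H] := sqn_mulmx M; exists (1 + c); first by rewrite addr_ge0.
move=> a b; have h1 := dotv_young a (M *m b) ltr01.
have h2 := dotv_young (- a) (M *m b) ltr01.
have sN : sqn (- a) = sqn a by apply: eq_bigr => i _; rewrite mxE sqrrN.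
have Hb := H b.
have a0 := sqn_ge0 a; have b0 := sqn_ge0 b.
have ca0 : 0 <= c * sqn a by exact: mulr_ge0.
rewrite sN /dotv bformNl -/(dotv _ _) -bform_dotv invr1 !mul1r in h1 h2.
by rewrite ler_norml; apply/andP; split; lra.
Qed.

(** The form is nonnegative on the combinations [al *: a + be *: b]; where it is
    degenerate in [b], the mixed term must vanish. *)
Lemma psd_cauchy_schwarz n (M : 'M[K]_n) a b : pos_semidef M ->
  bform M a b ^+ 2 <= qform M a * qform M b.
Proof.
move=> [sM M0]; have H al be : 0 <= al ^+ 2 * qform M a +
    2 * (al * be) * bform M a b + be ^+ 2 * qform M b.
  have := M0 (al *: a + be *: b).
  rewrite qformE bformDl !bformDr !(bformZl, bformZr) (bformC b a sM) -!qformE.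
  by lra.
have qa := M0 a; have qb := M0 b.
have [b0|b0] := eqVneq (qform M b) 0; last first.
  have {}b0 : 0 < qform M b by rewrite lt0r b0.
  have := H (qform M b) (- bform M a b).
  rewrite (_ : _ + _ + _ = qform M b * (qform M a * qform M b - bform M a b ^+ 2)).
    by rewrite pmulr_rge0// subr_ge0.
  by ring.
rewrite b0 mulr0; have [->|a0] := eqVneq (bform M a b) 0; first by rewrite expr0n.
(* This combination makes the quadratic form equal to -1. *)
have := H 1 (- (qform M a + 1) / (2 * bform M a b)).
rewrite b0 mulr0 addr0 expr1n !mul1r.
rewrite (_ : 2 * _ * _ = - (qform M a + 1)); last by field; rewrite a0.
lra.
Qed.

(** Cauchy-Schwarz against the basis vectors. *)
Lemma psd_output_bound n (M : 'M[K]_n) : pos_semidef M ->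
  exists2 c : K, 0 <= c & forall v, sqn (M *m v) <= c * qform M v.
Proof.
move=> psdM; have [_ M0] := psdM.
exists (\sum_i qform M (delta_mx i 0)); first by apply: sumr_ge0 => i _; exact: M0.
move=> v; rewrite mulr_suml; apply: ler_sum => i _.
apply: le_trans (psd_cauchy_schwarz _ _ psdM).
by rewrite /bform trmx_delta -mulmxA -rowE [in leRHS]mxE.
Qed.

Lemma pos_def_psd n (M : 'M[K]_n) : pos_def M -> pos_semidef M.
Proof.
move=> [sM M0]; split=> // v; have [->|/M0/ltW//] := eqVneq v 0.
by rewrite qformE bform0l.
Qed.

Lemma pos_def_unitmx n (M : 'M[K]_n) : pos_def M -> M \in unitmx.
Proof.
move=> [sM M0]; rewrite -row_free_unit -kermx_eq0; apply/eqP/row_matrixP => i.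
rewrite row0; apply/eqP; apply: contraT => v0.
have := M0 (row i (kermx M))^T.
rewrite -trmx0 (inj_eq trmx_inj) => /(_ v0).
have /sub_kermxP kM : (row i (kermx M) <= kermx M)%MS by exact: row_sub.
by rewrite /qform trmxK kM mul0mx mxE ltxx.
Qed.

(** [psd_output_bound] bounds [M *m v], and [M] is invertible. *)
Lemma pos_def_coercive n (M : 'M[K]_n) : pos_def M ->
  exists2 c : K, 0 <= c & forall v, sqn v <= c * qform M v.
Proof.
move=> pdM; have uM := pos_def_unitmx pdM; have psdM := pos_def_psd pdM.
have [c c0 H] := psd_output_bound psdM; have [k k0 H'] := sqn_mulmx (invmx M).
exists (k * c); first exact: mulr_ge0.
move=> v; rewrite -{1}(mulKmx uM v); apply: (le_trans (H' _)).
by rewrite -mulrA ler_wpM2l.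
Qed.

Lemma pos_def_drsubmx n m (M : 'M[K]_(n + m)) : pos_def M -> pos_def (drsubmx M).
Proof.
move=> [sM M0]; split; first by rewrite trmx_drsub sM.
move=> v v0; have := M0 (col_mx 0 v).
rewrite col_mx_eq0 (negPf v0) andbF qformE bform_col_mx !bform0l /=.
rewrite !add0r /bform mulmx0 mxE add0r; exact.
Qed.

Lemma pos_semidef_conj n m (X : 'M[K]_n) (B : 'M[K]_(n, m)) :
  pos_semidef X -> pos_semidef (B^T *m X *m B).
Proof.
move=> [sX X0]; split; first by rewrite !trmx_mul trmxK sX mulmxA.
by move=> v; have := X0 (B *m v); rewrite /qform trmx_mul !mulmxA.
Qed.

Lemma pos_defD n (M N : 'M[K]_n) : pos_def M -> pos_semidef N -> pos_def (M + N).
Proof.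
move=> [sM M0] [sN N0]; split; first by rewrite raddfD /= sM sN.
move=> v v0; have := M0 v v0; have := N0 v.
rewrite {3}/qform mulmxDr mulmxDl mxE -/(qform M v) -/(qform N v); lra.
Qed.

(** With an output injection [H] the state follows the stable matrix [A - H *m Q]
    with forcing [H *m (Q *m x) + B *m u], and the running cost dominates the squares
    of both terms. *)
Lemma detectable_bound n m (A : 'M[K]_n) (B : 'M[K]_(n, m)) Q R :
  pos_semidef Q -> pos_def R -> detectable Q A ->
  exists2 c : K, 0 < c & forall (x : nat -> 'cV[K]_n) (u : nat -> 'cV[K]_m),
    x 0%N = 0 -> (forall t, x t.+1 = A *m x t + B *m u t) ->
    forall N, sqn (x N) <= c * \sum_(t < N) (qform Q (x t) + qform R (u t)).
Proof.
move=> psdQ pdR [H stH].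
have [rho [k [/andP[rho0 rho1] k0 fade]]] := stable_fading stH.
have [q q0 Qq] := psd_output_bound psdQ; have [r r0 Rr] := pos_def_coercive pdR.
have [h h0 Hh] := sqn_mulmx H; have [b b0 Bb] := sqn_mulmx B.
pose c := k * (2 * h * q + 2 * b * r).
have hq0 : 0 <= h * q by exact: mulr_ge0.
have br0 : 0 <= b * r by exact: mulr_ge0.
have c0 : 0 <= c by rewrite mulr_ge0// addr_ge0// -mulrA mulr_ge0.
exists (c + 1) => [|x u x0 xS N]; first exact: ltr_wpDl.
pose f t := H *m (Q *m x t) + B *m u t.
have xS' t : x t.+1 = (A - H *m Q) *m x t + f t.
  by rewrite xS /f addrA mulmxBl mulmxA subrK.
apply: (le_trans (fade x f x0 xS' N)).
have Q0 t : 0 <= qform Q (x t) by exact: psdQ.2.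
have R0 t : 0 <= qform R (u t) by exact: (pos_def_psd pdR).2.
rewrite !mulr_sumr; apply: ler_sum => t _.
apply: (@le_trans _ _ (k * sqn (f t))).
  rewrite ler_wpM2l// ler_piMl ?sqn_ge0//.
  by rewrite exprn_ile1// ltW.
apply: (@le_trans _ _ (c * (qform Q (x t) + qform R (u t)))); last first.
  by rewrite ler_wpM2r ?addr_ge0// lerDl.
rewrite /c -mulrA ler_wpM2l//; apply: (le_trans (sqnD _ _)).
have h1 := le_trans (Hh (Q *m x t)) (ler_wpM2l h0 (Qq (x t))).
have h2 := le_trans (Bb (u t)) (ler_wpM2l b0 (Rr (u t))).
have h3 : 0 <= h * q * qform R (u t) by rewrite mulr_ge0.
have h4 : 0 <= b * r * qform Q (x t) by rewrite mulr_ge0.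
lra.
Qed.

Lemma dsubmx_mulmx a b c e (M : 'M[K]_(a + b, c + e)) (y : 'cV[K]_(c + e)) :
  dsubmx (M *m y) = drsubmx M *m dsubmx y + dlsubmx M *m usubmx y.
Proof.
rewrite -{1}[M]submxK -{1}[y]vsubmxK mul_block_col col_mxKd.
exact: addrC.
Qed.

Lemma dotv_col_mx0 a b (p : 'cV[K]_b) (q : 'cV[K]_(a + b)) :
  dotv (col_mx 0 p) q = dotv p (dsubmx q).
Proof.
rewrite !dotv_sum big_split_ord /= big1 ?add0r.
  by apply: eq_bigr => i _; rewrite col_mxEd mxE.
by move=> i _; rewrite col_mxEu mxE mul0r.
Qed.

Lemma dotvDl n (a b c : 'cV[K]_n) : dotv (a + b) c = dotv a c + dotv b c.
Proof. exact: bformDl. Qed.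

Lemma dotvC n (a b : 'cV[K]_n) : dotv a b = dotv b a.
Proof. by apply: bformC; rewrite trmx1. Qed.

End quadratic.

(** * The Riccati pairing identity *)
Section riccati.
Context {K : realType}.

Lemma trmx_invmx_sym n (M : 'M[K]_n) : M^T = M -> (invmx M)^T = invmx M.
Proof. by move=> sM; rewrite trmx_inv sM. Qed.

(** The Riccati equation amounts to Q = X - F'XA and L'R = F'XB for the closed-loop
    matrix F. Hence Q and R may be traded for X and one step of both dynamics,
    whatever the input [u]. *)
Lemma riccati_pairing n m (A : 'M[K]_n) (B : 'M[K]_(n, m)) Q R X
    (x z om e : 'cV[K]_n) (u : 'cV[K]_m) :
  pos_def R -> psd_stabilizing_riccati A B Q R X ->
  let L := riccati_gain A B R X in
  let zp := (A - B *m L) *m z + om in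
  let xp := A *m x + B *m u + e in
  bform Q z x + bform R (- (L *m z)) u =
  bform X z x - bform X zp xp + bform X om xp + bform X ((A - B *m L) *m z) e.
Proof.
move=> pdR [psdX are _] L zp xp.
have [sX _] := psdX; have [sR _] := pdR.
set S := R + B^T *m X *m B.
have pdS : pos_def S by apply: pos_defD => //; exact: pos_semidef_conj.
have uS := pos_def_unitmx pdS; have [sS _] := pdS.
have LE : L = invmx S *m (B^T *m X *m A) by rewrite /L /riccati_gain !mulmxA.
have LT : L^T = A^T *m X *m B *m invmx S.
  by rewrite LE !trmx_mul trmxK sX trmx_invmx_sym// !mulmxA.
have LS : L^T *m S = A^T *m X *m B by rewrite LT mulmxKV.
set F := A - B *m L.
have FT : F^T = A^T - L^T *m B^T by rewrite /F linearB /= trmx_mul.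
have QE : Q = X - F^T *m X *m A.
  rewrite {1}are FT !mulmxBl LT.
  rewrite [B^T *m X *m B + R]addrC -/S.
  by rewrite opprB addrA subrK addrAC subrr add0r.
have RE : L^T *m R = F^T *m X *m B.
  by rewrite FT !mulmxBl -LS /S mulmxDr !mulmxA addrK.
have -> : bform Q z x = bform X z x - bform X (F *m z) (A *m x).
  by rewrite {1}QE bformDm bformNm bform_mulmxr bform_mulmxl.
have -> : bform R (- (L *m z)) u = - bform X (F *m z) (B *m u).
  by rewrite bformNl -bform_mulmxl RE bform_mulmxr bform_mulmxl.
rewrite /zp /xp -/F bformDl !bformDr.
by ring.
Qed.

Fixpoint response n (F : 'M[K]_n) (om : nat -> 'cV[K]_n) t : 'cV[K]_n :=
  if t is s.+1 then F *m response F om s + om s else 0.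

Lemma response_fading n (F : 'M[K]_n) : schur_stable F ->
  exists2 c : K, 0 <= c & exists2 rho : K, 0 <= rho < 1 &
    forall om N, sqn (response F om N) <=
      c * \sum_(t < N) rho ^+ (N.-1 - t) * sqn (om t).
Proof.
move=> /stable_fading[rho [c [r01 c0 H]]]; exists c => //; exists rho => // om N.
exact: (H (response F om) om).
Qed.

End riccati.

(** * The closed loop of the chain controller *)
Section closed_loop.
Context {K : realType}.
Variables (n1 n2 n3 m1 m2 m3 : nat).
Variables (A11 : 'M[K]_n1) (A21 : 'M[K]_(n2, n1)) (A22 : 'M[K]_n2)
  (A32 : 'M[K]_(n3, n2)) (A33 : 'M[K]_n3)
  (B1 : 'M[K]_(n1, m1)) (B2 : 'M[K]_(n2, m2)) (B3 : 'M[K]_(n3, m3)).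
Variables (L1 : 'M[K]_(m1 + (m2 + m3), n1 + (n2 + n3)))
  (L2 : 'M[K]_(m2 + m3, n2 + n3)) (L3 : 'M[K]_(m3, n3)).
Let At : 'M[K]_(n2 + n3) := block_mx A22 0 A32 A33.
Let Bt : 'M[K]_(n2 + n3, m2 + m3) := block_mx B2 0 0 B3.
Let A : 'M[K]_(n1 + (n2 + n3)) := block_mx A11 0 (col_mx A21 0) At.
Let B : 'M[K]_(n1 + (n2 + n3), m1 + (m2 + m3)) := block_mx B1 0 0 Bt.
Let F1 := A - B *m L1.
Let F2 := At - Bt *m L2.
Let F3 := A33 - B3 *m L3.
Let kappa := chain_controller F1 F2 L1 L2 L3.
Variable v : nat -> 'cV[K]_(n1 + (n2 + n3)).

Definition head_noise t : 'cV[K]_(n1 + (n2 + n3)) := col_mx (usubmx (v t)) 0.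
Definition mid_noise t : 'cV[K]_(n2 + n3) :=
  col_mx (usubmx (dsubmx (v t))) 0.
Definition tail_noise t : 'cV[K]_n3 := dsubmx (dsubmx (v t)).

Let z1 := response F1 head_noise.
Let z2 := response F2 mid_noise.
Let z3 := response F3 tail_noise.

Let x := state A B kappa v.

Lemma eq_eta12 (y y' : nat -> 'cV[K]_(n1 + (n2 + n3))) t :
  (forall s, (s < t)%N -> y s = y' s) -> eta12 F1 y t = eta12 F1 y' t.
Proof.
elim: t => //= t IH yy; rewrite yy// IH// => s st; apply: yy.
exact: ltnW.
Qed.

Lemma eq_eta3 (y y' : nat -> 'cV[K]_(n1 + (n2 + n3))) t :
  (forall s, (s < t)%N -> y s = y' s) -> eta3 F1 F2 y t = eta3 F1 F2 y' t.
Proof.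
elim: t => //= t IH yy; have yy' s : (s < t)%N -> y s = y' s.
  by move=> st; apply: yy; exact: ltnW.
by rewrite yy// IH// /eta1 (eq_eta12 yy').
Qed.

Lemma nth_history t s : (s <= t)%N -> nth 0 (history A B kappa v t) s = x s.
Proof.
move=> st; have st' : (s < t.+1)%N by [].
by rewrite history_state (_ : s = Ordinal st')// -tnth_nth tnth_mktuple.
Qed.

Lemma chain_input t :
  input A B kappa v t = - (L1 *m col_mx (usubmx (x t)) (eta12 F1 x t))
    - col_mx 0 (L2 *m col_mx (usubmx (dsubmx (x t)) - eta1 F1 x t)
                 (eta3 F1 F2 x t))
    - col_mx 0 (col_mx 0 (L3 *m (dsubmx (dsubmx (x t)) - eta2 F1 x t
                 - eta3 F1 F2 x t))).
Proof.
rewrite /input /kappa /chain_controller (nth_history (leqnn t)).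
have yy s : (s < t)%N -> nth 0 (history A B kappa v t) s = x s.
  by move=> st; rewrite nth_history// ltnW.
by rewrite /eta1 /eta2 (eq_eta12 yy) (eq_eta3 yy) vsubmxK.
Qed.

Let chain_coordinates t :
  x t = z1 t + col_mx 0 (z2 t + col_mx 0 (z3 t)) ->
  eta12 F1 x t = dsubmx (z1 t) -> eta3 F1 F2 x t = dsubmx (z2 t) ->
  [/\ col_mx (usubmx (x t)) (eta12 F1 x t) = z1 t,
      col_mx (usubmx (dsubmx (x t)) - eta1 F1 x t) (eta3 F1 F2 x t) = z2 t
    & dsubmx (dsubmx (x t)) - eta2 F1 x t - eta3 F1 F2 x t = z3 t].
Proof.
move=> IHx IH12 IH3.
have ux : usubmx (x t) = usubmx (z1 t).
  by rewrite IHx linearD /= col_mxKu addr0.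
have dx : dsubmx (x t) = dsubmx (z1 t) + (z2 t + col_mx 0 (z3 t)).
  by rewrite IHx linearD /= col_mxKd.
have e12 : col_mx (usubmx (x t)) (eta12 F1 x t) = z1 t.
  by rewrite ux IH12 vsubmxK.
have e3 : col_mx (usubmx (dsubmx (x t)) - eta1 F1 x t) (eta3 F1 F2 x t) = z2 t.
  rewrite /eta1 dx IH12 IH3 !linearD /= col_mxKu addr0 addrAC subrr add0r.
  exact: vsubmxK.
have z3E : dsubmx (dsubmx (x t)) - eta2 F1 x t - eta3 F1 F2 x t = z3 t.
  by rewrite /eta2 dx IH12 IH3 !linearD /= col_mxKd
    [_ + (_ + _)]addrC addrK addrC addKr.
by split.
Qed.

(** By induction on time, together with the observation that the controller states
    are blocks of the responses: eta1 and eta2 form the lower part of z1, and eta3 is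
    the lower part of z2. The disturbances w2 and w3 are therefore seen only through
    x2 - eta1 and x3 - eta2 - eta3. *)
Lemma chain_closed_loop t :
  [/\ x t = z1 t + col_mx 0 (z2 t + col_mx 0 (z3 t)),
      eta12 F1 x t = dsubmx (z1 t) & eta3 F1 F2 x t = dsubmx (z2 t)].
Proof.
elim: t => [|t [IHx IH12 IH3]].
  by rewrite /x state0 /= col_mx0 addr0 col_mx0 addr0 !linear0.
have [e12 e3 z3E] := chain_coordinates IHx IH12 IH3.
split.
- rewrite /x stateS -/(x t) chain_input e12 e3 z3E IHx /=.
  have -> : v t = head_noise t + col_mx 0 (mid_noise t + col_mx 0 (tail_noise t)).
    by rewrite /head_noise /mid_noise !add_col_mx !(addr0, add0r) !vsubmxK.
  have D2 a b : col_mx 0 (a + b) = col_mx 0 a + col_mx 0 b :> 'cV[K]_(n1 + (n2 + n3)).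
    by rewrite add_col_mx addr0.
  have D3 a b : col_mx 0 (a + b) = col_mx 0 a + col_mx 0 b :> 'cV[K]_(n2 + n3).
    by rewrite add_col_mx addr0.
  have N2 a : col_mx 0 (- a) = - col_mx 0 a :> 'cV[K]_(n1 + (n2 + n3)).
    by rewrite opp_col_mx oppr0.
  have N3 a : col_mx 0 (- a) = - col_mx 0 a :> 'cV[K]_(n2 + n3).
    by rewrite opp_col_mx oppr0.
  have A2 a : A *m col_mx 0 a = col_mx 0 (At *m a).
    by rewrite mul_block_col !mulmx0 mul0mx !add0r.
  have At2 a : At *m col_mx 0 a = col_mx 0 (A33 *m a).
    by rewrite mul_block_col !mulmx0 mul0mx !add0r.
  have B2' a : B *m col_mx 0 a = col_mx 0 (Bt *m a).
    by rewrite mul_block_col !mulmx0 mul0mx !add0r.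
  have Bt2 a : Bt *m col_mx 0 a = col_mx 0 (B3 *m a).
    by rewrite mul_block_col !mulmx0 mul0mx !add0r.
  have -> : z1 t.+1 = A *m z1 t - B *m (L1 *m z1 t) + head_noise t.
    by rewrite mulmxA -mulmxBl.
  have -> : z2 t.+1 = At *m z2 t - Bt *m (L2 *m z2 t) + mid_noise t.
    by rewrite mulmxA -mulmxBl.
  have -> : z3 t.+1 = A33 *m z3 t - B3 *m (L3 *m z3 t) + tail_noise t.
    by rewrite mulmxA -mulmxBl.
  rewrite !(mulmxDr, mulmxN, A2, B2', D3, D2, At2, Bt2, N3, N2).
  move: (A *m z1 t) (B *m (L1 *m z1 t)) (head_noise t).
  move: (col_mx 0 (At *m z2 t)) (col_mx 0 (Bt *m (L2 *m z2 t))) (col_mx 0 (mid_noise t)).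
  move: (col_mx 0 (col_mx 0 (A33 *m z3 t))) (col_mx 0 (col_mx 0 (B3 *m (L3 *m z3 t)))).
  move: (col_mx 0 (col_mx 0 (tail_noise t))) => a b c e f g h k l.
  by apply/matrixP => i j; rewrite !mxE; ring.
- rewrite -[z1 t.+1]/(F1 *m z1 t + head_noise t) /= e12.
  by rewrite [RHS]linearD [X in _ + X]col_mxKd addr0 mul_dsub_mx.
- rewrite -[z2 t.+1]/(F2 *m z2 t + mid_noise t) /= e3.
  by rewrite [RHS]linearD [X in _ + X]col_mxKd addr0 mul_dsub_mx.
Qed.

Lemma chain_closed_loop_input t :
  input A B kappa v t = - (L1 *m z1 t) +
    col_mx 0 (- (L2 *m z2 t) + col_mx 0 (- (L3 *m z3 t))).
Proof.
have [xE x12 x3] := chain_closed_loop t.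
have [e12 e3 z3E] := chain_coordinates xE x12 x3.
have D2 a b : col_mx 0 (a + b) = col_mx 0 a + col_mx 0 b :> 'cV[K]_(m1 + (m2 + m3)).
  by rewrite add_col_mx addr0.
have N2 a : col_mx 0 (- a) = - col_mx 0 a :> 'cV[K]_(m1 + (m2 + m3)).
  by rewrite opp_col_mx oppr0.
have N3 a : col_mx 0 (- a) = - col_mx 0 a :> 'cV[K]_(m2 + m3).
  by rewrite opp_col_mx oppr0.
by rewrite chain_input e12 e3 z3E D2 N3 !N2 !addrA.
Qed.

End closed_loop.

(** * Square-integrable random vectors *)
Section random_vectors.
Context {K : realType} {d : measure_display} {T : measurableType d}.
Variable P : probability T K.
Local Notation mean := (mean P).
Local Notation sqint := (sqint P).

Definition sqintv n (a : T -> 'cV[K]_n) : Prop := forall i, sqint (fun o => a o i 0).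

Definition orthv n m (a : T -> 'cV[K]_n) (b : T -> 'cV[K]_m) : Prop :=
  forall i j, mean (fun o => a o i 0 * b o j 0) = 0.

Lemma sqintv_mulmx n m (M : 'M[K]_(m, n)) a :
  sqintv a -> sqintv (fun o => M *m a o).
Proof.
move=> sa i; under eq_fun do rewrite mxE.
by apply: sqint_sum => j; exact: sqintZ.
Qed.

Lemma sqintvD n (a b : T -> 'cV[K]_n) :
  sqintv a -> sqintv b -> sqintv (fun o => a o + b o).
Proof. by move=> sa sb i; under eq_fun do rewrite mxE; exact: sqintD. Qed.

Lemma sqintvN n (a : T -> 'cV[K]_n) : sqintv a -> sqintv (fun o => - a o).
Proof.
move=> sa i; under eq_fun do rewrite mxE -mulN1r; exact: sqintZ.
Qed.

Lemma sqintv0 n : sqintv (fun=> 0 : 'cV[K]_n).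
Proof. by move=> i; under eq_fun do rewrite mxE; exact: sqint_cst. Qed.

Lemma sqintv_usubmx n m (a : T -> 'cV[K]_(n + m)) :
  sqintv a -> sqintv (fun o => usubmx (a o)).
Proof. by move=> sa i; under eq_fun do rewrite mxE; exact: sa. Qed.

Lemma sqintv_dsubmx n m (a : T -> 'cV[K]_(n + m)) :
  sqintv a -> sqintv (fun o => dsubmx (a o)).
Proof. by move=> sa i; under eq_fun do rewrite mxE; exact: sa. Qed.

Lemma sqintv_col_mx n m (a : T -> 'cV[K]_n) (b : T -> 'cV[K]_m) :
  sqintv a -> sqintv b -> sqintv (fun o => col_mx (a o) (b o)).
Proof.
move=> sa sb i; under eq_fun do rewrite mxE.
by case: splitP => k _; [exact: sa|exact: sb].
Qed.

Lemma intg_bform n m (M : 'M[K]_(n, m)) a b : sqintv a -> sqintv b ->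
  intg P (fun o => bform M (a o) (b o)).
Proof.
move=> sa sb; under eq_fun do rewrite bform_sum.
by do 2 (apply: intg_sum => ?); apply: intgZ; exact: intgM.
Qed.

Lemma mean_bform n m (M : 'M[K]_(n, m)) a b : sqintv a -> sqintv b ->
  mean (fun o => bform M (a o) (b o)) =
  \sum_i \sum_j M i j * mean (fun o => a o i 0 * b o j 0).
Proof.
move=> sa sb; under eq_fun do rewrite bform_sum.
have i1 i j : intg P (fun o => M i j * (a o i 0 * b o j 0)).
  by apply: intgZ; exact: intgM.
rewrite mean_sum => [|i]; last exact: intg_sum.
apply: eq_bigr => i _; rewrite mean_sum//; apply: eq_bigr => j _.
by rewrite meanZ//; exact: intgM.
Qed.

Lemma intg_sqn n (a : T -> 'cV[K]_n) : sqintv a -> intg P (fun o => sqn (a o)).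
Proof. by move=> sa; apply: intg_sum => i; exact: (sa i).2. Qed.

Lemma orthv_bform n m (M : 'M[K]_(n, m)) a b : sqintv a -> sqintv b ->
  orthv a b -> mean (fun o => bform M (a o) (b o)) = 0.
Proof.
move=> sa sb ab; rewrite mean_bform//.
by do 2 (apply: big1 => ? _); rewrite ab mulr0.
Qed.

Lemma orthvC n m (a : T -> 'cV[K]_n) (b : T -> 'cV[K]_m) :
  orthv a b -> orthv b a.
Proof. by move=> ab i j; under eq_fun do rewrite mulrC. Qed.

Lemma orthv_mulmxl n m p (M : 'M[K]_(p, n)) (a : T -> 'cV[K]_n) (b : T -> 'cV[K]_m) :
  sqintv a -> sqintv b -> orthv a b -> orthv (fun o => M *m a o) b.
Proof.
move=> sa sb ab i j.
rewrite (_ : (fun o => _) = fun o => \sum_k M i k * (a o k 0 * b o j 0)).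
  rewrite mean_sum => [|k]; last by apply: intgZ; exact: intgM.
  by apply: big1 => k _; rewrite meanZ ?ab ?mulr0//; exact: intgM.
by apply/funext => o; rewrite mxE mulr_suml; apply: eq_bigr => k _; rewrite mulrA.
Qed.

Lemma orthvDl n m (a a' : T -> 'cV[K]_n) (b : T -> 'cV[K]_m) :
  sqintv a -> sqintv a' -> sqintv b ->
  orthv a b -> orthv a' b -> orthv (fun o => a o + a' o) b.
Proof.
move=> sa sa' sb ab ab' i j; under eq_fun do rewrite mxE mulrDl.
by rewrite meanD ?ab ?ab' ?addr0//; exact: intgM.
Qed.

Lemma orthv0l n m (b : T -> 'cV[K]_m) : orthv (fun=> 0 : 'cV[K]_n) b.
Proof. by move=> i j; under eq_fun do rewrite mxE mul0r; exact: mean_cst. Qed.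

Lemma orthv_mulmxr n m p (M : 'M[K]_(p, m)) (a : T -> 'cV[K]_n) (b : T -> 'cV[K]_m) :
  sqintv a -> sqintv b -> orthv a b -> orthv a (fun o => M *m b o).
Proof. by move=> sa sb ab; apply/orthvC/orthv_mulmxl => //; exact: orthvC. Qed.

Lemma orthvDr n m (a : T -> 'cV[K]_n) (b b' : T -> 'cV[K]_m) :
  sqintv a -> sqintv b -> sqintv b' ->
  orthv a b -> orthv a b' -> orthv a (fun o => b o + b' o).
Proof.
by move=> sa sb sb' ab ab'; apply/orthvC/orthvDl => //; exact: orthvC.
Qed.

Lemma orthv0r n m (a : T -> 'cV[K]_n) : orthv a (fun=> 0 : 'cV[K]_m).
Proof. exact/orthvC/orthv0l. Qed.

(** [riccati_pairing] in expectation, for a subsystem. Here [r] is the coupling from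
    the preceding blocks and [e] the noise, [rq] and [ru] are the cross terms of the
    cost with the preceding blocks. All four are orthogonal to [z], and [om] is orthogonal to
    [y], [u] and [r]; of the last terms only the pairing of [om] with [e] survives. *)
Lemma component_pairing n m (A : 'M[K]_n) (B : 'M[K]_(n, m)) Q R X
    (z om y r e rq : T -> 'cV[K]_n) (u ru : T -> 'cV[K]_m) :
  pos_def R -> psd_stabilizing_riccati A B Q R X ->
  let L := riccati_gain A B R X in
  sqintv z -> sqintv om -> sqintv y -> sqintv r -> sqintv e -> sqintv rq ->
  sqintv u -> sqintv ru ->
  orthv z r -> orthv z e -> orthv z rq -> orthv z ru ->
  orthv om y -> orthv om u -> orthv om r ->
  mean (fun o => dotv (z o) (Q *m y o + rq o) +
                 dotv (- (L *m z o)) (R *m u o + ru o)) =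
  mean (fun o => bform X (z o) (y o)) -
  mean (fun o => bform X ((A - B *m L) *m z o + om o)
                         (A *m y o + B *m u o + (r o + e o))) +
  mean (fun o => bform X (om o) (e o)).
Proof.
move=> pdR ric L sz som sy sr se srq su sru zr ze zrq zru oy ou or_.
set F := A - B *m L.
have sFz := sqintv_mulmx F sz; have sAy := sqintv_mulmx A sy.
have sBu := sqintv_mulmx B su; have sre := sqintvD sr se.
have szp := sqintvD sFz som; have sAB := sqintvD sAy sBu.
have sxp := sqintvD sAB sre; have sABr := sqintvD sAB sr.
have sLz := sqintvN (sqintv_mulmx L sz).
rewrite (_ : (fun o => _) = fun o => (((bform X (z o) (y o)
    - bform X (F *m z o + om o) (A *m y o + B *m u o + (r o + e o)))
    + bform X (om o) (A *m y o + B *m u o + r o)) + bform X (om o) (e o))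
    + (bform X (F *m z o) (r o + e o)
    + (bform 1%:M (z o) (rq o) + bform (- L^T) (z o) (ru o)))).
  have ob : mean (fun o => bform X (om o) (A *m y o + B *m u o + r o)) = 0.
    apply: orthv_bform => //; apply: orthvDr => //.
    by apply: orthvDr => //; exact: orthv_mulmxr.
  have zb : mean (fun o => bform X (F *m z o) (r o + e o)) = 0.
    by apply: orthv_bform => //; apply: orthv_mulmxl => //; exact: orthvDr.
  have zq : mean (fun o => bform 1%:M (z o) (rq o)) = 0 by exact: orthv_bform.
  have zu : mean (fun o => bform (- L^T) (z o) (ru o)) = 0 by exact: orthv_bform.
  have i1 := intg_bform X sz sy; have i2 := intg_bform X szp sxp.
  have i3 := intg_bform X som sABr; have i4 := intg_bform X som se.
  have i5 := intg_bform X sFz sre; have i6 := intg_bform 1%:M sz srq.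
  have i7 := intg_bform (- L^T) sz sru.
  have i12 := intgB i1 i2; have i123 := intgD i12 i3; have i14 := intgD i123 i4.
  have i67 := intgD i6 i7; have i57 := intgD i5 i67.
  rewrite (meanD i14 i57) (meanD i123 i4) (meanD i12 i3) (meanB i1 i2).
  by rewrite (meanD i5 i67) (meanD i6 i7) ob zb zq zu !addr0.
apply/funext => o.
have := @riccati_pairing _ _ _ A B Q R X (y o) (z o) (om o) (r o + e o) (u o) pdR ric.
rewrite -/L -/F /= => H.
have e1 : dotv (z o) (Q *m y o + rq o) = bform Q (z o) (y o) + bform 1%:M (z o) (rq o).
  by rewrite /dotv bformDr -bform_mulmxr mul1mx.
have e2 : dotv (- (L *m z o)) (R *m u o + ru o) =
    bform R (- (L *m z o)) (u o) + bform (- L^T) (z o) (ru o).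
  rewrite /dotv bformDr -bform_mulmxr mul1mx; congr (_ + _).
  by rewrite bformNl bformNm -[L^T]mulmx1 bform_mulmxl.
rewrite e1 e2 addrACA H.
rewrite (_ : bform X (om o) (A *m y o + B *m u o + (r o + e o)) =
  bform X (om o) (A *m y o + B *m u o + r o) + bform X (om o) (e o)); last first.
  by rewrite addrA bformDr.
by ring.
Qed.

End random_vectors.

(** * Linear responses of random inputs *)
Section vector_processes.
Context {K : realType} {d : measure_display} {Omega : measurableType d}.
Variable P : probability Omega K.

Lemma measurable_bform n m (M : 'M[K]_(n, m)) (a : Omega -> 'cV[K]_n) (b : Omega -> 'cV[K]_m) :
  measurable_fun setT a -> measurable_fun setT b ->
  measurable_fun setT (fun o => bform M (a o) (b o)).
Proof.
move=> /measurable_mxP ma /measurable_mxP mb; under eq_fun do rewrite bform_sum.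
apply: measurable_sum => i; apply: measurable_sum => j.
by apply: measurable_funM => //; exact: measurable_funM.
Qed.

Lemma mean_bform_cov n (M C : 'M[K]_n) (a : Omega -> 'cV[K]_n) : sqintv P a ->
  (forall i j, mean P (fun o => a o i 0 * a o j 0) = C i j) ->
  mean P (fun o => bform M (a o) (a o)) = \tr (M *m C).
Proof.
move=> sa aC; rewrite mean_bform// /mxtrace; apply: eq_bigr => i _.
rewrite mxE; apply: eq_bigr => j _; rewrite -aC; congr (_ * mean P _).
by apply/funext => o; rewrite mulrC.
Qed.

Lemma orthv_usubmx n m p (a : Omega -> 'cV[K]_(n + m)) (b : Omega -> 'cV[K]_p) :
  orthv P a b -> orthv P (fun o => usubmx (a o)) b.
Proof. by move=> ab i j; under eq_fun do rewrite mxE; exact: ab. Qed.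

Lemma orthv_dsubmx n m p (a : Omega -> 'cV[K]_(n + m)) (b : Omega -> 'cV[K]_p) :
  orthv P a b -> orthv P (fun o => dsubmx (a o)) b.
Proof. by move=> ab i j; under eq_fun do rewrite mxE; exact: ab. Qed.

Lemma orthv_col_mx n m p (a : Omega -> 'cV[K]_n) (a' : Omega -> 'cV[K]_m)
    (b : Omega -> 'cV[K]_p) :
  orthv P a b -> orthv P a' b -> orthv P (fun o => col_mx (a o) (a' o)) b.
Proof.
move=> ab ab' i j; under eq_fun do rewrite mxE.
by case: splitP => k _; [exact: ab|exact: ab'].
Qed.

Lemma orthv_response n p (F : 'M[K]_n) (om : nat -> Omega -> 'cV[K]_n)
    (b : Omega -> 'cV[K]_p) t : sqintv P b -> (forall s, sqintv P (om s)) ->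
  (forall s, (s < t)%N -> orthv P (om s) b) ->
  sqintv P (fun o => response F (om ^~ o) t) /\
  orthv P (fun o => response F (om ^~ o) t) b.
Proof.
move=> sb som; elim: t => [_|t IH ob] /=.
  by split; [exact: sqintv0|exact: orthv0l].
have [|sr rb] := IH; first by move=> s st; apply: ob; exact: ltnW.
split; first by apply: sqintvD => //; exact: sqintv_mulmx.
apply: orthvDl => //; [exact: sqintv_mulmx|exact: orthv_mulmxl|].
exact: ob.
Qed.

Lemma sqintv_response n (F : 'M[K]_n) (om : nat -> Omega -> 'cV[K]_n) t :
  (forall s, sqintv P (om s)) -> sqintv P (fun o => response F (om ^~ o) t).
Proof.
move=> som; elim: t => [|t IH] /=; first exact: sqintv0.
by apply: sqintvD => //; exact: sqintv_mulmx.
Qed.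

(** The geometric weights of [response_fading] are summable. *)
Lemma response_bounded n (F : 'M[K]_n) (om : nat -> Omega -> 'cV[K]_n) (b : K) :
  schur_stable F -> (forall t, sqintv P (om t)) ->
  (forall t, mean P (fun o => sqn (om t o)) <= b) ->
  exists c : K, forall t, mean P (fun o => sqn (response F (om ^~ o) t)) <= c.
Proof.
move=> stF som omb; have [c c0 [rho r01 fade]] := response_fading stF.
have /andP[r0 r1] := r01.
have b0 : 0 <= b by apply: le_trans (omb 0%N); apply: mean_ge0 => o; exact: sqn_ge0.
exists (c * ((1 - rho)^-1 * b)) => t.
have io s : intg P (fun o => sqn (om s o)) by exact: intg_sqn.
have iro (s : 'I_t) : intg P (fun o => rho ^+ (t.-1 - s) * sqn (om s o)) by exact: intgZ.
have isum : intg P (fun o => \sum_(s < t) rho ^+ (t.-1 - s) * sqn (om s o)).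
  exact: intg_sum.
apply: (@le_trans _ _ (mean P (fun o => c * \sum_(s < t) rho ^+ (t.-1 - s) * sqn (om s o)))).
  apply: mean_le => [||o]; last exact: fade.
    by apply: intg_sqn; exact: sqintv_response.
  exact: intgZ.
rewrite meanZ// ler_wpM2l// mean_sum//.
apply: (@le_trans _ _ (\sum_(s < t) rho ^+ (t.-1 - s) * b)).
  apply: ler_sum => s _; rewrite meanZ// ler_wpM2l//; exact: exprn_ge0.
by rewrite -mulr_suml ler_wpM2r//; exact: geometric_sum_le.
Qed.

End vector_processes.

(** * Information carried by the past of the first blocks *)
Section knowledge.
Context {K : realType} {d : measure_display} {Omega : measurableType d}.
Variables (P : probability Omega K) (n : nat) (W : 'M[K]_n).
Variable w : nat -> Omega -> 'cV[K]_n.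
Hypothesis noise : gaussian_white_noise P W w.

Definition past (b t : nat) : set (nat * 'I_n) :=
  [set p : nat * 'I_n | (p.1 < t)%N /\ (p.2 < b)%N].

(** Measurability with respect to [past b t]. The controllers being nonlinear, this
    is all that remains of the information structure. *)
Definition known (b t : nat) {d'} {T' : measurableType d'} (f : Omega -> T') : Prop :=
  measurable_fun setT (f : g_sigma_algebraType (cylinders w (past b t)) -> T').

Lemma known_mono b t b' t' {d'} {T' : measurableType d'} (f : Omega -> T') :
  (b <= b')%N -> (t <= t')%N -> known b t f -> known b' t' f.
Proof.
move=> bb tt kf _ A mA; have := kf measurableT A mA.
apply: sub_smallest2r; first exact: smallest_sigma_algebra.
move=> B [l Il ->]; exists l => // x /Il[xt xb]; split; first exact: leq_trans tt.
exact: leq_trans bb.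
Qed.

Lemma known_measurable b t {d'} {T' : measurableType d'} (f : Omega -> T') :
  known b t f -> measurable_fun setT f.
Proof.
move=> kf _ A mA; rewrite setTI; apply: (measurable_info noise (I := past b t)).
by have := kf measurableT A mA; rewrite setTI.
Qed.

Lemma known_noise b t k (i : 'I_n) : (k < t)%N -> (i < b)%N ->
  known b t (fun o => w k o i 0).
Proof.
move=> kt ib; apply: (measurability (@RGenInftyO.G K)); first exact: RGenInftyO.measurableE.
move=> _ [_ [c ->] <-]; rewrite setTI; apply: sub_sigma_algebra.
exists [:: (k, i, c)]; first by move=> x; rewrite inE => /eqP ->.
apply/seteqP; split => o /=; rewrite in_itv /=.
  by move=> H x; rewrite inE => /eqP ->.
by move=> /(_ (k, i, c)); rewrite inE eqxx; exact.
Qed.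

(** A noise entry is orthogonal to information from earlier times, and also to
    information of any time from the rows with which it is uncorrelated. *)
Lemma known_orthogonal b t s (j : 'I_n) (phi : Omega -> K) :
  (t <= s)%N \/ (forall i : 'I_n, (i < b)%N -> W i j = 0) ->
  known b t phi -> sqint P phi -> mean P (fun o => w s o j 0 * phi o) = 0.
Proof.
move=> H kphi sphi; apply: (noise_orthogonal noise) kphi sphi => k i [/= kt ib].
case: H => [ts|/(_ i ib)]; [left|by right].
by move=> ks; move: kt; rewrite ks ltnNge ts.
Qed.

Lemma known_entry m b t (f : Omega -> 'cV[K]_m) i :
  known b t f -> known b t (fun o => f o i 0).
Proof. by move=> /measurable_mxP; exact. Qed.

End knowledge.

(** * Admissibility of the chain controller *)
Section chain_controller_admissible.
Context {K : realType}.
Variables (n1 n2 n3 m1 m2 m3 : nat).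
Variables (F1 : 'M[K]_(n1 + (n2 + n3))) (F2 : 'M[K]_(n2 + n3))
  (L1 : 'M[K]_(m1 + (m2 + m3), n1 + (n2 + n3)))
  (L2 : 'M[K]_(m2 + m3, n2 + n3)) (L3 : 'M[K]_(m3, n3)).
Local Notation cVx := 'cV[K]_(n1 + (n2 + n3)).
Local Notation chain := (chain_controller F1 F2 L1 L2 L3).

Section measurability.
Context {d : measure_display} {T : measurableType d}.
Variables (t : nat) (h : T -> t.+1.-tuple cVx).
Hypothesis mh : measurable_fun setT h.

Lemma measurable_nth_tuple s : measurable_fun setT (fun o => nth 0 (h o) s).
Proof.
have [st|ts] := ltnP s t.+1.
  rewrite (_ : (fun o => _) = fun o => tnth (h o) (Ordinal st)).
    exact: (measurable_fun_tnthP _).1 mh (Ordinal st).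
  by apply/funext => o; rewrite (tnth_nth 0).
rewrite (_ : (fun o => _) = fun=> 0); first exact: measurable_cst.
by apply/funext => o; rewrite nth_default// size_tuple.
Qed.

Lemma measurable_eta12 s : measurable_fun setT (fun o => eta12 F1 (nth 0 (h o)) s).
Proof.
elim: s => [|s IH] /=; first exact: measurable_cst.
apply: measurable_mulmx; apply: measurable_col_mx => //.
by apply: measurable_usubmx; exact: measurable_nth_tuple.
Qed.

Lemma measurable_eta3 s : measurable_fun setT (fun o => eta3 F1 F2 (nth 0 (h o)) s).
Proof.
elim: s => [|s IH] /=; first exact: measurable_cst.
apply: measurable_mulmx; apply: measurable_col_mx => //.
apply: measurable_addmx.
  by do 2 apply: measurable_usubmx || apply: measurable_dsubmx; exact: measurable_nth_tuple.
by apply: measurable_oppmx; apply: measurable_usubmx; exact: measurable_eta12.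
Qed.

Lemma measurable_chain_controller : measurable_fun setT (fun o => chain (h o)).
Proof.
rewrite /chain_controller /eta1 /eta2.
have mx := measurable_nth_tuple t; have m12 := measurable_eta12 t.
have meta3 := measurable_eta3 t.
apply: measurable_addmx; first apply: measurable_addmx.
- apply: measurable_oppmx; apply: measurable_mulmx; apply: measurable_col_mx.
    exact: measurable_usubmx.
  by apply: measurable_col_mx; [exact: measurable_usubmx|exact: measurable_dsubmx].
- apply: measurable_oppmx; apply: measurable_col_mx; first exact: measurable_cst.
  apply: measurable_mulmx; apply: measurable_col_mx => //; apply: measurable_addmx.
    by apply: measurable_usubmx; exact: measurable_dsubmx.
  by apply: measurable_oppmx; exact: measurable_usubmx.
- apply: measurable_oppmx; apply: measurable_col_mx; first exact: measurable_cst.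
  apply: measurable_col_mx; first exact: measurable_cst.
  apply: measurable_mulmx; apply: measurable_addmx; last exact: measurable_oppmx.
  apply: measurable_addmx.
    by apply: measurable_dsubmx; exact: measurable_dsubmx.
  by apply: measurable_oppmx; exact: measurable_dsubmx.
Qed.

End measurability.

Section dependence.
Variables (y y' : nat -> cVx).
Hypothesis yy : forall s, usubmx (y s) = usubmx (y' s).

Lemma eta12_head t : eta12 F1 y t = eta12 F1 y' t.
Proof. by elim: t => //= t ->; rewrite yy. Qed.

Lemma eta3_head_mid t : (forall s, usubmx (dsubmx (y s)) = usubmx (dsubmx (y' s))) ->
  eta3 F1 F2 y t = eta3 F1 F2 y' t.
Proof.
by move=> yy2; elim: t => //= t ->; rewrite yy2 /eta1 eta12_head.
Qed.

End dependence.

Lemma usubmxB a b (p q : 'cV[K]_(a + b)) : usubmx (p - q) = usubmx p - usubmx q.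
Proof. exact: linearB. Qed.

Lemma dsubmxB a b (p q : 'cV[K]_(a + b)) : dsubmx (p - q) = dsubmx p - dsubmx q.
Proof. exact: linearB. Qed.

Lemma chain_controller_head t (h h' : t.+1.-tuple cVx) :
  (forall s, usubmx (nth 0 h s) = usubmx (nth 0 h' s)) ->
  usubmx (chain h) = usubmx (chain h').
Proof.
move=> hh; rewrite /chain_controller /eta1 /eta2 hh (eta12_head hh).
by rewrite !usubmxB !col_mxKu.
Qed.

Lemma chain_controller_mid t (h h' : t.+1.-tuple cVx) :
  (forall s, usubmx (nth 0 h s) = usubmx (nth 0 h' s)) ->
  (forall s, usubmx (dsubmx (nth 0 h s)) = usubmx (dsubmx (nth 0 h' s))) ->
  usubmx (dsubmx (chain h)) = usubmx (dsubmx (chain h')).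
Proof.
move=> hh hh2; rewrite /chain_controller /eta1 /eta2 hh hh2 (eta12_head hh).
by rewrite (eta3_head_mid hh _ hh2) !dsubmxB !usubmxB !col_mxKd !col_mxKu.
Qed.

(** Each block of the controller depends only on the permitted blocks of the history,
    so the remaining blocks may be filled with zeros to define the three laws. *)
Lemma chain_controller_admissible : admissible chain.
Proof.
pose e1 t (p : t.+1.-tuple 'cV[K]_n1) : t.+1.-tuple cVx :=
  [tuple col_mx (tnth p i) 0 | i < t.+1].
pose e2 t (p : t.+1.-tuple 'cV[K]_n1 * t.+1.-tuple 'cV[K]_n2) : t.+1.-tuple cVx :=
  [tuple col_mx (tnth p.1 i) (col_mx (tnth p.2 i) 0) | i < t.+1].
pose e3 t (p : t.+1.-tuple 'cV[K]_n1 * t.+1.-tuple 'cV[K]_n2 *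
    t.+1.-tuple 'cV[K]_n3) : t.+1.-tuple cVx :=
  [tuple col_mx (tnth p.1.1 i) (col_mx (tnth p.1.2 i) (tnth p.2 i)) | i < t.+1].
have tn d (T : measurableType d) t n (f : T -> t.+1.-tuple 'cV[K]_n) i :
    measurable_fun setT f -> measurable_fun setT (fun o => tnth (f o) i).
  by move=> mf; exact: (measurable_fun_tnthP _).1 mf i.
have me1 t : measurable_fun setT (e1 t).
  apply/measurable_fun_tnthP => i.
  rewrite (_ : _ \o _ = fun p => col_mx (tnth p i) 0); last first.
    by apply/funext => p; rewrite /= tnth_mktuple.
  by apply: measurable_col_mx => //; apply: tn; exact: measurable_id.
have me2 t : measurable_fun setT (e2 t).
  apply/measurable_fun_tnthP => i.
  rewrite (_ : _ \o _ = fun p => col_mx (tnth p.1 i) (col_mx (tnth p.2 i) 0)); last first.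
    by apply/funext => p; rewrite /= tnth_mktuple.
  apply: measurable_col_mx; first by apply: tn; exact: measurable_fst.
  by apply: measurable_col_mx => //; apply: tn; exact: measurable_snd.
have me3 t : measurable_fun setT (e3 t).
  apply/measurable_fun_tnthP => i.
  rewrite (_ : _ \o _ = fun p => col_mx (tnth p.1.1 i)
      (col_mx (tnth p.1.2 i) (tnth p.2 i))); last first.
    by apply/funext => p; rewrite /= tnth_mktuple.
  apply: measurable_col_mx.
    by apply: tn; apply: measurableT_comp; [exact: measurable_fst|exact: measurable_fst].
  apply: measurable_col_mx; last by apply: tn; exact: measurable_snd.
  by apply: tn; apply: measurableT_comp; [exact: measurable_snd|exact: measurable_fst].
exists (fun t p => usubmx (chain (e1 t p))),
  (fun t p => usubmx (dsubmx (chain (e2 t p)))),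
  (fun t p => dsubmx (dsubmx (chain (e3 t p)))); split.
- by move=> t; apply: measurable_usubmx; exact: measurable_chain_controller (me1 t).
- move=> t; apply: measurable_usubmx; apply: measurable_dsubmx.
  exact: measurable_chain_controller (me2 t).
- move=> t; apply: measurable_dsubmx; apply: measurable_dsubmx.
  exact: measurable_chain_controller (me3 t).
move=> t h h1 h2 h3.
have nthE (f : cVx -> cVx) (k : t.+1.-tuple cVx) s : f 0 = 0 ->
    (forall i, tnth k i = f (tnth h i)) -> nth 0 k s = f (nth 0 h s).
  move=> f0 kf; have [st|ts] := ltnP s t.+1.
    by have := kf (Ordinal st); rewrite !(tnth_nth 0).
  by rewrite !nth_default ?size_tuple// f0.
have E1 s : nth 0 (e1 t h1) s = col_mx (usubmx (nth 0 h s)) 0.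
  apply: (nthE (fun y => col_mx (usubmx y) 0)); first by rewrite linear0 col_mx0.
  by move=> i; rewrite tnth_mktuple tnth_map.
have E2 s : nth 0 (e2 t (h1, h2)) s = col_mx (usubmx (nth 0 h s))
    (col_mx (usubmx (dsubmx (nth 0 h s))) 0).
  apply: (nthE (fun y => col_mx (usubmx y) (col_mx (usubmx (dsubmx y)) 0))).
    by rewrite !linear0 !col_mx0.
  by move=> i; rewrite tnth_mktuple !tnth_map.
have E3 : e3 t (h1, h2, h3) = h.
  by apply: eq_from_tnth => i; rewrite tnth_mktuple !tnth_map /= !vsubmxK.
rewrite E3.
rewrite -(@chain_controller_head t h); last by move=> s; rewrite E1 col_mxKu.
rewrite -(@chain_controller_mid t h); last first.
- by move=> s; rewrite E2 col_mxKd col_mxKu.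
- by move=> s; rewrite E2 col_mxKu.
by rewrite !vsubmxK.
Qed.

End chain_controller_admissible.

(** * Limits of averages *)
Section limits.
Context {K : realType}.

Lemma cvg_add_invn (a c : K) : a + N%:R^-1 * c @[N --> \oo] --> a.
Proof.
rewrite -[X in _ --> X]addr0; apply: cvgD; first exact: cvg_cst.
rewrite -[X in _ --> X](mul0r c); apply: cvgMl.
by rewrite -cvg_shiftS; exact: cvg_harmonic.
Qed.

(** The lower limit of the larger sequence is at least that of the convergent one. The
    index 0 is excluded because the average over no step is 0. *)
Lemma cvg_le_limn_einf (u v : nat -> \bar K) l :
  (forall n, (0 < n)%N -> v n <= u n)%E -> v @ \oo --> l -> (l <= limn_einf u)%E.
Proof.
move=> vu vl; have [<- _] := cvg_limn_einf_sup vl.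
rewrite !limn_einf_lim; apply: lee_lim; [exact: is_cvg_einfs|exact: is_cvg_einfs|].
near=> n; apply: le_ereal_inf_tmp => _ [k /= nk <-].
apply: ge_ereal_inf; exists (v k); first by exists k.
by apply: vu; apply: leq_trans nk; near: n; exact: nbhs_infty_gt.
Unshelve. all: by end_near. Qed.

End limits.

(** * Comparison of an arbitrary strategy with the chain controller *)
Section chain.
Context {K : realType} {d : measure_display} {Omega : measurableType d}.
Variables (P : probability Omega K) (n1 n2 n3 m1 m2 m3 : nat).
Variables (A11 : 'M[K]_n1) (A21 : 'M[K]_(n2, n1)) (A22 : 'M[K]_n2)
  (A32 : 'M[K]_(n3, n2)) (A33 : 'M[K]_n3)
  (B1 : 'M[K]_(n1, m1)) (B2 : 'M[K]_(n2, m2)) (B3 : 'M[K]_(n3, m3))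
  (W1 : 'M[K]_n1) (W2 : 'M[K]_n2) (W3 : 'M[K]_n3).
Local Notation cVx := 'cV[K]_(n1 + (n2 + n3)).
Local Notation cVu := 'cV[K]_(m1 + (m2 + m3)).
Let At : 'M[K]_(n2 + n3) := block_mx A22 0 A32 A33.
Let Bt : 'M[K]_(n2 + n3, m2 + m3) := block_mx B2 0 0 B3.
Let A : 'M[K]_(n1 + (n2 + n3)) := block_mx A11 0 (col_mx A21 0) At.
Let B : 'M[K]_(n1 + (n2 + n3), m1 + (m2 + m3)) := block_mx B1 0 0 Bt.
Let W : 'M[K]_(n1 + (n2 + n3)) := block_mx W1 0 0 (block_mx W2 0 0 W3).
Variable w : nat -> Omega -> cVx.
Hypothesis noise : gaussian_white_noise P W w.

Lemma chain_step_head (x v : cVx) (u : cVu) :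
  usubmx (A *m x + B *m u + v) =
  A11 *m usubmx x + B1 *m usubmx u + usubmx v.
Proof.
rewrite !linearD /=; congr (_ + _ + _).
  by rewrite -{1}[x]vsubmxK mul_block_col mul0mx addr0 col_mxKu.
by rewrite -{1}[u]vsubmxK mul_block_col mul0mx addr0 col_mxKu.
Qed.

Lemma chain_step_rest (x v : cVx) (u : cVu) :
  dsubmx (A *m x + B *m u + v) = At *m dsubmx x + Bt *m dsubmx u +
    (col_mx (A21 *m usubmx x) 0 + dsubmx v).
Proof.
rewrite !linearD /= -{1}[x]vsubmxK -{1}[u]vsubmxK !mul_block_col !col_mxKd.
rewrite mul_col_mx !mul0mx add0r.
move: (col_mx _ _) (At *m _) (Bt *m _) (dsubmx v) => a b c e.
by apply/matrixP => i j; rewrite !mxE; ring.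
Qed.

Lemma chain_step_mid (x v : cVx) (u : cVu) :
  usubmx (dsubmx (A *m x + B *m u + v)) =
  A22 *m usubmx (dsubmx x) + B2 *m usubmx (dsubmx u) +
  (A21 *m usubmx x + usubmx (dsubmx v)).
Proof.
rewrite chain_step_rest !linearD /= col_mxKu; congr (_ + _ + _).
  by rewrite -{1}[dsubmx x]vsubmxK mul_block_col mul0mx addr0 col_mxKu.
by rewrite -{1}[dsubmx u]vsubmxK mul_block_col mul0mx addr0 col_mxKu.
Qed.

Lemma chain_step_tail (x v : cVx) (u : cVu) :
  dsubmx (dsubmx (A *m x + B *m u + v)) =
  A33 *m dsubmx (dsubmx x) + B3 *m dsubmx (dsubmx u) +
  (A32 *m usubmx (dsubmx x) + dsubmx (dsubmx v)).
Proof.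
rewrite chain_step_rest !linearD /= col_mxKd add0r.
rewrite -{1}[dsubmx x]vsubmxK -{1}[dsubmx u]vsubmxK !mul_block_col !col_mxKd.
rewrite mul0mx add0r.
move: (A32 *m _) (A33 *m _) (B3 *m _) (dsubmx (dsubmx v)) => a b c e.
by apply/matrixP => i j; rewrite !mxE; ring.
Qed.

Lemma noise_cov_cross (i j : 'I_(n1 + (n2 + n3))) :
  ((i < n1) && (n1 <= j))%N || ((i < n1 + n2) && (n1 + n2 <= j))%N ->
  W i j = 0.
Proof.
rewrite -(splitK i) -(splitK j); case: (fintype.split i) => k; case: (fintype.split j) => l /=.
- by have := ltn_ord l; lia.
- by rewrite block_mxEur mxE.
- by rewrite block_mxEdl mxE.
rewrite block_mxEdr -(splitK k) -(splitK l).
case: (fintype.split k) => k'; case: (fintype.split l) => l' /=.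
- by have := ltn_ord l'; lia.
- by rewrite block_mxEur mxE.
- by rewrite block_mxEdl mxE.
- by lia.
Qed.

Local Notation known := (known w).

Lemma noise_sqintv s : sqintv P (w s).
Proof. by move=> i; exact: noise_sqint noise s i. Qed.

Lemma noise_known_orth s n (f : Omega -> 'cV[K]_n) b t : (t <= s)%N ->
  known b t f -> sqintv P f -> orthv P (w s) f.
Proof.
move=> ts kf sf i j.
by apply: (known_orthogonal noise) (known_entry j kf) (sf j); left.
Qed.

Lemma mid_known_orth s n (f : Omega -> 'cV[K]_n) t :
  known n1 t f -> sqintv P f -> orthv P (fun o => dsubmx (w s o)) f.
Proof.
move=> kf sf i j; under eq_fun do rewrite mxE.
apply: (known_orthogonal noise) (known_entry j kf) (sf j); right => k kn1.
by apply: noise_cov_cross; rewrite /= kn1 leq_addr.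
Qed.

Lemma tail_known_orth s n (f : Omega -> 'cV[K]_n) t :
  known (n1 + n2) t f -> sqintv P f ->
  orthv P (fun o => dsubmx (dsubmx (w s o))) f.
Proof.
move=> kf sf i j; under eq_fun do rewrite !mxE.
apply: (known_orthogonal noise) (known_entry j kf) (sf j); right => k kn.
by apply: noise_cov_cross => /=; lia.
Qed.

Lemma noise_orth s t : s <> t -> orthv P (w s) (w t).
Proof.
by move=> st i j; rewrite (noise_cov noise); case: eqP => // _; rewrite mulr0n.
Qed.

Variables (Q : 'M[K]_(n1 + (n2 + n3))) (R : 'M[K]_(m1 + (m2 + m3))).
Variables (X1 : 'M[K]_(n1 + (n2 + n3))) (X2 : 'M[K]_(n2 + n3)) (X3 : 'M[K]_n3).
Hypothesis pdR : pos_def R.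
Let Qt := drsubmx Q.
Let Rt := drsubmx R.
Hypothesis ric1 : psd_stabilizing_riccati A B Q R X1.
Hypothesis ric2 : psd_stabilizing_riccati At Bt Qt Rt X2.
Hypothesis ric3 : psd_stabilizing_riccati A33 B3 (drsubmx Qt) (drsubmx Rt) X3.
Let L1 := riccati_gain A B R X1.
Let L2 := riccati_gain At Bt Rt X2.
Let L3 := riccati_gain A33 B3 (drsubmx Rt) X3.
Let F1 := A - B *m L1.
Let F2 := At - Bt *m L2.
Let F3 := A33 - B3 *m L3.
Let om1 t o := head_noise (w ^~ o) t.
Let om2 t o := mid_noise (w ^~ o) t.
Let om3 t o := tail_noise (w ^~ o) t.
Let z1 t o := response F1 (om1 ^~ o) t.
Let z2 t o := response F2 (om2 ^~ o) t.
Let z3 t o := response F3 (om3 ^~ o) t.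

Definition optimal_cost : K :=
  \tr (ulsubmx X1 *m W1) + \tr (ulsubmx X2 *m W2) + \tr (X3 *m W3).

Let sw s : sqintv P (w s) := noise_sqintv s.
Let sdw s : sqintv P (fun o => dsubmx (w s o)) := sqintv_dsubmx (sw s).
Let sddw s : sqintv P (fun o => dsubmx (dsubmx (w s o))) := sqintv_dsubmx (sdw s).
Let sudw s : sqintv P (fun o => usubmx (dsubmx (w s o))) := sqintv_usubmx (sdw s).
Let suw s : sqintv P (fun o => usubmx (w s o)) := sqintv_usubmx (sw s).

Let som1 s : sqintv P (om1 s).
Proof. by apply: sqintv_col_mx => //; exact: sqintv0. Qed.
Let som2 s : sqintv P (om2 s).
Proof. by apply: sqintv_col_mx => //; exact: sqintv0. Qed.
Let som3 s : sqintv P (om3 s). Proof. exact: sddw. Qed.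

Let sz1 t : sqintv P (z1 t). Proof. exact: sqintv_response. Qed.
Let sz2 t : sqintv P (z2 t). Proof. exact: sqintv_response. Qed.
Let sz3 t : sqintv P (z3 t). Proof. exact: sqintv_response. Qed.

Let om1_orth p (b : Omega -> 'cV[K]_p) s : orthv P (w s) b -> orthv P (om1 s) b.
Proof. by move=> wb; apply: orthv_col_mx; [exact: orthv_usubmx|exact: orthv0l]. Qed.
Let om2_orth p (b : Omega -> 'cV[K]_p) s :
  orthv P (fun o => dsubmx (w s o)) b -> orthv P (om2 s) b.
Proof. by move=> wb; apply: orthv_col_mx; [exact: orthv_usubmx|exact: orthv0l]. Qed.

(** The response at time [t] involves the noise strictly before [t]. *)
Let z1_noise t : orthv P (z1 t) (w t).
Proof.
apply: (orthv_response F1 (sw t) som1 _).2 => s st.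
by apply/om1_orth/noise_orth => E; move: st; rewrite E ltnn.
Qed.

Let z2_noise t : orthv P (z2 t) (fun o => dsubmx (w t o)).
Proof.
apply: (orthv_response F2 (sdw t) som2 _).2 => s st.
apply/om2_orth/orthv_dsubmx/orthvC/orthv_dsubmx/noise_orth => E.
by move: st; rewrite E ltnn.
Qed.

Let z3_noise t : orthv P (z3 t) (fun o => dsubmx (dsubmx (w t o))).
Proof.
apply: (orthv_response F3 (sddw t) som3 _).2 => s st.
apply/orthv_dsubmx/orthv_dsubmx/orthvC/orthv_dsubmx/orthv_dsubmx/noise_orth => E.
by move: st; rewrite E ltnn.
Qed.

(** Second-block noise is uncorrelated with the first block at all times, so [f] may
    even be later than [s]. *)
Let z2_known n (f : Omega -> 'cV[K]_n) s t :
  known n1 t f -> sqintv P f -> orthv P (z2 s) f.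
Proof.
move=> kf sf; apply: (orthv_response F2 sf som2 _).2 => r _.
exact/om2_orth/(mid_known_orth r kf sf).
Qed.

Let z3_known n (f : Omega -> 'cV[K]_n) s t :
  known (n1 + n2) t f -> sqintv P f -> orthv P (z3 s) f.
Proof.
move=> kf sf; apply: (orthv_response F3 sf som3 _).2 => r _.
exact: tail_known_orth kf sf.
Qed.

Let cross_cov (i j : 'I_(n1 + (n2 + n3))) s :
  ((i < n1) && (n1 <= j))%N || ((i < n1 + n2) && (n1 + n2 <= j))%N ->
  mean P (fun o => w s o i 0 * w s o j 0) = 0.
Proof. by move=> ij; rewrite (noise_cov noise) eqxx noise_cov_cross. Qed.

Let trace1 t : mean P (fun o => bform X1 (om1 t o) (w t o)) = \tr (ulsubmx X1 *m W1).
Proof.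
rewrite (_ : (fun o => _) = fun o =>
  bform (ulsubmx X1) (usubmx (w t o)) (usubmx (w t o)) +
  bform (ursubmx X1) (usubmx (w t o)) (dsubmx (w t o))); last first.
  by apply/funext => o; rewrite /om1 /head_noise -[X in bform X1 _ X]vsubmxK
    bform_col_mx !bform0l !addr0.
rewrite meanD; try exact: intg_bform.
rewrite [X in _ + X]orthv_bform ?addr0//; last first.
  move=> i j; under eq_fun do rewrite !mxE.
  by apply: cross_cov; rewrite /= ltn_ord leq_addr.
apply: mean_bform_cov => // i j; under eq_fun do rewrite !mxE.
by rewrite (noise_cov noise) eqxx mulr1n block_mxEul.
Qed.

Let trace2 t : mean P (fun o => bform X2 (om2 t o) (dsubmx (w t o))) =
  \tr (ulsubmx X2 *m W2).
Proof.
rewrite (_ : (fun o => _) = fun o =>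
  bform (ulsubmx X2) (usubmx (dsubmx (w t o))) (usubmx (dsubmx (w t o))) +
  bform (ursubmx X2) (usubmx (dsubmx (w t o))) (dsubmx (dsubmx (w t o)))); last first.
  by apply/funext => o; rewrite /om2 /mid_noise -[X in bform X2 _ X]vsubmxK
    bform_col_mx !bform0l !addr0.
rewrite meanD; try exact: intg_bform.
rewrite [X in _ + X]orthv_bform ?addr0//; last first.
  move=> i j; under eq_fun do rewrite !mxE.
  by apply: cross_cov => /=; have := ltn_ord i; lia.
apply: mean_bform_cov => // i j; under eq_fun do rewrite !mxE.
by rewrite (noise_cov noise) eqxx mulr1n block_mxEdr block_mxEul.
Qed.

Let trace3 t : mean P (fun o => bform X3 (om3 t o) (dsubmx (dsubmx (w t o)))) =
  \tr (X3 *m W3).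
Proof.
apply: mean_bform_cov => // i j; under eq_fun do rewrite !mxE.
by rewrite (noise_cov noise) eqxx mulr1n !block_mxEdr.
Qed.

Let xs t o : cVx := z1 t o + col_mx 0 (z2 t o + col_mx 0 (z3 t o)).
Let us t o : cVu := - (L1 *m z1 t o) +
  col_mx 0 (- (L2 *m z2 t o) + col_mx 0 (- (L3 *m z3 t o))).
(** Plays the role of the product of the Riccati solution with the optimal state in
    the centralised problem. *)
Let lam t o : cVx := X1 *m z1 t o +
  col_mx 0 (X2 *m z2 t o + col_mx 0 (X3 *m z3 t o)).

Let pdRt : pos_def Rt. Proof. exact: pos_def_drsubmx. Qed.
Let pdR33 : pos_def (drsubmx Rt). Proof. exact: pos_def_drsubmx. Qed.

Section strategy.
Variable kappa : controller K (n1 + (n2 + n3)) (m1 + (m2 + m3)).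
Hypothesis adm : admissible kappa.
Let x t o := state A B kappa (w ^~ o) t.
Let u t o := input A B kappa (w ^~ o) t.

Let state_known t := [/\ known n1 t (fun o => usubmx (x t o)),
  known (n1 + n2) t (fun o => usubmx (dsubmx (x t o)))
  & known (n1 + (n2 + n3)) t (fun o => dsubmx (dsubmx (x t o)))].

Let input_known t := [/\ known n1 t (fun o => usubmx (u t o)),
  known (n1 + n2) t (fun o => usubmx (dsubmx (u t o)))
  & known (n1 + (n2 + n3)) t (fun o => dsubmx (dsubmx (u t o)))].

Let known_history n (f : cVx -> 'cV[K]_n) b t :
  (forall s, (s <= t)%N -> known b s (fun o => f (x s o))) ->
  known b t (fun o => map_tuple f (history A B kappa (w ^~ o) t)).
Proof.
move=> kf; apply/measurable_fun_tnthP => i.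
rewrite (_ : _ \o _ = fun o => f (x i o)); last first.
  by apply/funext => o /=; rewrite tnth_map history_state tnth_mktuple.
have it : (i <= t)%N by rewrite -ltnS.
exact: known_mono (leqnn b) it (kf i it).
Qed.

Let le12 : (n1 <= n1 + n2)%N. Proof. exact: leq_addr. Qed.
Let le23 : (n1 + n2 <= n1 + (n2 + n3))%N.
Proof. by rewrite addnA leq_addr. Qed.
Let le13 : (n1 <= n1 + (n2 + n3))%N. Proof. exact: leq_addr. Qed.

Let input_known_of t : (forall s, (s <= t)%N -> state_known s) -> input_known t.
Proof.
move=> ks; have [g1 [g2 [g3 [mg1 mg2 mg3 kE]]]] := adm.
have k1 b : (n1 <= b)%N ->
    known b t (fun o => map_tuple (fun y : cVx => usubmx y) (history A B kappa (w ^~ o) t)).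
  move=> nb; apply: known_history => s st; have [H _ _] := ks s st.
  exact: known_mono nb (leqnn s) H.
have k2 b : (n1 + n2 <= b)%N ->
    known b t (fun o => map_tuple (fun y : cVx => usubmx (dsubmx y)) (history A B kappa (w ^~ o) t)).
  move=> nb; apply: known_history => s st; have [_ H _] := ks s st.
  exact: known_mono nb (leqnn s) H.
have k3 : known (n1 + (n2 + n3)) t
    (fun o => map_tuple (fun y : cVx => dsubmx (dsubmx y)) (history A B kappa (w ^~ o) t)).
  by apply: known_history => s st; have [_ _ H] := ks s st.
split.
- rewrite (_ : (fun o => _) = fun o => g1 t (map_tuple (fun y : cVx => usubmx y)
    (history A B kappa (w ^~ o) t))); last first.
    by apply/funext => o; rewrite /u /input kE col_mxKu.
  exact: (measurableT_comp (mg1 t) (k1 _ (leqnn _))).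
- rewrite (_ : (fun o => _) = fun o => g2 t (
    map_tuple (fun y : cVx => usubmx y) (history A B kappa (w ^~ o) t),
    map_tuple (fun y : cVx => usubmx (dsubmx y)) (history A B kappa (w ^~ o) t))); last first.
    by apply/funext => o; rewrite /u /input kE col_mxKd col_mxKu.
  apply: (measurableT_comp (mg2 t)); apply: measurable_fun_pair.
    exact: k1.
  exact: k2.
- rewrite (_ : (fun o => _) = fun o => g3 t (
    map_tuple (fun y : cVx => usubmx y) (history A B kappa (w ^~ o) t),
    map_tuple (fun y : cVx => usubmx (dsubmx y)) (history A B kappa (w ^~ o) t),
    map_tuple (fun y : cVx => dsubmx (dsubmx y)) (history A B kappa (w ^~ o) t))); last first.
    by apply/funext => o; rewrite /u /input kE !col_mxKd.
  apply: (measurableT_comp (mg3 t)); apply: measurable_fun_pair; last exact: k3.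
  by apply: measurable_fun_pair; [exact: k1|exact: k2].
Qed.

(** States and inputs by simultaneous induction: the dynamics send no signal from a
    later block to an earlier one, and each control law reads only its own block and
    the preceding ones. *)
Lemma strategy_known t : state_known t /\ input_known t.
Proof.
suff ks : forall s, (s <= t)%N -> state_known s.
  by split; [exact: ks|exact: input_known_of].
elim: t => [|t IH] s.
  rewrite leqn0 => /eqP ->.
  have x0 : x 0%N = fun=> 0 by apply/funext => o; exact: state0.
  by rewrite /state_known x0; split; exact: measurable_cst.
rewrite leq_eqVlt ltnS => /orP[/eqP ->|/IH//].
have [u1 u2 u3] := input_known_of IH.
have [x1 x2 x3] := IH t (leqnn t).
have up b b' n (f : Omega -> 'cV[K]_n) : (b <= b')%N -> known b t f -> known b' t.+1 f.
  by move=> bb; apply: known_mono => //; exact: leqnSn.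
have xS o : x t.+1 o = A *m x t o + B *m u t o + w t o by exact: stateS.
split.
- rewrite (_ : (fun o => _) = fun o => A11 *m usubmx (x t o) +
    B1 *m usubmx (u t o) + usubmx (w t o)); last first.
    by apply/funext => o; rewrite xS chain_step_head.
  apply: measurable_addmx; first apply: measurable_addmx.
  + by apply: measurable_mulmx; exact: up x1.
  + by apply: measurable_mulmx; exact: up u1.
  + apply/measurable_mxP => i j; rewrite (ord1 j); under eq_fun do rewrite mxE.
    by apply: known_noise => //=.
- rewrite (_ : (fun o => _) = fun o => A22 *m usubmx (dsubmx (x t o)) +
    B2 *m usubmx (dsubmx (u t o)) +
    (A21 *m usubmx (x t o) + usubmx (dsubmx (w t o)))); last first.
    by apply/funext => o; rewrite xS chain_step_mid.
  apply: measurable_addmx; first apply: measurable_addmx.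
  + by apply: measurable_mulmx; exact: up x2.
  + by apply: measurable_mulmx; exact: up u2.
  + apply: measurable_addmx; first by apply: measurable_mulmx; exact: up x1.
    apply/measurable_mxP => i j; rewrite (ord1 j); under eq_fun do rewrite !mxE.
    by apply: known_noise => //=; rewrite ltn_add2l.
- rewrite (_ : (fun o => _) = fun o => A33 *m dsubmx (dsubmx (x t o)) +
    B3 *m dsubmx (dsubmx (u t o)) +
    (A32 *m usubmx (dsubmx (x t o)) + dsubmx (dsubmx (w t o)))); last first.
    by apply/funext => o; rewrite xS chain_step_tail.
  apply: measurable_addmx; first apply: measurable_addmx.
  + by apply: measurable_mulmx; exact: up x3.
  + by apply: measurable_mulmx; exact: up u3.
  + apply: measurable_addmx; first by apply: measurable_mulmx; exact: up x2.
    apply/measurable_mxP => i j; rewrite (ord1 j); under eq_fun do rewrite !mxE.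
    by apply: known_noise => //=; rewrite !ltn_add2l.
Qed.

Let xS t o : x t.+1 o = A *m x t o + B *m u t o + w t o.
Proof. exact: stateS. Qed.

Section one_step.
Variable t : nat.
Hypothesis sx : sqintv P (x t).
Hypothesis su : sqintv P (u t).

Lemma sqintv_stateS : sqintv P (x t.+1).
Proof.
rewrite (_ : x t.+1 = fun o => A *m x t o + B *m u t o + w t o).
  by apply: sqintvD => //; apply: sqintvD; exact: sqintv_mulmx.
by apply/funext => o; exact: xS.
Qed.

Let sux := sqintv_usubmx sx.
Let sdx := sqintv_dsubmx sx.
Let sudx := sqintv_usubmx sdx.
Let sddx := sqintv_dsubmx sdx.
Let suu := sqintv_usubmx su.
Let sdu := sqintv_dsubmx su.
Let sudu := sqintv_usubmx sdu.
Let sddu := sqintv_dsubmx sdu.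

Let xknown := (strategy_known t).1.
Let uknown := (strategy_known t).2.

Let full_known n m (f : Omega -> 'cV[K]_(n + m)) b s :
  known b s (fun o => usubmx (f o)) -> known b s (fun o => dsubmx (f o)) ->
  known b s f.
Proof.
move=> kf kg; rewrite (_ : f = fun o => col_mx (usubmx (f o)) (dsubmx (f o))).
  exact: measurable_col_mx.
by apply/funext => o; rewrite vsubmxK.
Qed.

Lemma state_known_full : known (n1 + (n2 + n3)) t (x t).
Proof.
have [k1 k2 k3] := xknown.
apply: full_known; first exact: known_mono le13 (leqnn t) k1.
by apply: full_known => //; exact: known_mono le23 (leqnn t) k2.
Qed.

Lemma input_known_full : known (n1 + (n2 + n3)) t (u t).
Proof.
have [k1 k2 k3] := uknown.
apply: full_known; first exact: known_mono le13 (leqnn t) k1.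
by apply: full_known => //; exact: known_mono le23 (leqnn t) k2.
Qed.

Let pairing1 :
  mean P (fun o => dotv (z1 t o) (Q *m x t o) +
                   dotv (- (L1 *m z1 t o)) (R *m u t o)) =
  mean P (fun o => bform X1 (z1 t o) (x t o)) -
  mean P (fun o => bform X1 (z1 t.+1 o) (x t.+1 o)) + \tr (ulsubmx X1 *m W1).
Proof.
have s0 n : sqintv P (fun=> 0 : 'cV[K]_n) by exact: sqintv0.
have := component_pairing pdR ric1 (sz1 t) (som1 t) sx (s0 _) (sw t) (s0 _) su (s0 _)
  (orthv0r _ _) (@z1_noise t) (orthv0r _ _) (orthv0r _ _)
  (om1_orth (noise_known_orth (leqnn t) state_known_full sx))
  (om1_orth (noise_known_orth (leqnn t) input_known_full su)) (orthv0r _ _).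
rewrite trace1 /=.
under eq_fun do rewrite !addr0.
move=> ->; congr (_ - mean P _ + _); apply/funext => o.
by rewrite xS add0r.
Qed.

Let pairing2 :
  mean P (fun o => dotv (z2 t o) (Qt *m dsubmx (x t o) + dlsubmx Q *m usubmx (x t o)) +
    dotv (- (L2 *m z2 t o)) (Rt *m dsubmx (u t o) + dlsubmx R *m usubmx (u t o))) =
  mean P (fun o => bform X2 (z2 t o) (dsubmx (x t o))) -
  mean P (fun o => bform X2 (z2 t.+1 o) (dsubmx (x t.+1 o))) +
  \tr (ulsubmx X2 *m W2).
Proof.
have [kx _ _] := xknown; have [ku _ _] := uknown.
pose r o : 'cV[K]_(n2 + n3) := col_mx (A21 *m usubmx (x t o)) 0.
have sr : sqintv P r.
  by apply: sqintv_col_mx; [exact: sqintv_mulmx|exact: sqintv0].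
have kr : known n1 t r.
  by apply: measurable_col_mx => //; exact: measurable_mulmx.
have kq : known n1 t (fun o => dlsubmx Q *m usubmx (x t o)).
  exact: measurable_mulmx.
have kru : known n1 t (fun o => dlsubmx R *m usubmx (u t o)).
  exact: measurable_mulmx.
have sq := sqintv_mulmx (dlsubmx Q) sux; have sru := sqintv_mulmx (dlsubmx R) suu.
have oall n (f : Omega -> 'cV[K]_n) : known (n1 + (n2 + n3)) t f -> sqintv P f ->
    orthv P (om2 t) f.
  by move=> kf sf; apply/om2_orth/orthv_dsubmx/(noise_known_orth (leqnn t) kf sf).
have := component_pairing pdRt ric2 (sz2 t) (som2 t) sdx sr (sdw t) sq sdu sru
  (z2_known t kr sr) (@z2_noise t) (z2_known t kq sq) (z2_known t kru sru)
  (oall _ _ (measurable_dsubmx state_known_full) sdx) (oall _ _ (measurable_dsubmx input_known_full) sdu)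
  (oall _ _ (known_mono le13 (leqnn t) kr) sr).
rewrite trace2 /= => ->; congr (_ - mean P _ + _); apply/funext => o.
by rewrite xS chain_step_rest.
Qed.

Let pairing3 :
  mean P (fun o => dotv (z3 t o) (drsubmx Qt *m dsubmx (dsubmx (x t o)) +
      (dlsubmx Qt *m usubmx (dsubmx (x t o)) + dsubmx (dlsubmx Q *m usubmx (x t o)))) +
    dotv (- (L3 *m z3 t o)) (drsubmx Rt *m dsubmx (dsubmx (u t o)) +
      (dlsubmx Rt *m usubmx (dsubmx (u t o)) + dsubmx (dlsubmx R *m usubmx (u t o))))) =
  mean P (fun o => bform X3 (z3 t o) (dsubmx (dsubmx (x t o)))) -
  mean P (fun o => bform X3 (z3 t.+1 o) (dsubmx (dsubmx (x t.+1 o)))) +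
  \tr (X3 *m W3).
Proof.
have [kx1 kx2 kx3] := xknown; have [ku1 ku2 ku3] := uknown.
have kx12 := known_mono le12 (leqnn t) kx1; have ku12 := known_mono le12 (leqnn t) ku1.
have kr : known (n1 + n2) t (fun o => A32 *m usubmx (dsubmx (x t o))).
  exact: measurable_mulmx.
have sr := sqintv_mulmx A32 sudx.
have kq : known (n1 + n2) t (fun o => dlsubmx Qt *m usubmx (dsubmx (x t o)) +
    dsubmx (dlsubmx Q *m usubmx (x t o))).
  apply: measurable_addmx; first exact: measurable_mulmx.
  by apply: measurable_dsubmx; exact: measurable_mulmx.
have kru : known (n1 + n2) t (fun o => dlsubmx Rt *m usubmx (dsubmx (u t o)) +
    dsubmx (dlsubmx R *m usubmx (u t o))).
  apply: measurable_addmx; first exact: measurable_mulmx.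
  by apply: measurable_dsubmx; exact: measurable_mulmx.
have sq := sqintvD (sqintv_mulmx (dlsubmx Qt) sudx)
  (sqintv_dsubmx (sqintv_mulmx (dlsubmx Q) sux)).
have sru := sqintvD (sqintv_mulmx (dlsubmx Rt) sudu)
  (sqintv_dsubmx (sqintv_mulmx (dlsubmx R) suu)).
have oall n (f : Omega -> 'cV[K]_n) : known (n1 + (n2 + n3)) t f -> sqintv P f ->
    orthv P (om3 t) f.
  by move=> kf sf; apply/orthv_dsubmx/orthv_dsubmx/(noise_known_orth (leqnn t) kf sf).
have := component_pairing pdR33 ric3 (sz3 t) (som3 t) sddx sr (sddw t) sq sddu sru
  (z3_known t kr sr) (@z3_noise t) (z3_known t kq sq) (z3_known t kru sru)
  (oall _ _ kx3 sddx) (oall _ _ ku3 sddu)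
  (oall _ _ (known_mono le23 (leqnn t) kr) sr).
rewrite trace3 /= => ->; congr (_ - mean P _ + _); apply/funext => o.
by rewrite xS chain_step_tail.
Qed.

Let lamE s o : dotv (x s o) (lam s o) =
  bform X1 (z1 s o) (x s o) + bform X2 (z2 s o) (dsubmx (x s o)) +
  bform X3 (z3 s o) (dsubmx (dsubmx (x s o))).
Proof.
have [[sX1 _] _ _] := ric1; have [[sX2 _] _ _] := ric2; have [[sX3 _] _ _] := ric3.
rewrite dotvC /lam !dotvDl !dotv_col_mx0 !dotvDl !dotv_col_mx0 addrA.
by rewrite !(dotvC (_ *m _)) -!bform_dotv; congr (_ + _ + _); exact: bformC.
Qed.

(** The sum of the pairings for the three components. The cost of (xs, us) against
    (x, u) splits along [xs] and [us]; the cross blocks of [Q] and [R] go to the terms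
    [rq] and [ru] of [component_pairing]. *)
Lemma pairing_step :
  mean P (fun o => bform Q (xs t o) (x t o) + bform R (us t o) (u t o)) =
  mean P (fun o => dotv (x t o) (lam t o)) -
  mean P (fun o => dotv (x t.+1 o) (lam t.+1 o)) + optimal_cost.
Proof.
have sxS := sqintv_stateS.
have iL s : sqintv P (x s) -> mean P (fun o => dotv (x s o) (lam s o)) =
    mean P (fun o => bform X1 (z1 s o) (x s o)) +
    mean P (fun o => bform X2 (z2 s o) (dsubmx (x s o))) +
    mean P (fun o => bform X3 (z3 s o) (dsubmx (dsubmx (x s o)))).
  move=> sxs; have sd := sqintv_dsubmx sxs; have sdd := sqintv_dsubmx sd.
  under eq_fun do rewrite lamE.
  have i1 := intg_bform X1 (sz1 s) sxs; have i2 := intg_bform X2 (sz2 s) sd.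
  have i3 := intg_bform X3 (sz3 s) sdd.
  by rewrite (meanD (intgD i1 i2) i3) (meanD i1 i2).
rewrite (iL t sx) (iL t.+1 sxS) /optimal_cost.
rewrite (_ : (fun o => _) = fun o =>
  (dotv (z1 t o) (Q *m x t o) + dotv (- (L1 *m z1 t o)) (R *m u t o)) +
  (dotv (z2 t o) (Qt *m dsubmx (x t o) + dlsubmx Q *m usubmx (x t o)) +
    dotv (- (L2 *m z2 t o)) (Rt *m dsubmx (u t o) + dlsubmx R *m usubmx (u t o))) +
  (dotv (z3 t o) (drsubmx Qt *m dsubmx (dsubmx (x t o)) +
      (dlsubmx Qt *m usubmx (dsubmx (x t o)) + dsubmx (dlsubmx Q *m usubmx (x t o)))) +
    dotv (- (L3 *m z3 t o)) (drsubmx Rt *m dsubmx (dsubmx (u t o)) +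
      (dlsubmx Rt *m usubmx (dsubmx (u t o)) + dsubmx (dlsubmx R *m usubmx (u t o)))))); last first.
  apply/funext => o; rewrite !bform_dotv /xs /us.
  rewrite !dotvDl !dotv_col_mx0 !dotvDl !dotv_col_mx0.
  rewrite !dsubmx_mulmx !linearD /= !dsubmx_mulmx -!addrA.
  ring.
have dI n (a b : Omega -> 'cV[K]_n) : sqintv P a -> sqintv P b ->
    intg P (fun o => dotv (a o) (b o)) by move=> sa sb; exact: intg_bform.
have i1 : intg P (fun o => dotv (z1 t o) (Q *m x t o) + dotv (- (L1 *m z1 t o)) (R *m u t o)).
  by apply: intgD; apply: dI; do ?[exact: sqintv_mulmx | apply: sqintvN].
have i2 : intg P (fun o => dotv (z2 t o) (Qt *m dsubmx (x t o) + dlsubmx Q *m usubmx (x t o)) +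
    dotv (- (L2 *m z2 t o)) (Rt *m dsubmx (u t o) + dlsubmx R *m usubmx (u t o))).
  by apply: intgD; apply: dI; do ?[exact: sqintv_mulmx | apply: sqintvN | apply: sqintvD].
have i3 : intg P (fun o => dotv (z3 t o) (drsubmx Qt *m dsubmx (dsubmx (x t o)) +
      (dlsubmx Qt *m usubmx (dsubmx (x t o)) + dsubmx (dlsubmx Q *m usubmx (x t o)))) +
    dotv (- (L3 *m z3 t o)) (drsubmx Rt *m dsubmx (dsubmx (u t o)) +
      (dlsubmx Rt *m usubmx (dsubmx (u t o)) + dsubmx (dlsubmx R *m usubmx (u t o))))).
  apply: intgD; apply: dI => //; last first.
  - by apply: sqintvD; [exact: sqintv_mulmx|apply: sqintvD; [exact: sqintv_mulmx|apply: sqintv_dsubmx; exact: sqintv_mulmx]].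
  - by apply: sqintvN; exact: sqintv_mulmx.
  - by apply: sqintvD; [exact: sqintv_mulmx|apply: sqintvD; [exact: sqintv_mulmx|apply: sqintv_dsubmx; exact: sqintv_mulmx]].
by rewrite (meanD (intgD i1 i2) i3) (meanD i1 i2) pairing1 pairing2 pairing3; ring.
Qed.

End one_step.

Section finite_horizon.
Variable N : nat.
Hypothesis su : forall t, (t < N)%N -> sqintv P (u t).

Lemma sqintv_state t : (t <= N)%N -> sqintv P (x t).
Proof.
elim: t => [_|t IH tN].
  rewrite (_ : x 0%N = fun=> 0); first exact: sqintv0.
  by apply/funext => o; exact: state0.
by apply: sqintv_stateS; [exact/IH/ltnW|exact: su].
Qed.

(** The pairings telescope, and the initial state is 0. *)
Lemma pairing_sum :
  \sum_(t < N) mean P (fun o => bform Q (xs t o) (x t o) + bform R (us t o) (u t o)) =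
  N%:R * optimal_cost - mean P (fun o => dotv (x N o) (lam N o)).
Proof.
have H t : (t <= N)%N ->
  \sum_(s < t) mean P (fun o => bform Q (xs s o) (x s o) + bform R (us s o) (u s o)) =
  t%:R * optimal_cost - mean P (fun o => dotv (x t o) (lam t o)).
  elim: t => [_|t IH tN].
    rewrite big_ord0 mul0r sub0r (_ : (fun o => _) = fun=> 0) ?mean_cst ?oppr0//.
    by apply/funext => o; rewrite /x state0 /dotv bform0l.
  rewrite big_ord_recr /= IH; last exact: ltnW.
  rewrite pairing_step; [|exact/sqintv_state/ltnW|exact: su].
  rewrite -natr1 mulrDl mul1r; move: optimal_cost => oc.
  move: (mean P _) (mean P _) => a b.
  by rewrite !addrA subrK addrAC.
exact: H.
Qed.

End finite_horizon.

End strategy.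

Let sxs t : sqintv P (xs t).
Proof.
apply: sqintvD => //; apply: sqintv_col_mx; first exact: sqintv0.
apply: sqintvD => //; apply: sqintv_col_mx => //; exact: sqintv0.
Qed.

Let sus t : sqintv P (us t).
Proof.
apply: sqintvD; first by apply: sqintvN; exact: sqintv_mulmx.
apply: sqintv_col_mx; first exact: sqintv0.
apply: sqintvD; first by apply: sqintvN; exact: sqintv_mulmx.
apply: sqintv_col_mx; first exact: sqintv0.
by apply: sqintvN; exact: sqintv_mulmx.
Qed.

Let slam t : sqintv P (lam t).
Proof.
apply: sqintvD; first exact: sqintv_mulmx.
apply: sqintv_col_mx; first exact: sqintv0.
apply: sqintvD; first exact: sqintv_mulmx.
by apply: sqintv_col_mx; [exact: sqintv0|exact: sqintv_mulmx].
Qed.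

Let mean_sqn_noise t : mean P (fun o => sqn (w t o)) = \tr W.
Proof.
rewrite mean_sum => [|i]; last exact: (sw t i).2.
apply: eq_bigr => i _; have := noise_cov noise t t i i.
by rewrite eqxx mulr1n => <-.
Qed.

Let z_bounded : exists c : K, forall t,
  [/\ mean P (fun o => sqn (z1 t o)) <= c, mean P (fun o => sqn (z2 t o)) <= c
    & mean P (fun o => sqn (z3 t o)) <= c].
Proof.
have bnd n (om : nat -> Omega -> 'cV[K]_n) : (forall t, sqintv P (om t)) ->
    (forall t o, sqn (om t o) <= sqn (w t o)) ->
    forall t, mean P (fun o => sqn (om t o)) <= \tr W.
  by move=> som omw t; rewrite -(mean_sqn_noise t); apply: mean_le => //; exact: intg_sqn.
have dw (v : cVx) : sqn v = sqn (usubmx v) + (sqn (usubmx (dsubmx v)) + sqn (dsubmx (dsubmx v))).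
  by rewrite -!sqn_col_mx !vsubmxK.
have [_ _ st1] := ric1; have [_ _ st2] := ric2; have [_ _ st3] := ric3.
have [c1 h1] : exists c : K, forall t, mean P (fun o => sqn (z1 t o)) <= c.
  apply: (response_bounded st1 som1); apply: bnd => // t o.
  rewrite /om1 /head_noise sqn_col_mx sqn0 addr0 [leRHS]dw lerDl.
  by rewrite addr_ge0 ?sqn_ge0.
have [c2 h2] : exists c : K, forall t, mean P (fun o => sqn (z2 t o)) <= c.
  apply: (response_bounded st2 som2); apply: bnd => // t o.
  rewrite /om2 /mid_noise sqn_col_mx sqn0 addr0 [leRHS]dw addrCA lerDl.
  by rewrite addr_ge0 ?sqn_ge0.
have [c3 h3] : exists c : K, forall t, mean P (fun o => sqn (z3 t o)) <= c.
  apply: (response_bounded st3 som3); apply: bnd => // t o.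
  rewrite /om3 /tail_noise [leRHS]dw addrA lerDr.
  by rewrite addr_ge0 ?sqn_ge0.
exists (Num.max c1 (Num.max c2 c3)) => t; split.
- by rewrite (le_trans (h1 t))// le_max lexx.
- by rewrite (le_trans (h2 t))// !le_max lexx orbT.
- by rewrite (le_trans (h3 t))// !le_max lexx !orbT.
Qed.

Let combination_bounded (M1 : 'M[K]_(n1 + (n2 + n3))) (M2 : 'M[K]_(n2 + n3)) (M3 : 'M[K]_n3) :
  exists c : K, forall t, mean P (fun o => sqn (M1 *m z1 t o +
    col_mx 0 (M2 *m z2 t o + col_mx 0 (M3 *m z3 t o)))) <= c.
Proof.
have [c zc] := z_bounded.
have [k1 k10 h1] := sqn_mulmx M1; have [k2 k20 h2] := sqn_mulmx M2.
have [k3 k30 h3] := sqn_mulmx M3.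
exists ((2 * k1 + 4 * k2 + 4 * k3) * c) => t.
have i1 := intg_sqn (sz1 t); have i2 := intg_sqn (sz2 t); have i3 := intg_sqn (sz3 t).
have [b1 b2 b3] := zc t.
apply: (@le_trans _ _ (mean P (fun o => 2 * k1 * sqn (z1 t o) + 4 * k2 * sqn (z2 t o) +
    4 * k3 * sqn (z3 t o)))).
  apply: mean_le => [||o].
  - apply/intg_sqn/sqintvD; first exact: sqintv_mulmx.
    apply: sqintv_col_mx; first exact: sqintv0.
    apply: sqintvD; first exact: sqintv_mulmx.
    by apply: sqintv_col_mx; [exact: sqintv0|exact: sqintv_mulmx].
  - by apply: intgD; [apply: intgD|]; exact: intgZ.
  apply: (le_trans (sqnD _ _)); rewrite sqn_col_mx sqn0 add0r.
  have := sqnD (M2 *m z2 t o) (col_mx 0 (M3 *m z3 t o)).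
  rewrite sqn_col_mx sqn0 add0r.
  have := h1 (z1 t o); have := h2 (z2 t o); have := h3 (z3 t o); lra.
rewrite meanD; [|by apply: intgD; exact: intgZ|exact: intgZ].
rewrite meanD; [|exact: intgZ|exact: intgZ].
rewrite !meanZ// !mulrDl; rewrite !lerD// ler_wpM2l// mulr_ge0//.
Qed.

Let lam_bounded : exists c : K, forall t, mean P (fun o => sqn (lam t o)) <= c.
Proof. exact: combination_bounded. Qed.

Let xs_bounded : exists c : K, forall t, mean P (fun o => sqn (xs t o)) <= c.
Proof.
have [c H] := combination_bounded 1%:M 1%:M 1%:M; exists c => t.
apply: le_trans (H t); rewrite le_eqVlt; apply/orP; left; apply/eqP; congr (mean P _).
by apply/funext => o; rewrite !mul1mx.
Qed.

Let terminal_bounded : exists2 c : K, 0 <= c &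
  forall t, `|mean P (fun o => dotv (xs t o) (lam t o))| <= c.
Proof.
have [c1 h1] := lam_bounded; have [c2 h2] := xs_bounded.
have [k k0 hk] := bform_bound (1%:M : 'M[K]_(n1 + (n2 + n3))).
have c10 : 0 <= c1 by apply: le_trans (h1 0%N); apply: mean_ge0 => o; exact: sqn_ge0.
have c20 : 0 <= c2 by apply: le_trans (h2 0%N); apply: mean_ge0 => o; exact: sqn_ge0.
exists (k * (c2 + c1)); first by rewrite mulr_ge0// addr_ge0.
move=> t; have ix := intg_sqn (sxs t); have il := intg_sqn (slam t).
have id_ : intg P (fun o => dotv (xs t o) (lam t o)) := intg_bform _ (sxs t) (slam t).
have is_ := intgZ k (intgD ix il).
have ub : mean P (fun o => k * (sqn (xs t o) + sqn (lam t o))) <= k * (c2 + c1).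
  rewrite meanZ; last exact: intgD.
  by rewrite meanD// ler_wpM2l// lerD.
rewrite ler_norml; apply/andP; split.
- rewrite lerNl -meanN//; apply: le_trans ub; apply: mean_le => //; first exact: intgN.
  by move=> o; apply: le_trans (hk _ _); rewrite -normrN ler_norm.
- apply: le_trans ub; apply: mean_le => // o.
  by apply: le_trans (hk _ _); rewrite ler_norm.
Qed.

Let kstar : controller K (n1 + (n2 + n3)) (m1 + (m2 + m3)) :=
  chain_controller F1 F2 L1 L2 L3.

Let kstar_adm : admissible kstar. Proof. exact: chain_controller_admissible. Qed.

Let kstar_state t o : state A B kstar (w ^~ o) t = xs t o.
Proof. by have [-> _ _] := chain_closed_loop A11 A21 A22 A32 A33 B1 B2 B3 L1 L2 L3 (w ^~ o) t. Qed.

Let kstar_input t o : input A B kstar (w ^~ o) t = us t o.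
Proof. exact: (chain_closed_loop_input A11 A21 A22 A32 A33 B1 B2 B3 L1 L2 L3 (w ^~ o) t). Qed.

Let stage kappa t o : K :=
  qform Q (state A B kappa (w ^~ o) t) + qform R (input A B kappa (w ^~ o) t).

Let kstar_cost N : \sum_(t < N) mean P (stage kstar t) =
  N%:R * optimal_cost - mean P (fun o => dotv (xs N o) (lam N o)).
Proof.
have su t : (t < N)%N -> sqintv P (fun o => input A B kstar (w ^~ o) t).
  by move=> _ i; under eq_fun do rewrite kstar_input; exact: sus.
have := pairing_sum kstar_adm su.
have -> : (fun o => dotv (state A B kstar (w ^~ o) N) (lam N o)) =
    fun o => dotv (xs N o) (lam N o) by apply/funext => o; rewrite kstar_state.
move=> <-; apply: eq_bigr => t _; congr (mean P _); apply/funext => o.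
by rewrite /stage kstar_state kstar_input.
Qed.

Hypothesis psdQ : pos_semidef Q.

(** Polarisation against the chain controller, whose pairing with any strategy is
    known. The terminal pairing with [lam] of the difference of the two trajectories
    is absorbed by the cost of that difference through Young's inequality with the
    detectability constant [c]. *)
Lemma cost_lower_bound c N kappa : admissible kappa -> 0 < c ->
  (forall (y : nat -> cVx) (v : nat -> cVu), y 0%N = 0 ->
    (forall t, y t.+1 = A *m y t + B *m v t) ->
    forall M, sqn (y M) <= c * \sum_(t < M) (qform Q (y t) + qform R (v t))) ->
  (forall t, (t < N)%N -> sqintv P (fun o => input A B kappa (w ^~ o) t)) ->
  N%:R * optimal_cost - mean P (fun o => dotv (xs N o) (lam N o))
    - c * mean P (fun o => sqn (lam N o)) <= \sum_(t < N) mean P (stage kappa t).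
Proof.
move=> adm c0 detc su.
set x := fun t o => state A B kappa (w ^~ o) t.
set u := fun t o => input A B kappa (w ^~ o) t.
have sx t : (t <= N)%N -> sqintv P (x t) by exact: (sqintv_state su).
have pair := pairing_sum adm su.
have [sQ Q0] := psdQ; have [sR R0] := pos_def_psd pdR.
pose dx t o := x t o - xs t o; pose du t o := u t o - us t o.
have sdx t : (t <= N)%N -> sqintv P (dx t).
  by move=> tN; apply: sqintvD; [exact: sx|exact: sqintvN].
have sdu t : (t < N)%N -> sqintv P (du t).
  by move=> tN; apply: sqintvD; [exact: su|exact: sqintvN].
have sq (n : nat) (M : 'M[K]_n) (a b : 'cV[K]_n) : M^T = M ->
    qform M a = 2 * bform M b a - qform M b + qform M (a - b).
  move=> sM; rewrite !qformE bformDl !bformDr !(bformNl, bformNr) (bformC a b sM).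
  by ring.
have iQ t : (t <= N)%N -> intg P (fun o => bform Q (xs t o) (x t o)).
  by move=> tN; apply: intg_bform; [exact: sxs|exact: sx].
have iR t : (t < N)%N -> intg P (fun o => bform R (us t o) (u t o)).
  by move=> tN; apply: intg_bform; [exact: sus|exact: su].
have iP (t : 'I_N) : intg P (fun o => bform Q (xs t o) (x t o) + bform R (us t o) (u t o)).
  by apply: intgD; [apply: iQ; exact: ltnW|exact: iR].
have iS (t : 'I_N) : intg P (fun o => qform Q (xs t o) + qform R (us t o)).
  by apply: intgD; exact: intg_bform.
have iD (t : 'I_N) : intg P (fun o => qform Q (dx t o) + qform R (du t o)).
  have [s1 s2] := (sdx t (ltnW (ltn_ord t)), sdu t (ltn_ord t)).
  by apply: intgD; exact: intg_bform.
have stageE (t : 'I_N) : mean P (stage kappa t) =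
    2 * mean P (fun o => bform Q (xs t o) (x t o) + bform R (us t o) (u t o)) -
    mean P (stage kstar t) + mean P (fun o => qform Q (dx t o) + qform R (du t o)).
  have -> : stage kstar t = fun o => qform Q (xs t o) + qform R (us t o).
    by apply/funext => o; rewrite /stage kstar_state kstar_input.
  rewrite -meanZ// -meanB//; last exact: intgZ.
  rewrite -meanD//; last by apply: intgB => //; exact: intgZ.
  congr (mean P _); apply/funext => o; rewrite /stage.
  rewrite (sq _ Q (state _ _ _ _ _) (xs t o) sQ) (sq _ R (input _ _ _ _ _) (us t o) sR).
  by rewrite -/(x t o) -/(u t o) -/(dx t o) -/(du t o); ring.
rewrite (eq_bigr _ (fun t _ => stageE t)) big_split sumrB -mulr_sumr /= kstar_cost.
have -> : \sum_(t < N) mean P (fun o => bform Q (xs t o) (x t o) + bform R (us t o) (u t o)) =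
  N%:R * optimal_cost - mean P (fun o => dotv (x N o) (lam N o)) by exact: pair.
have iL : intg P (fun o => dotv (dx N o) (lam N o)).
  by apply: intg_bform => //; exact: sdx.
have iX : intg P (fun o => dotv (xs N o) (lam N o)) by exact: intg_bform.
have -> : mean P (fun o => dotv (x N o) (lam N o)) =
    mean P (fun o => dotv (xs N o) (lam N o)) + mean P (fun o => dotv (dx N o) (lam N o)).
  rewrite -meanD//; congr (mean P _); apply/funext => o.
  by rewrite -dotvDl /dx addrC subrK.
have isum : intg P (fun o => \sum_(t < N) (qform Q (dx t o) + qform R (du t o))).
  exact: intg_sum.
rewrite -mean_sum//.
have ilam := intgZ c (intg_sqn (slam N)).
have key : 2 * mean P (fun o => dotv (dx N o) (lam N o)) <=
    mean P (fun o => \sum_(t < N) (qform Q (dx t o) + qform R (du t o))) +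
    c * mean P (fun o => sqn (lam N o)).
  rewrite -meanZ// -(meanZ c (intg_sqn (slam N))) -meanD//.
  apply: mean_le; [exact: intgZ|exact: intgD|move=> o].
  (* The weight 1/c makes the first Young term the one that detectability bounds. *)
  have ci : 0 < c^-1 by rewrite invr_gt0.
  apply: (le_trans (dotv_young _ _ ci)); rewrite invrK lerD2r.
  rewrite mulrC ler_pdivrMr// mulrC.
  (* The noise cancels in the difference, which for every outcome is a
     trajectory of the deterministic system. *)
  apply: (detc (dx ^~ o) (du ^~ o)).
    by rewrite /dx /x state0 /xs /= col_mx0 addr0 col_mx0 addr0 subr0.
  move=> t; rewrite /dx /du /x stateS -[state A B kappa _ t]/(x t o).
  rewrite -kstar_state stateS kstar_state kstar_input !mulmxBr.
  rewrite -[input A B kappa _ t]/(u t o).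
  move: (A *m _) (A *m _) (B *m _) (B *m _) (w t o) => a b e f g.
  by apply/matrixP => i j; rewrite !mxE; ring.
move: key; move: (mean P _) (mean P _) (mean P _) (mean P _) => a b e f; lra.
Qed.

Let cost kappa N o : K := \sum_(t < N) stage kappa t o.

Let average_costE kappa N : average_cost P A B Q R w kappa N =
  ((N%:R^-1)%:E * \int[P]_o (cost kappa N o)%:E)%E.
Proof. by rewrite /average_cost unlock. Qed.

Let stage_ge0 kappa t o : 0 <= stage kappa t o.
Proof. by rewrite addr_ge0 ?psdQ.2 ?(pos_def_psd pdR).2. Qed.

Let measurable_input kappa t : admissible kappa ->
  measurable_fun setT (fun o => input A B kappa (w ^~ o) t).
Proof. by move=> adm; apply: (known_measurable noise); exact: (input_known_full adm). Qed.

Let measurable_stage kappa t : admissible kappa -> measurable_fun setT (stage kappa t).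
Proof.
move=> adm; apply: measurable_funD; apply: measurable_bform.
- by apply: (known_measurable noise); exact: (state_known_full adm).
- by apply: (known_measurable noise); exact: (state_known_full adm).
- exact: measurable_input.
- exact: measurable_input.
Qed.

Let measurable_cost kappa N : admissible kappa -> measurable_fun setT (cost kappa N).
Proof. by move=> adm; apply: measurable_sum => t; exact: measurable_stage. Qed.

Let finite_cost_sqintv kappa N : admissible kappa -> intg P (cost kappa N) ->
  forall t, (t < N)%N -> intg P (stage kappa t) /\
    sqintv P (fun o => input A B kappa (w ^~ o) t).
Proof.
move=> adm ic t tN.
have le_stage o : stage kappa t o <= cost kappa N o.
  by rewrite /cost (bigD1 (Ordinal tN))//= lerDl sumr_ge0.
have is_ : intg P (stage kappa t).
  apply: intg_dom ic _; first exact: measurable_stage.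
  by move=> o; rewrite ger0_norm.
split=> // i; have mu := (measurable_mxP _).1 (measurable_input t adm) i 0.
split=> //; have [c c0 coer] := pos_def_coercive pdR.
apply: intg_dom (intgZ c is_) _; first exact: measurable_funX.
move=> o; rewrite ger0_norm ?sqr_ge0//.
apply: (@le_trans _ _ (sqn (input A B kappa (w ^~ o) t))).
  by rewrite /sqn (bigD1 i)//= lerDl sumr_ge0// => j _; exact: sqr_ge0.
by apply: (le_trans (coer _)); rewrite ler_wpM2l// lerDr psdQ.2.
Qed.

Let mean_cost kappa N : (forall t, (t < N)%N -> intg P (stage kappa t)) ->
  average_cost P A B Q R w kappa N =
  (N%:R^-1 * \sum_(t < N) mean P (stage kappa t))%:E.
Proof.
move=> is_; have is' (t : 'I_N) : intg P (stage kappa t) by exact: is_.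
by rewrite average_costE -EFin_mean ?mean_sum//; exact: intg_sum.
Qed.

Lemma kstar_average_cost :
  average_cost P A B Q R w kstar @ \oo --> optimal_cost%:E.
Proof.
have [c c0 term] := terminal_bounded.
have is_ t : intg P (stage kstar t).
  rewrite (_ : stage kstar t = fun o => qform Q (xs t o) + qform R (us t o)).
    by apply: intgD; exact: intg_bform.
  by apply/funext => o; rewrite /stage kstar_state kstar_input.
apply/fine_cvgP; split.
  by apply: nearW => N; rewrite mean_cost.
apply: (@squeeze_cvgr _ _ _ _ (fun N => optimal_cost - N%:R^-1 * c)
  (fun N => optimal_cost + N%:R^-1 * c)).
- near=> N; have N0 : (0 < N)%N by near: N; exact: nbhs_infty_gt.
  have N0' : N%:R != 0 :> K by rewrite pnatr_eq0 -lt0n.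
  rewrite /= mean_cost//= kstar_cost mulrBr mulKf//.
  have := term N; rewrite ler_norml => /andP[h1 h2].
  have Ni : 0 <= N%:R^-1 :> K by rewrite invr_ge0.
  by have := ler_wpM2l Ni h1; have := ler_wpM2l Ni h2; rewrite mulrN => *; apply/andP; split; lra.
- by under eq_fun do rewrite -mulrN; exact: cvg_add_invn.
- exact: cvg_add_invn.
Unshelve. all: by end_near. Qed.

Hypothesis detQ : detectable Q A.

(** Up to a bounded error, [cost_lower_bound] gives N times the optimal cost; the case
    of infinite expected cost is separate. *)
Lemma average_cost_lower_bound kappa : admissible kappa ->
  (optimal_cost%:E <= limn_einf (average_cost P A B Q R w kappa))%E.
Proof.
move=> adm; have [c c0 detc] := detectable_bound B psdQ pdR detQ.
have [k k0 term] := terminal_bounded; have [l lamb] := lam_bounded.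
apply: (@cvg_le_limn_einf _ _ (fun N => (optimal_cost + N%:R^-1 * - (k + c * l))%:E)).
  move=> N N0; have N0' : N%:R != 0 :> K by rewrite pnatr_eq0 -lt0n.
  have Ni : 0 < N%:R^-1 :> K by rewrite invr_gt0 ltr0n.
  have cost_ge0 o : 0 <= cost kappa N o by rewrite sumr_ge0.
  have [fin|inf] := ltP (\int[P]_o (cost kappa N o)%:E)%E +oo%E; last first.
    rewrite average_costE (_ : integral _ _ _ = +oo%E).
      by rewrite gt0_muley ?lte_fin// leey.
    by apply/eqP; rewrite -leye_eq.
  have ic := ge0_intg (measurable_cost N adm) cost_ge0 fin.
  have fc := finite_cost_sqintv adm ic.
  rewrite mean_cost => [|t tN]; last exact: (fc t tN).1.
  have := cost_lower_bound adm c0 detc (fun t tN => (fc t tN).2).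
  have := term N; rewrite ler_norml => /andP[_ h1].
  have h2 := ler_wpM2l (ltW c0) (lamb N).
  move=> /(ler_wpM2l (ltW Ni)) h3; rewrite lee_fin; apply: le_trans h3.
  move: h1 h2; set a := mean P (fun o => dotv _ _).
  set b := mean P (fun o => sqn _); move: optimal_cost a b => oc a b h1 h2.
  have -> : N%:R^-1 * (N%:R * oc - a - c * b) = oc + N%:R^-1 * (- a - c * b).
    by field.
  by rewrite lerD2l ler_pM2l//; lra.
by apply: cvg_EFin; [exact: nearW|exact: cvg_add_invn].
Qed.

Lemma chain_controller_optimal :
  [/\ admissible kstar,
      average_cost P A B Q R w kstar @ \oo --> optimal_cost%:E
    & forall kappa, admissible kappa ->
        (optimal_cost%:E <= limn_einf (average_cost P A B Q R w kappa))%E].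
Proof.
split; [exact: kstar_adm|exact: kstar_average_cost|].
exact: average_cost_lower_bound.
Qed.

End chain.

Theorem theorem2 (K : realType) (d : measure_display)
    (Omega : measurableType d) (P : probability Omega K)
    (n1 n2 n3 m1 m2 m3 : nat)
    (A11 : 'M[K]_n1) (A21 : 'M[K]_(n2, n1)) (A22 : 'M[K]_n2)
    (A32 : 'M[K]_(n3, n2)) (A33 : 'M[K]_n3)
    (B1 : 'M[K]_(n1, m1)) (B2 : 'M[K]_(n2, m2)) (B3 : 'M[K]_(n3, m3))
    (W1 : 'M[K]_n1) (W2 : 'M[K]_n2) (W3 : 'M[K]_n3)
    (Q : 'M[K]_(n1 + (n2 + n3))) (R : 'M[K]_(m1 + (m2 + m3)))
    (w : nat -> Omega -> 'cV[K]_(n1 + (n2 + n3)))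
    (X1 : 'M[K]_(n1 + (n2 + n3))) (X2 : 'M[K]_(n2 + n3)) (X3 : 'M[K]_n3) :
  let A : 'M[K]_(n1 + (n2 + n3)) :=
    block_mx A11 0 (col_mx A21 0) (block_mx A22 0 A32 A33) in
  let B : 'M[K]_(n1 + (n2 + n3), m1 + (m2 + m3)) :=
    block_mx B1 0 0 (block_mx B2 0 0 B3) in
  let W : 'M[K]_(n1 + (n2 + n3)) :=
    block_mx W1 0 0 (block_mx W2 0 0 W3) in
  let At := drsubmx A in
  let Bt := drsubmx B in
  let Qt := drsubmx Q in
  let Rt := drsubmx R in
  let Q33 := drsubmx Qt in
  let R33 := drsubmx Rt in
  let L1 := riccati_gain A B R X1 in
  let L2 := riccati_gain At Bt Rt X2 in
  let L3 := riccati_gain A33 B3 R33 X3 in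
  let kappa := chain_controller (A - B *m L1) (At - Bt *m L2) L1 L2 L3 in
  let optimal_cost :=
    \tr (ulsubmx X1 *m W1) + \tr (ulsubmx X2 *m W2) + \tr (X3 *m W3) in
  gaussian_white_noise P W w ->
  pos_semidef Q ->
  pos_def R ->
  [/\ stabilizable A B, stabilizable At Bt & stabilizable A33 B3] ->
  [/\ detectable Q A, detectable Qt At & detectable Q33 A33] ->
  psd_stabilizing_riccati A B Q R X1 ->
  psd_stabilizing_riccati At Bt Qt Rt X2 ->
  psd_stabilizing_riccati A33 B3 Q33 R33 X3 ->
  [/\ admissible kappa,
      average_cost P A B Q R w kappa @ \oo --> optimal_cost%:E
    & forall kappa' : controller K (n1 + (n2 + n3)) (m1 + (m2 + m3)),
        admissible kappa' ->
        (optimal_cost%:E <= limn_einf (average_cost P A B Q R w kappa'))%E].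
Proof.
move=> A B W At Bt Qt Rt Q33 R33 L1 L2 L3 kappa optimal_cost.
have AtE : At = block_mx A22 0 A32 A33 by exact: block_mxKdr.
have BtE : Bt = block_mx B2 0 0 B3 by exact: block_mxKdr.
rewrite /kappa /L2 AtE BtE => noise psdQ pdR _ [detQ _ _] ric1 ric2 ric3.
exact: (chain_controller_optimal noise pdR ric1 ric2 ric3 psdQ detQ).
Qed.
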